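(* Let $m\ge1$ be an integer, $\tau>0$, $C_0\in\mathbb R$. Consider an $s$-stage Runge-Kutta method with real coefficients $a_{ij},b_i$ ($i,j=1,\dots,s$) that is symplectic, i.e. $b_ia_{ij}+b_ja_{ji}=b_ib_j$ for all $i,j=1,\dots,s$. (1) Applied with time step $\tau$ to the reformulated generalized Benjamin-Ono system for $(u(x,t),v(t))$, $x\in\mathbb R$, $$u_t=-\Big(-\mathcal H u_x+\frac1m\frac{u^m v}{\sqrt{\langle u^m,u\rangle+C_0}}\Big)_x,\qquad v_t=\frac{m+1}{2\sqrt{\langle u^m,u\rangle+C_0}}\langle u^m,u_t\rangle,$$ with $v(0)=\sqrt{\langle u_0^m,u_0\rangle+C_0}$, $u(\cdot,0)=u_0$, the method conserves the $L^1$-type integral $I^n=\int_{\mathbb R}u^n\,dx$, the mass $M^n=\int_{\mathbb R}(u^n)^2dx$ and the modified energy $E^n=\frac12\langle\mathcal H u^n_x,u^n\rangle-\frac1{m(m+1)}\big((v^n)^2-C_0\big)$: $$I^{n+1}=I^n,\qquad M^{n+1}=M^n,\qquad E^{n+1}=E^n.$$ (2) Furthermore, applied with time step $\tau$ to the spatially semi-discretized system for $(\mathbf u,v_h)$ $$\mathbf u_t=-\mathbf P^{-1}\mathbf F^{-1}\mathbf S_1\mathbf F\mathbf P\Big(-\mathbf P^{-1}\mathbf F^{-1}\mathbf H\mathbf S_1\mathbf F\mathbf P\,\mathbf u+\frac1m\frac{\mathbf u^{\mathbf m}v_h}{\sqrt{\langle\mathbf u^{\mathbf m},\mathbf u\rangle_h+C_0}}\Big),\qquad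 (v_h)_t=\frac{m+1}{2\sqrt{\langle\mathbf u^{\mathbf m},\mathbf u\rangle_h+C_0}}\langle\mathbf u^{\mathbf m},\mathbf u_t\rangle_h,$$ with initial data $\mathbf u^0$ and $v_h^0=\sqrt{\langle(\mathbf u^0)^{\mathbf m},\mathbf u^0\rangle_h+C_0}$, the method preserves the discrete modified energy $$E_h^n=\tfrac12\langle\mathbf P^{-1}\mathbf F^{-1}\mathbf H\mathbf S_1\mathbf F\mathbf P\,\mathbf u^n,\mathbf u^n\rangle_h-\tfrac1{m(m+1)}\big((v_h^n)^2-C_0\big),$$ that is, $E_h^n=E_h^{n-1}=\cdots=E_h^0$.
   Context: All functions and vectors are real-valued. $\langle u,v\rangle=\int_{\mathbb R}u\bar v\,dx$, and $\mathcal H$ is the Hilbert transform, $\widehat{\mathcal H f}(\xi)=-i\,\mathrm{sgn}(\xi)\hat f(\xi)$. The system in (1) reformulates the generalized Benjamin-Ono equation $u_t=-(-\mathcal H u_x+\frac1mu^m)_x$ using $v=\sqrt{\langle u^m,u\rangle+C_0}$. Standing assumptions: $C_0$ is chosen so that the quantities under the square roots are positive (initially and at all Runge-Kutta intermediate values). In (1), the functions $u^n$ and the intermediate values $U_i$ are smooth and decay at infinity sufficiently for the integrals to make sense and for integration by parts without boundary terms (for instance in all Sobolev spaces $H^k(\mathbb R)$, with the integral $I$ of $u^n$ existing as an improper integral). Runge-Kutta method. For a system $y_t=G(y)$, one step from $y^n$ to $y^{n+1}$ consists of intermediate values $Y_1,\dots,Y_s$ satisfying $Y_i=y^n+\tau\sum_{j=1}^sa_{ij}G(Y_j)$,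 and $y^{n+1}=y^n+\tau\sum_{i=1}^sb_iG(Y_i)$. Here $y=(u,v)$ or $y=(\mathbf u,v_h)$, and $u_t$ (resp. $\mathbf u_t$) in the second equation of each system denotes the right-hand side of the first. The claims concern any such steps, for which the intermediate values exist. Discretization. Let $\alpha>0$, $N$ a positive even integer, $J=\{-N/2,\dots,N/2-1\}$; vectors and matrices are indexed by $J$. Put $\theta_j=2\pi j/N$, $x_j=\alpha\tan(\theta_j/2)$, so $x_{-N/2}=-\infty$. Define: - $\mathbf F_{kj}=\frac1N e^{-ik\theta_j}$ and $(\mathbf F^{-1})_{jk}=e^{ik\theta_j}$ (discrete Fourier matrix and its inverse); - $\mathbf P=\mathrm{diag}(\alpha-ix_j)_{j\in J}$ and $\mathbf W=\mathbf P\overline{\mathbf P}=\mathrm{diag}(w_j)$, $w_j=\alpha^2+x_j^2$; - $\mathbf S_1$ the tridiagonal matrix $(\mathbf S_1\hat{\mathbf u})_k=\frac{i}{2\alpha}\big[k\hat u_{k-1}+(2k+1)\hat u_k+(k+1)\hat u_{k+1}\big]$, where $\hat u_{k}:=0$ for $k\notin J$; - $\mathbf H=-i\,\mathrm{diag}(\mathrm{sgn}(k+\tfrac12))_{k\in J}$. Boundary convention at the node $x_{-N/2}=-\infty$: all grid vectors $\mathbf u=(u_j)_{j\in J}$ (including intermediate values) satisfy $u_{-N/2}=0$, and this node contributes nothing; i.e. the $-N/2$ diagonal entries of $\mathbf P$, $\mathbf P^{-1}$ and $\mathbf W$ are read as $0$ (the other diagonal entries of $\mathbf P^{-1}$ are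 $1/(\alpha-ix_j)$). The discrete inner product is $\langle\mathbf u,\mathbf v\rangle_h=\frac{\pi}{N\alpha}\overline{\mathbf v}^T\mathbf W\mathbf u=\frac{\pi}{N\alpha}\sum_{j\in J} w_ju_j\bar v_j$. Powers $\mathbf u^{\mathbf p}=(u_j^p)_j$ are entrywise. *)

(* Defs.v *)
From HB Require Import structures.
From mathcomp Require Import all_boot all_order all_algebra.
From mathcomp Require Import complex.
From mathcomp Require Import all_classical all_reals all_analysis.

Set Implicit Arguments.
Unset Strict Implicit.
Unset Printing Implicit Defensive.

Import Order.TTheory GRing.Theory Num.Theory.
Import numFieldNormedType.Exports.

Local Open Scope classical_set_scope.
Local Open Scope ring_scope.
Local Open Scope complex_scope.

Definition symplectic (R : pzRingType) (s : nat) (a : 'M[R]_s) (b : 'rV[R]_s) :=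
  forall i j, b 0 i * a i j + b 0 j * a j i = b 0 i * b 0 j.

(** One step of size [tau] for [y_t = G y], from [y0] to [y1], with
    intermediate values [Y]. *)
Definition rk_step (K : pzRingType) (E : lmodType K) (s : nat)
    (a : 'M[K]_s) (b : 'rV[K]_s) (tau : K) (G : E -> E)
    (y0 : E) (Y : 'I_s -> E) (y1 : E) : Prop :=
  (forall i, Y i = y0 + tau *: \sum_j a i j *: G (Y j)) /\
  y1 = y0 + tau *: \sum_i b 0 i *: G (Y i).

(** [\int_(-A)^A f(x) e^(- i x xi) dx]; the Lebesgue integral of the library is
    real-valued, so the real and imaginary parts are given separately. *)
Definition fourier_trunc (R : realType) (f : R -> R) (A xi : R) : R[i] :=
  let mu := @lebesgue_measure R in
  (\int[mu]_(x in `[- A, A]) (f x * cos (x * xi)))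
  -i* (\int[mu]_(x in `[- A, A]) (f x * sin (x * xi))).

Definition sqnormc (R : realType) (z : R[i]) : R :=
  complex.Re z ^+ 2 + complex.Im z ^+ 2.

(** [F] is the Fourier-Plancherel transform of the (real) L^2 function [f]: the
    limit in L^2, as [A] tends to infinity, of the truncated Fourier integrals.
    It is determined by [f] up to a null set. *)
Definition is_fourier (R : realType) (f : R -> R) (F : R -> R[i]) : Prop :=
  let mu := @lebesgue_measure R in
  [/\ f \in Lfun mu 2%:E,
      (fun xi => complex.Re (F xi)) \in Lfun mu 2%:E,
      (fun xi => complex.Im (F xi)) \in Lfun mu 2%:E &
      (\int[mu]_xi (sqnormc (fourier_trunc f A xi - F xi))%:E)%E
        @[A --> +oo] --> 0%E].

Definition is_hilbert (R : realType) (f g : R -> R) : Prop :=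
  exists2 F : R -> R[i],
    is_fourier f F & is_fourier g (fun xi => - 'i%C * (Num.sg xi)%:C * F xi).

(** As an element of L^2 the Hilbert transform is defined up to a null set;
    [hilbert f] is its continuous representative (unique when it exists, and it
    exists when [f] is in H^1). *)
Definition hilbert (R : realType) (f : R -> R) : R -> R :=
  xget (cst 0) [set g | continuous g /\ is_hilbert f g].

(** The (smooth representatives of the) elements of all the Sobolev spaces
    H^k(R). *)
Definition sobolev_oo (R : realType) (f : R -> R) : Prop :=
  (forall (k : nat) (x : R), derivable (derive1n k f) x 1) /\
  (forall k : nat, derive1n k f \in Lfun (@lebesgue_measure R) 2%:E).

(** [\int_p^q f], to be considered as [p] and [q] tend to [-oo] and [+oo]
    independently of each other. *)
Definition integral_seg (R : realType) (f : R -> R) (p : R * R) : R :=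
  \int[@lebesgue_measure R]_(x in `[p.1, p.2]) f x.

Definition improper_integrable (R : realType) (f : R -> R) : Prop :=
  cvg (integral_seg f p @[p --> filter_prod (-oo : set_system R) +oo]).

Definition improper_integral (R : realType) (f : R -> R) : R :=
  lim (integral_seg f p @[p --> filter_prod (-oo : set_system R) +oo]).

Definition ip (R : realType) (f g : R -> R) : R :=
  \int[@lebesgue_measure R]_x (f x * g x).

Definition radicand (R : realType) (m : nat) (C0 : R) (u : R -> R) : R :=
  ip (fun x => u x ^+ m) u + C0.

Definition gbo_rhs (R : realType) (m : nat) (C0 : R) (y : (R -> R) * R) :
    (R -> R) * R :=
  let u := y.1 in
  let v := y.2 in
  let c := Num.sqrt (radicand m C0 u) in
  let flux := fun x => - hilbert (derive1 u) x + m%:R^-1 * (u x ^+ m * v / c) in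
  let u_t := fun x => - derive1 flux x in
  (u_t, m.+1%:R / (2 * c) * ip (fun x => u x ^+ m) u_t).

Definition mass (R : realType) (u : R -> R) : R :=
  \int[@lebesgue_measure R]_x (u x ^+ 2).

Definition energy (R : realType) (m : nat) (C0 : R) (y : (R -> R) * R) : R :=
  2^-1 * ip (hilbert (derive1 y.1)) y.1 - (m * m.+1)%:R^-1 * (y.2 ^+ 2 - C0).

(** The index set [J = {- N/2, ..., N/2 - 1}] is represented by ['I_N]: the
    ordinal [i] stands for the index [i - N/2]. *)
Definition jdx (N : nat) (i : 'I_N) : int := i%:Z - (N./2)%:Z.

(** The ordinal of the node at infinity, i.e. of the index [- N/2]. *)
Definition at_infty (N : nat) (i : 'I_N) : bool := val i == 0%N.

Definition theta (R : realType) (N : nat) (i : 'I_N) : R :=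
  2 * pi * (jdx i)%:~R / N%:R.

(** At the node at infinity the value is irrelevant. *)
Definition node (R : realType) (alpha : R) (N : nat) (i : 'I_N) : R :=
  alpha * tan (theta R i / 2).

Definition cis (R : realType) (t : R) : R[i] := cos t +i* sin t.

Definition dftmx (R : realType) (N : nat) : 'M[R[i]]_N :=
  \matrix_(k, j) (N%:R^-1 * cis (- ((jdx k)%:~R * theta R j))).

Definition idftmx (R : realType) (N : nat) : 'M[R[i]]_N :=
  \matrix_(j, k) cis ((jdx k)%:~R * theta R j).

Definition Pmx (R : realType) (alpha : R) (N : nat) : 'M[R[i]]_N :=
  diag_mx (\row_j if at_infty j then 0 else alpha -i* node alpha j).

(** Not the matrix inverse: the entry at infinity is [0] here and in [Pmx]. *)
Definition Pinvmx (R : realType) (alpha : R) (N : nat) : 'M[R[i]]_N :=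
  diag_mx (\row_j if at_infty j then 0 else (alpha -i* node alpha j)^-1).

Definition Wmx (R : realType) (alpha : R) (N : nat) : 'M[R[i]]_N :=
  Pmx alpha N *m map_mx conjc (Pmx alpha N).

Definition S1mx (R : realType) (alpha : R) (N : nat) : 'M[R[i]]_N :=
  \matrix_(k, l) ('i%C / (2 * alpha%:C) *
    (if jdx l == jdx k - 1 then (jdx k)%:~R
     else if jdx l == jdx k then (2 * jdx k + 1)%:~R
     else if jdx l == jdx k + 1 then (jdx k + 1)%:~R
     else 0)).

Definition Hmx (R : realType) (N : nat) : 'M[R[i]]_N :=
  - 'i%C *: diag_mx (\row_k (Num.sg ((jdx k)%:~R + 2^-1 : R))%:C).

Definition Dxmx (R : realType) (alpha : R) (N : nat) : 'M[R[i]]_N :=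
  Pinvmx alpha N *m idftmx R N *m S1mx alpha N *m dftmx R N *m Pmx alpha N.

Definition HDxmx (R : realType) (alpha : R) (N : nat) : 'M[R[i]]_N :=
  Pinvmx alpha N *m idftmx R N *m Hmx R N *m S1mx alpha N *m dftmx R N
    *m Pmx alpha N.

Definition iph (R : realType) (alpha : R) (N : nat) (u v : 'cV[R[i]]_N) : R[i] :=
  (pi / (N%:R * alpha))%:C * ((map_mx conjc v)^T *m Wmx alpha N *m u) 0 0.

Definition powv (R : realType) (m N : nat) (u : 'cV[R[i]]_N) : 'cV[R[i]]_N :=
  map_mx (fun z => z ^+ m) u.

(** The matrices are complex, so the grid vectors are complex vectors whose
    entries are real. *)
Definition grid_vector (R : realType) (N : nat) (u : 'cV[R[i]]_N) : Prop :=
  u \is a mxOver Num.real /\ forall j, at_infty j -> u j 0 = 0.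

Definition radicandh (R : realType) (alpha : R) (m N : nat) (C0 : R)
    (u : 'cV[R[i]]_N) : R[i] :=
  iph alpha (powv m u) u + C0%:C.

Definition gboh_rhs (R : realType) (alpha : R) (m N : nat) (C0 : R)
    (y : 'cV[R[i]]_N * R[i]) : 'cV[R[i]]_N * R[i] :=
  let u := y.1 in
  let v := y.2 in
  let c := sqrtC (radicandh alpha m C0 u) in
  let u_t := - (Dxmx alpha N *m
    (- (HDxmx alpha N *m u) + (m%:R^-1 * (v / c)) *: powv m u)) in
  (u_t, m.+1%:R / (2 * c) * iph alpha (powv m u) u_t).

Definition energyh (R : realType) (alpha : R) (m N : nat) (C0 : R)
    (y : 'cV[R[i]]_N * R[i]) : R[i] :=
  2^-1 * iph alpha (HDxmx alpha N *m y.1) y.1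
  - (m * m.+1)%:R^-1 * (y.2 ^+ 2 - C0%:C).

(* Main.v *)
Require Import Defs.
From HB Require Import structures.
From mathcomp Require Import all_boot all_order all_algebra.
From mathcomp Require Import complex.
From mathcomp Require Import all_classical all_reals all_analysis.
From mathcomp Require Import measurable_realfun zify ring lra.


(** A Runge-Kutta method with [b_i a_ij + b_j a_ji = b_i b_j] conserves every
    quadratic form [B] with [B (Y, G Y) = 0] at the intermediate values
    ([rk_step_quadratic_invariant]). The point of the variable [v] is that it
    makes the energy, like the mass, such a form up to a constant.

    For the continuous system write [g] for the flux, so that [u_t = - g_x].
    Integration by parts turns the rate of the mass into the product of [u_x]
    with [g = - H u_x + c u^m]; here [u_x] is orthogonal to [H u_x], because
    [H d/dx] is symmetric and commutes with [d/dx], and to [u^m], because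
    [u_x u^m] is a derivative ([mass_rate]). The rate of the energy is a
    multiple of the product of [g] with [g_x], hence 0 ([energy_rate]). The
    integral is conserved because the increment of [u] in one step is the
    derivative of a function that vanishes at infinity
    ([rk_step_increment], [improper_integral_add_derive1]).

    All this takes place among the functions of all the Sobolev spaces, and
    the analytic part consists in showing that [u |-> H u_x] maps these
    functions to themselves, is linear and symmetric, and commutes with
    [d/dx]. This is read off from its Fourier multiplier [|xi|]. The Fourier
    transform is replaced by the Hartley transform, with kernel [cos + sin],
    which carries the same information for real functions, is real-valued and
    is its own adjoint. Its Plancherel formula is proved by damping with
    [exp (- e |x|)]: by Fubini's theorem the damped product of two transforms
    is a product through the Poisson kernel, which is an approximate identity
    ([damped_pairing], [poisson_smoothing_cvg], [plancherel]). Completeness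
    extends the transform to square integrable functions ([l2_hartley]);
    derivation becomes multiplication by the frequency ([l2_hartley_derive]),
    so that the transform of a Sobolev function decays rapidly and the inverse
    transform of [|xi|] times it is smooth ([hdxE], [is_derive_hdx]). That the
    chosen continuous representative of the Hilbert transform is this function
    is [hilbert_l2_hartley].

    For the discrete system the same cancellation is linear algebra. With the
    weight [W], the inverses of [P] and of the Fourier matrix become adjoints,
    so that [W D] is a congruence transform of [S_1], which is [i] times a
    real symmetric matrix, and [W H D] one of [H S_1], which is real symmetric
    ([adjmx_S1mx], [adjmx_Hmx_mul_S1mx]). Hence [D] is skew-adjoint and [H D]
    self-adjoint for the discrete inner product ([iph_Dxmx], [iph_HDxmx]). *)

Set Implicit Arguments.
Unset Strict Implicit.
Unset Printing Implicit Defensive.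

Import Order.TTheory GRing.Theory Num.Theory.
Import numFieldNormedType.Exports.

Local Open Scope classical_set_scope.
Local Open Scope ring_scope.
Local Open Scope complex_scope.

(** * Integrable and square integrable real functions *)

Section integrable_real.
Context {R : realType}.
Local Notation mu := (@lebesgue_measure R).
Implicit Types (f g h : R -> R) (c : R).

(** Total functions instead of classes modulo null sets: equality almost
    everywhere is mentioned only where it occurs. *)
Definition mfun f : Prop := measurable_fun [set: measurableTypeR R] f.

Definition L1 f : Prop := mu.-integrable setT (EFin \o f).

Lemma cont_comp g f : continuous g -> continuous f -> continuous (fun x => g (f x)).
Proof. by move=> cg cf x; exact: continuous_comp (cf x) (cg (f x)). Qed.

Lemma contD f g : continuous f -> continuous g -> continuous (fun x => f x + g x).
Proof. by move=> cf cg x; apply: cvgD; [exact: cf|exact: cg]. Qed.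

Lemma contM f g : continuous f -> continuous g -> continuous (fun x => f x * g x).
Proof. by move=> cf cg x; apply: cvgM; [exact: cf|exact: cg]. Qed.

Lemma cont_cst c : continuous (fun _ : R => c).
Proof. by move=> x; exact: cvg_cst. Qed.

Lemma cont_id : continuous (fun x : R => x).
Proof. by move=> x; exact: cvg_id. Qed.

Lemma contN f : continuous f -> continuous (fun x => - f x).
Proof. by move=> cf x; apply: cvgN; exact: cf. Qed.

Lemma cont_norm : continuous (fun x : R => `|x|).
Proof. exact: norm_continuous. Qed.

Lemma cont_mull c : continuous (fun x : R => c * x).
Proof. exact: contM (cont_cst (c := c)) cont_id. Qed.

Lemma cont_mulr c : continuous (fun x : R => x * c).
Proof. exact: contM cont_id (cont_cst (c := c)). Qed.

Lemma mfunD f g : mfun f -> mfun g -> mfun (fun x => f x + g x).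
Proof. exact: measurable_funD. Qed.

Lemma mfunB f g : mfun f -> mfun g -> mfun (fun x => f x - g x).
Proof. exact: measurable_funB. Qed.

Lemma mfunM f g : mfun f -> mfun g -> mfun (fun x => f x * g x).
Proof. exact: measurable_funM. Qed.

Lemma mfun_cst c : mfun (fun=> c).
Proof. exact: measurable_cst. Qed.

Lemma mfun_comp g f : mfun g -> mfun f -> mfun (fun x => g (f x)).
Proof. by move=> mg mf; apply: (measurableT_comp (f := g)). Qed.

Lemma mfun_continuous f : continuous f -> mfun f.
Proof. exact: continuous_measurable_fun. Qed.

Lemma mfunX n f : mfun f -> mfun (fun x => f x ^+ n).
Proof. by move=> mf; apply: measurable_funX. Qed.

Lemma mfun_cvg (f_ : nat -> R -> R) f : (forall n, mfun (f_ n)) ->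
  (forall x, f_ n x @[n --> \oo] --> f x) -> mfun f.
Proof. by move=> mf_ f_f; apply: (measurable_fun_cvg mf_) => x _. Qed.

Lemma mfun_EFin f : mfun f -> measurable_fun [set: measurableTypeR R] (EFin \o f).
Proof. by move=> mf; exact/measurable_EFinP. Qed.

Lemma L1_mfun f : L1 f -> mfun f.
Proof. by move=> /integrableP[/measurable_EFinP]. Qed.

Lemma L1_le g f : L1 g -> mfun f -> (forall x, `|f x| <= g x) -> L1 f.
Proof.
move=> Lg mf fg; apply: le_integrable Lg => //; first exact: mfun_EFin.
by move=> x _ /=; rewrite lee_fin (le_trans (fg x))// ler_norm.
Qed.

Lemma L1D f g : L1 f -> L1 g -> L1 (fun x => f x + g x).
Proof. by move=> Lf Lg; have := integrableD measurableT Lf Lg. Qed.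

Lemma L1B f g : L1 f -> L1 g -> L1 (fun x => f x - g x).
Proof. by move=> Lf Lg; have := integrableB measurableT Lf Lg. Qed.

Lemma L1Z c f : L1 f -> L1 (fun x => c * f x).
Proof. by move=> Lf; have := integrableZl measurableT c Lf. Qed.

Lemma L1_norm f : L1 f -> L1 (fun x => `|f x|).
Proof. exact: integrable_norm. Qed.

Lemma L1M_bounded c f h : L1 f -> mfun h ->
  (forall x, `|h x| <= c) -> L1 (fun x => f x * h x).
Proof.
move=> Lf mh hc; apply: (L1_le (g := fun x => c * `|f x|)).
- exact/L1Z/L1_norm.
- by apply: mfunM => //; exact: L1_mfun.
- by move=> x; rewrite normrM mulrC ler_wpM2r.
Qed.

Lemma intD f g : L1 f -> L1 g ->
  \int[mu]_x (f x + g x) = \int[mu]_x f x + \int[mu]_x g x.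
Proof. exact: RintegralD. Qed.

Lemma intB f g : L1 f -> L1 g ->
  \int[mu]_x (f x - g x) = \int[mu]_x f x - \int[mu]_x g x.
Proof. exact: RintegralB. Qed.

Lemma intZ c f : L1 f -> \int[mu]_x (c * f x) = c * \int[mu]_x f x.
Proof. exact: RintegralZl. Qed.

Lemma int_le f g : L1 f -> L1 g -> (forall x, f x <= g x) ->
  \int[mu]_x f x <= \int[mu]_x g x.
Proof. by move=> Lf Lg fg; apply: le_Rintegral. Qed.

Lemma eq_int f g : f =1 g -> \int[mu]_x f x = \int[mu]_x g x.
Proof. by move=> fg; apply: eq_Rintegral => x _. Qed.

Lemma int_ge0 f : (forall x, 0 <= f x) -> 0 <= \int[mu]_x f x.
Proof. by move=> f0; apply: Rintegral_ge0. Qed.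

Lemma int_norm f : L1 f -> `|\int[mu]_x f x| <= \int[mu]_x `|f x|.
Proof. exact: le_normr_Rintegral. Qed.

Lemma EFin_int f : L1 f -> (\int[mu]_x f x)%:E = (\int[mu]_x (f x)%:E)%E.
Proof. by move=> Lf; rewrite /Rintegral fineK//; exact: integrable_fin_num. Qed.

Lemma aeS (P Q : R -> Prop) : {ae mu, forall x, P x} ->
  (forall x, P x -> Q x) -> {ae mu, forall x, Q x}.
Proof.
move=> aeP PQ; move: aeP.
by apply: filterS; first exact: (ae_filter_ringOfSetsType mu).
Qed.

Lemma aeS2 (P Q S : R -> Prop) : {ae mu, forall x, P x} ->
  {ae mu, forall x, Q x} -> (forall x, P x -> Q x -> S x) ->
  {ae mu, forall x, S x}.
Proof.
move=> aeP aeQ PQ; move: aeP aeQ.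
by apply: filterS2; first exact: (ae_filter_ringOfSetsType mu).
Qed.

Lemma L1_ae f g : L1 f -> mfun g -> {ae mu, forall x, f x = g x} ->
  L1 g /\ \int[mu]_x f x = \int[mu]_x g x.
Proof.
move=> Lf mg fg.
have fge : ae_eq mu setT (EFin \o f) (EFin \o g).
  by apply: aeS fg _ => x /= -> _.
split.
  move/integrableP : Lf => [mf foo]; apply/integrableP; split.
    exact: mfun_EFin.
  rewrite (_ : integral _ _ _ = \int[mu]_x `|(EFin \o f) x|)%E//.
  apply: ae_eq_integral => //.
  - by apply: measurableT_comp => //; exact: mfun_EFin.
  - exact: measurableT_comp.
  - by apply: aeS fg _ => x /= -> _.
rewrite /Rintegral; congr fine; apply: ae_eq_integral => //.
- exact: mfun_EFin (L1_mfun _).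
- exact: mfun_EFin.
Qed.

Lemma int_dct (f_ : nat -> R -> R) f g :
  (forall n, mfun (f_ n)) -> mfun f ->
  {ae mu, forall x, f_ n x @[n --> \oo] --> f x} ->
  L1 g -> (forall n x, `|f_ n x| <= g x) ->
  L1 f /\ \int[mu]_x f_ n x @[n --> \oo] --> \int[mu]_x f x.
Proof.
move=> mf_ mf f_f Lg fg.
have [] := @dominated_convergence _ _ _ mu setT measurableT
    (fun n => EFin \o f_ n) (EFin \o f) (EFin \o g).
- by move=> n; exact: mfun_EFin.
- exact: mfun_EFin.
- by apply: aeS f_f _ => x fx _; apply: cvg_EFin => //; exact: nearW.
- exact: Lg.
- by apply: aeW => x n _; rewrite /= lee_fin.
move=> Lf _ fc.
split => //; apply: fine_cvg; rewrite /= fineK//; exact: integrable_fin_num.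
Qed.

Lemma int_mct (f_ : nat -> R -> R) f l :
  (forall n, L1 (f_ n)) -> mfun f ->
  (forall n x, 0 <= f_ n x) ->
  (forall x, {homo f_ ^~ x : m n / (m <= n)%N >-> m <= n}) ->
  (forall x, f_ n x @[n --> \oo] --> f x) ->
  (forall n, \int[mu]_x f_ n x <= l) ->
  L1 f /\ \int[mu]_x f_ n x @[n --> \oo] --> \int[mu]_x f x.
Proof.
move=> Lf_ mf f_0 ndf f_f fl.
have f0 x : 0 <= f x.
  by apply: (cvgr_to_ge (f_f x)); apply: nearW.
have fE : (fun x => (f x)%:E) = fun x => limn (fun n => (f_ n x)%:E).
  apply/funext => x; apply/esym/cvg_lim => //; apply: cvg_EFin => //.
    exact: nearW.
  exact: f_f.
have cv := @cvg_monotone_convergence _ _ _ mu setT measurableT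
    (fun n x => (f_ n x)%:E).
rewrite -fE in cv.
have {}cv : (\int[mu]_x (f_ n x)%:E)%E @[n --> \oo] --> (\int[mu]_x (f x)%:E)%E.
  apply: cv.
  - by move=> n; exact: mfun_EFin (L1_mfun _).
  - by move=> n x _; rewrite lee_fin.
  - by move=> x _ m n mn; rewrite lee_fin ndf.
have foo : (\int[mu]_x (f x)%:E <= l%:E)%E.
  move/cvg_lim : (cv) => <-//; apply: lime_le.
    by apply/cvg_ex; exists (\int[mu]_x (f x)%:E)%E.
  by apply: nearW => n; rewrite -EFin_int// lee_fin.
have Lf : L1 f.
  apply/integrableP; split; first exact: mfun_EFin.
  under eq_integral do rewrite /= ger0_norm//.
  exact: le_lt_trans foo (ltry _).
split=> //; apply: fine_cvg; rewrite /= fineK//; exact: integrable_fin_num.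
Qed.

(** Reflection preserves the lengths of intervals, and these determine the
    Lebesgue measure. *)
Lemma int_opp f : L1 f ->
  L1 (fun x => f (- x)) /\ \int[mu]_x f (- x) = \int[mu]_x f x.
Proof.
move=> Lf.
pose opp : measurableTypeR R -> measurableTypeR R := -%R.
have mopp : measurable_fun [set: measurableTypeR R] opp.
  move=> mT A mA.
  have mN : mfun -%R by apply: mfun_continuous; exact: opp_continuous.
  exact: mN.
have muE A : measurable A -> mu A = pushforward mu opp A.
  move=> mA.
  pose nu : {measure set (measurableTypeR R) -> \bar R} :=
    measure_function_pushforward__canonical__measure_function_Measure mu mopp.
  apply: (@lebesgue_measure_unique R nu) => // _ [[a b] _ <-].
  rewrite /nu /=.
  rewrite (_ : pushforward mu opp _ = mu (opp @^-1` `]a, b]))//.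
  rewrite (_ : opp @^-1` `]a, b] = `[- b, - a[%classic); last first.
    apply/seteqP; split => x /=; rewrite !in_itv/= /opp.
      by rewrite ltrNr lerNl => /andP[-> ->].
    by rewrite ltrNr lerNl => /andP[-> ->].
  rewrite !lebesgue_measure_itv/= !lte_fin ltrN2.
  by case: ifP => // _; rewrite -!EFinB opprK addrC.
have mf := L1_mfun Lf.
have mfo : mfun (fun x => f (- x)).
  by apply: mfun_comp mf _; apply: mfun_continuous; exact: opp_continuous.
have intabs : (\int[mu]_x `|(f (- x))%:E| = \int[mu]_x `|(f x)%:E|)%E.
  transitivity (\int[pushforward mu opp]_x `|(f x)%:E|)%E.
    rewrite ge0_integral_pushforward//.
    by apply: measurableT_comp => //; exact: mfun_EFin.
  by apply: eq_measure_integral => A mA _; exact/esym/muE.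
have Lfo : L1 (fun x => f (- x)).
  apply/integrableP; split; first exact: mfun_EFin.
  by rewrite intabs; move/integrableP : Lf => [].
split => //; rewrite /Rintegral; congr fine.
transitivity (\int[pushforward mu opp]_x (f x)%:E)%E.
  rewrite integral_pushforward//.
  exact: mfun_EFin.
by apply: eq_measure_integral => A mA _; exact/esym/muE.
Qed.

Lemma int_sqr_ae0 f : L1 (fun x => f x ^+ 2) -> \int[mu]_x (f x ^+ 2) = 0 ->
  {ae mu, forall x, f x = 0}.
Proof.
move=> Lf f0.
have := EFin_int Lf; rewrite f0 => fe0.
have [+ _] := @ae_eq_integral_abs _ _ _ mu setT measurableT
  (EFin \o (fun x => f x ^+ 2)) (mfun_EFin (L1_mfun Lf)).
rewrite (_ : integral _ _ _ = 0%E); last first.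
  by apply/esym/(etrans fe0)/eq_integral => x _ /=; rewrite ger0_norm// sqr_ge0.
move=> /(_ erefl) fae; apply: (aeS fae) => x /(_ I) [] /eqP.
by rewrite sqrf_eq0 => /eqP.
Qed.

(** A nonzero value would persist on an interval, which is not a null set. *)
Lemma continuous_ae0 f : continuous f -> {ae mu, forall x, f x = 0} ->
  forall x, f x = 0.
Proof.
move=> cf [N [mN N0 fN]] x; apply: contrapT => fx0.
have fn0 : 0 < `|f x| by rewrite normr_gt0; apply/eqP.
have /cvgrPdist_lt/(_ _ fn0)[e /= e0 fxe] := cf x.
have eN : `]x - e, x + e[ `<=` N.
  move=> y /= yx; apply: fN => /= fy0.
  have : ball x e y by rewrite ball_itv.
  by move=> /fxe /=; rewrite fy0 subr0 ltxx.
have : (mu `](x - e)%R, (x + e)%R[%classic <= mu N)%E.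
  by apply: le_measure => //; rewrite inE.
rewrite N0 lebesgue_measure_itv/= lte_fin ifT; last by lra.
by rewrite -EFinB lee_fin; lra.
Qed.

End integrable_real.

Section square_integrable.
Context {R : realType}.
Local Notation mu := (@lebesgue_measure R).
Implicit Types (f g h : R -> R) (c : R).

Definition L2 f : Prop := mfun f /\ L1 (fun x => f x ^+ 2).

Lemma L2P f : f \in Lfun mu 2%:E <-> L2 f.
Proof.
split=> [Lf|[mf Lf]].
  split; last exact: Lfun2_integrable_sqr.
  by move: Lf; rewrite inE => /andP[/[!inE]].
rewrite inE; apply/andP; split; rewrite inE//=.
rewrite /finite_norm unlock /Lnorm.
rewrite poweR_lty//.
move/integrableP : Lf => [_]; apply: le_lt_trans.
rewrite le_eqVlt; apply/orP; left; apply/eqP.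
apply: eq_integral => x _ /=.
by rewrite powR_mulrn// normrX.
Qed.

(** From [|f g| <= f^2 + g^2]. *)
Lemma L2M f g : L2 f -> L2 g -> L1 (fun x => f x * g x).
Proof.
move=> [mf Lf] [mg Lg]; apply: L1_le (L1D Lf Lg) _ _; first exact: mfunM.
move=> x; have := sqr_ge0 (`|f x| - `|g x|).
rewrite normrM -(real_normK (num_real (f x))) -(real_normK (num_real (g x))).
have := normr_ge0 (f x); have := normr_ge0 (g x); nra.
Qed.

Lemma L2D f g : L2 f -> L2 g -> L2 (fun x => f x + g x).
Proof.
move=> Lf Lg; split; first by apply: mfunD; [case: Lf|case: Lg].
rewrite (_ : (fun x => _) =
  fun x => (f x ^+ 2 + g x ^+ 2) + 2 * (f x * g x)).
  by apply: L1D; [apply: L1D; [case: Lf|case: Lg]|exact/L1Z/L2M].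
by apply/funext => x; ring.
Qed.

Lemma L2Z c f : L2 f -> L2 (fun x => c * f x).
Proof.
move=> [mf Lf]; split; first exact: mfunM (mfun_cst c) mf.
rewrite (_ : (fun x => _) = fun x => c ^+ 2 * (f x ^+ 2)); first exact: L1Z.
by apply/funext => x; ring.
Qed.

Lemma L2N f : L2 f -> L2 (fun x => - f x).
Proof.
move=> /(L2Z (-1)); rewrite (_ : (fun x => _) = fun x => - f x)//.
by apply/funext => x; ring.
Qed.

Lemma L2B f g : L2 f -> L2 g -> L2 (fun x => f x - g x).
Proof. by move=> Lf Lg; apply: L2D => //; exact: L2N. Qed.

Lemma L2_le g f : L2 g -> mfun f -> (forall x, `|f x| <= `|g x|) -> L2 f.
Proof.
move=> [mg Lg] mf fg; split=> //; apply: L1_le Lg _ _; first exact: mfunX.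
move=> x; rewrite normrX -(real_normK (num_real (g x))) lerXn2r//.
Qed.

Lemma L2M_bounded c f h : L2 f -> mfun h -> (forall x, `|h x| <= c) ->
  L2 (fun x => f x * h x).
Proof.
move=> Lf mh hc; apply: (L2_le (g := fun x => c * f x)); first exact: L2Z.
  by apply: mfunM => //; case: Lf.
move=> x; rewrite !normrM mulrC ler_wpM2r//.
by rewrite (le_trans (hc x))// ler_norm.
Qed.

Lemma L2_ae f g : L2 f -> mfun g -> {ae mu, forall x, f x = g x} -> L2 g.
Proof.
move=> [mf Lf] mg fg; split=> //.
have [] := L1_ae Lf (mfunX 2 mg) => //.
by apply: aeS fg _ => x ->.
Qed.

Lemma L2_opp f : L2 f -> L2 (fun x => f (- x)).
Proof.
move=> [mf Lf]; split; last by have [] := int_opp Lf.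
by apply: mfun_comp mf _; apply: mfun_continuous; exact: opp_continuous.
Qed.

Lemma ipZl c f g : L2 f -> L2 g -> ip (fun x => c * f x) g = c * ip f g.
Proof.
move=> Lf Lg; rewrite /ip -intZ; last exact: L2M.
by apply: eq_int => x; rewrite mulrA.
Qed.

Lemma ipDl f g h : L2 f -> L2 g -> L2 h ->
  ip (fun x => f x + g x) h = ip f h + ip g h.
Proof.
move=> Lf Lg Lh; rewrite /ip -intD; [|exact: L2M..].
by apply: eq_int => x; rewrite mulrDl.
Qed.

Lemma ipBl f g h : L2 f -> L2 g -> L2 h ->
  ip (fun x => f x - g x) h = ip f h - ip g h.
Proof.
move=> Lf Lg Lh; rewrite /ip -intB; [|exact: L2M..].
by apply: eq_int => x; rewrite mulrBl.
Qed.

Lemma ipC f g : ip f g = ip g f.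
Proof. by apply: eq_int => x; rewrite mulrC. Qed.

Lemma ipDr f g h : L2 f -> L2 g -> L2 h ->
  ip h (fun x => f x + g x) = ip h f + ip h g.
Proof. by move=> Lf Lg Lh; rewrite ipC ipDl// !(ipC h). Qed.

Lemma ipBr f g h : L2 f -> L2 g -> L2 h ->
  ip h (fun x => f x - g x) = ip h f - ip h g.
Proof. by move=> Lf Lg Lh; rewrite ipC ipBl// !(ipC h). Qed.

Lemma ipZr c f g : L2 f -> L2 g -> ip g (fun x => c * f x) = c * ip g f.
Proof. by move=> Lf Lg; rewrite ipC ipZl// ipC. Qed.

Lemma ip_ge0 f : 0 <= ip f f.
Proof. by apply: int_ge0 => x; rewrite -expr2 sqr_ge0. Qed.

Lemma ip_opp f g : L2 f -> L2 g ->
  ip (fun x => f (- x)) (fun x => g (- x)) = ip f g.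
Proof. by move=> Lf Lg; have [_] := int_opp (L2M Lf Lg). Qed.

Lemma ip_sqrB f g : L2 f -> L2 g ->
  ip (fun x => f x - g x) (fun x => f x - g x) = ip f f - 2 * ip f g + ip g g.
Proof.
move=> Lf Lg; have Lfg := L2B Lf Lg.
rewrite (ipBl Lf Lg Lfg) (ipBr Lf Lg Lf) (ipBr Lf Lg Lg) (ipC g f).
ring.
Qed.

(** The polynomial [<f,f> - 2t<f,g> + t^2<g,g>] in [t] is nonnegative; when
    [<g,g> = 0] it is affine, hence constant. *)
Lemma cauchy_schwarz f g : L2 f -> L2 g -> ip f g ^+ 2 <= ip f f * ip g g.
Proof.
move=> Lf Lg.
have Q t : 0 <= ip f f - 2 * t * ip f g + t ^+ 2 * ip g g.
  have Ltg := L2Z t Lg.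
  have := ip_ge0 (fun x => f x - t * g x).
  rewrite (ip_sqrB Lf Ltg) (ipZr _ Lg Lf) (ipZl _ Lg Ltg) (ipZr _ Lg Lg).
  by congr (_ <= _); ring.
have f0 := ip_ge0 f; have := ip_ge0 g; rewrite le_eqVlt => /orP[/eqP g0|g0].
  have [->|fg0] := eqVneq (ip f g) 0; first by rewrite expr0n -g0 mulr0.
  have := Q ((ip f f + 1) / ip f g); rewrite -g0 mulr0 addr0 -mulrA divfK//.
  by rewrite mulr0; lra.
have := Q (ip f g / ip g g).
rewrite (_ : _ + _ = (ip f f * ip g g - ip f g ^+ 2) / ip g g); last first.
  by field; rewrite gt_eqF.
by rewrite pmulr_lge0 ?invr_gt0// subr_ge0.
Qed.

Lemma eq_ip f f' g g' : f =1 f' -> g =1 g' -> ip f g = ip f' g'.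
Proof. by move=> ff gg; apply: eq_int => x; rewrite ff gg. Qed.

Lemma ip_ae f f' g : L2 f -> L2 g -> mfun f' ->
  {ae mu, forall x, f x = f' x} -> ip f g = ip f' g.
Proof.
move=> Lf Lg mf' ff'.
have [] := L1_ae (L2M Lf Lg) (mfunM mf' (proj1 Lg)) => //.
by apply: aeS ff' _ => x ->.
Qed.

Lemma ip_eq0_ae f : L2 f -> ip f f = 0 -> {ae mu, forall x, f x = 0}.
Proof.
move=> [mf Lf] f0; apply: int_sqr_ae0 => //; rewrite -[RHS]f0.
Qed.

End square_integrable.

(** * Restriction to intervals *)

Section truncation.
Context {R : realType}.
Local Notation mu := (@lebesgue_measure R).
Implicit Types (f g h : R -> R) (a b c : R).

(** A boolean test, instead of a restriction to an interval, so that
    pointwise facts follow by case analysis. *)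
Definition cut a b f : R -> R := fun x => if a <= x <= b then f x else 0.

Lemma cut_patch a b f : cut a b f = f \_ `[a, b].
Proof.
apply/funext => x; rewrite /cut patchE.
by rewrite mem_setE in_itv.
Qed.

Lemma int_cut a b f : \int[mu]_x cut a b f x = \int[mu]_(x in `[a, b]) f x.
Proof. by rewrite [RHS]Rintegral_mkcond cut_patch. Qed.

Lemma L1_cutP a b f : L1 (cut a b f) <-> mu.-integrable `[a, b] (EFin \o f).
Proof.
rewrite /L1 cut_patch -restrict_EFin.
by apply: iff_sym; apply: integrable_mkcond.
Qed.

Lemma cutE1 a b f : cut a b f = (fun x => f x * cut a b (cst 1) x).
Proof. by apply/funext => x; rewrite /cut; case: ifP; rewrite ?mulr1 ?mulr0. Qed.

Lemma mfun_cut1 a b : mfun (cut a b (cst 1)).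
Proof.
rewrite cut_patch /mfun; apply/(measurable_restrictT _ _).1 => //.
Qed.

Lemma cut1_le a b x : `|cut a b (cst 1) x| <= 1.
Proof. by rewrite /cut; case: ifP; rewrite ?normr1 ?normr0. Qed.

Lemma mfun_cut a b f : mfun f -> mfun (cut a b f).
Proof. by move=> mf; rewrite cutE1; apply: mfunM => //; exact: mfun_cut1. Qed.

Lemma L1_cut a b f : L1 f -> L1 (cut a b f).
Proof.
by move=> Lf; rewrite cutE1; apply: (L1M_bounded Lf (@mfun_cut1 a b) (@cut1_le a b)).
Qed.

Lemma L2_cut a b f : L2 f -> L2 (cut a b f).
Proof.
by move=> Lf; rewrite cutE1; apply: (L2M_bounded Lf (@mfun_cut1 a b) (@cut1_le a b)).
Qed.

Lemma L1_cut_continuous a b f : continuous f -> L1 (cut a b f).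
Proof.
move=> cf; apply/L1_cutP; apply: continuous_compact_integrable.
  exact: segment_compact.
exact: continuous_subspaceT.
Qed.

Lemma cutM a b f g : (fun x => cut a b f x * g x) = cut a b (fun x => f x * g x).
Proof. by apply/funext => x; rewrite /cut; case: ifP; rewrite ?mul0r. Qed.

Lemma L2_cut_continuous a b f : continuous f -> L2 (cut a b f).
Proof.
move=> cf; split; first by apply: mfun_cut; exact: mfun_continuous.
rewrite (_ : (fun x => _) = cut a b (fun x => f x * f x)).
  by apply: L1_cut_continuous => x; apply: continuousM; exact: cf.
by apply/funext => x; rewrite /cut; case: ifP; rewrite ?expr0n.
Qed.

(** From [|f| <= f^2 + 1], and the constant is integrable on the interval. *)
Lemma L1_cut_L2 a b f : L2 f -> L1 (cut a b f).
Proof.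
move=> [mf Lf].
have L1c : L1 (cut a b (cst 1)) by apply: L1_cut_continuous => x; exact: cvg_cst.
apply: (L1_le (L1D Lf L1c)); first exact: mfun_cut.
move=> x; rewrite /cut; case: ifP => _; rewrite ?normr0 ?addr0 ?sqr_ge0//.
have := sqr_ge0 (`|f x| - 1); rewrite -(real_normK (num_real (f x))).
have := normr_ge0 (f x); rewrite /=; nra.
Qed.

Lemma cut_bounded a b f : continuous f ->
  exists M, forall x, `|cut a b f x| <= M.
Proof.
move=> cf; have [ab|ba] := leP a b; last first.
  exists 0 => x; rewrite /cut ifF ?normr0//.
  by apply/negP => /andP[ax xb]; have := le_trans ax xb; rewrite leNgt ba.
have cnf : {within `[a, b], continuous (fun x => `|f x|)}.
  apply: continuous_subspaceT => x.
  by apply: continuous_comp; [exact: cf|exact: norm_continuous].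
have [c _ fc] := EVT_max ab cnf.
exists `|f c| => x; rewrite /cut; case: ifP => xab; last by rewrite normr0.
by apply: fc; rewrite in_itv.
Qed.

Lemma cut_near f x : \forall n \near \oo, cut (- n%:R) n%:R f x = f x.
Proof.
near=> n; rewrite /cut ifT// -ler_norml.
by near: n; exact: nbhs_infty_ger.
Unshelve. all: by end_near. Qed.

Lemma cut_cvg f x : cut (- n%:R) n%:R f x @[n --> \oo] --> f x.
Proof.
apply: cvg_near_cst; exact: cut_near.
Qed.

Lemma cut_le a b f x : `|cut a b f x| <= `|f x|.
Proof. by rewrite /cut; case: ifP; rewrite ?normr0. Qed.

Lemma int_cut_cvg f : L1 f ->
  \int[mu]_x cut (- n%:R) n%:R f x @[n --> \oo] --> \int[mu]_x f x.
Proof.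
move=> Lf; have mf := L1_mfun Lf.
apply: (proj2 (int_dct (fun n => mfun_cut _ _ mf) mf _ (L1_norm Lf) _)).
  by apply: aeW => x; exact: cut_cvg.
by move=> n x; exact: cut_le.
Qed.

(** Every primitive of [f] is constant, and its derivative is [f] almost
    everywhere by the Lebesgue differentiation theorem. *)
Lemma cut_ae0 f : mfun f -> (forall a b, L1 (cut a b f)) ->
  (forall a b, \int[mu]_x cut a b f x = 0) -> {ae mu, forall x, f x = 0}.
Proof.
move=> mf Lf f0.
have locf : locally_integrable setT f.
  split; [exact: mf|exact: openT|].
  move=> K _ cK.
  have [M [_ /(_ (M + 1))]] := compact_bounded cK.
  rewrite ltrDl ltr01 => /(_ isT) KM.
  have : mu.-integrable K (EFin \o f).
    apply: integrableS ((L1_cutP _ _ _).1 (Lf (- (M + 1)) (M + 1))) => //.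
      exact: compact_measurable.
    by move=> x /KM /=; rewrite in_itv/= ler_norml.
  by move/integrableP => [].
have ftc (n : nat) : {ae mu, forall x, - n%:R < x -> f x = 0}.
  have := @FTC1 _ f (BLeft (- n%:R)) (fun y => (L1_cutP _ _ _).1 (Lf _ _)) locf.
  move/aeS; apply=> x /= Hx xn.
  have [|_ <-] := Hx; first by rewrite ?bnd_simp/= ?ltW.
  under eq_fun do rewrite -int_cut f0.
  by rewrite derive1_cst.
have := ae_foralln ftc.
move/aeS; apply => x Hx; near \oo => n; apply: (Hx n).
rewrite ltrNl (le_lt_trans (ler_norm _))// normrN.
by near: n; exact: nbhs_infty_gtr.
Unshelve. all: by end_near. Qed.

End truncation.

(** * Completeness of the space of square integrable functions *)

Section completeness.
Context {R : realType}.
Local Notation mu := (@lebesgue_measure R).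
Implicit Types (f g h : R -> R) (a b c : R).

Lemma ip_sqrD_le f g : L2 f -> L2 g ->
  ip (fun x => f x + g x) (fun x => f x + g x) <= 2 * ip f f + 2 * ip g g.
Proof.
move=> Lf Lg; have Lfg := L2D Lf Lg.
have := ip_ge0 (fun x => f x - g x); rewrite ip_sqrB//.
rewrite (ipDl Lf Lg Lfg) (ipDr Lf Lg Lf) (ipDr Lf Lg Lg) (ipC g f).
lra.
Qed.

Lemma ipNN f g : ip (fun x => - f x) (fun x => - g x) = ip f g.
Proof. by apply: eq_int => x; rewrite mulrNN. Qed.

(** The weights [2 ^ i] make the Cauchy-Schwarz inequality for a sum of any
    length cost only the tail of a geometric series. *)
Lemma telescope_sqr_le (u : nat -> R) n k :
  (u (n + k)%N - u n) ^+ 2 <= 2 * 2 ^- n *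
    \sum_(n <= i < n + k) (2 ^+ i * (u i.+1 - u i) ^+ 2).
Proof.
elim: k n => [|k IH] n; first by rewrite addn0 subrr expr0n big_geq ?mulr0.
rewrite addnS -addSn big_ltn; last by rewrite addSn ltnS leq_addr.
have := IH n.+1; set S := \sum_(_ <= i < _) _ => IHk.
have -> : 2 * 2 ^- n * (2 ^+ n * (u n.+1 - u n) ^+ 2 + S) =
   2 * (u n.+1 - u n) ^+ 2 + 2 * (2 * 2 ^- n.+1 * S).
  have n0 : (2 : R) ^+ n != 0 by rewrite expf_neq0.
  by rewrite (exprS 2 n); field.
have := sqr_ge0 ((u (n.+1 + k)%N - u n.+1) - (u n.+1 - u n)).
by nra.
Qed.

(** Monotone convergence in the extended reals: the sum has a finite integral,
    so it is finite almost everywhere. The set of convergence comes with a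
    measurable indicator, by which functions can be masked. *)
Lemma L1_series_ae_fin (d : nat -> R -> R) c :
  (forall n, L1 (d n)) -> (forall n x, 0 <= d n x) ->
  (forall n, \int[mu]_x (\sum_(i < n) d i x) <= c) ->
  exists A : set R, exists s : R -> R, [/\ L1 s /\ \int[mu]_x s x <= c,
    (forall x, 0 <= s x), mfun (fun x => (x \in A)%:R),
    {ae mu, forall x, A x} &
    forall x, A x -> \sum_(i < n) d i x @[n --> \oo] --> s x].
Proof.
move=> Ld d0 dc.
pose S n x := \sum_(i < n) d i x.
have LS n : L1 (S n).
  elim: n => [|n IH]; rewrite /S.
    under eq_fun do rewrite big_ord0.
    by apply: (L1_le (L1Z 0 (Ld 0%N))) => [|x]; [exact: mfun_cst|rewrite mul0r normr0].
  by under eq_fun do rewrite big_ord_recr/=; apply: L1D.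
have S0 n x : 0 <= S n x by apply: sumr_ge0.
have ndS x : {homo S ^~ x : m n / (m <= n)%N >-> m <= n}.
  apply/nondecreasing_seqP => n; rewrite /S big_ord_recr/= lerDl.
  exact: d0.
pose Sx x := limn (fun n => (S n x)%:E).
have ScS x : (S n x)%:E @[n --> \oo] --> Sx x.
  by apply: ereal_nondecreasing_is_cvgn => m n mn; rewrite lee_fin ndS.
have mSx : measurable_fun [set: measurableTypeR R] Sx.
  apply: (emeasurable_fun_cvg (fun n x => (S n x)%:E)).
    by move=> n; exact: mfun_EFin (L1_mfun (LS n)).
  by move=> x _; exact: ScS.
have Sx0 x : (0 <= Sx x)%E.
  by apply: lime_ge; [exact/cvgP/ScS|apply: nearW => n; rewrite lee_fin].
have intSx : (\int[mu]_x Sx x <= c%:E)%E.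
  have cv : (\int[mu]_x (S n x)%:E)%E @[n --> \oo] --> (\int[mu]_x Sx x)%E.
    apply: (@cvg_monotone_convergence _ _ _ mu setT measurableT
      (fun n x => (S n x)%:E)).
    - by move=> n; exact: mfun_EFin (L1_mfun (LS n)).
    - by move=> n x _; rewrite lee_fin.
    - by move=> x _ m n mn; rewrite lee_fin ndS.
  move/cvg_lim : (cv) => <-//; apply: lime_le; first exact/cvgP/cv.
  by apply: nearW => n; rewrite -EFin_int// lee_fin; exact: dc.
have LSx : mu.-integrable setT Sx.
  apply/integrableP; split; first exact: mSx.
  under eq_integral do rewrite gee0_abs//.
  exact: le_lt_trans intSx (ltry _).
exists [set x | Sx x \is a fin_num]; exists (fine \o Sx).
have mA : measurable [set x : measurableTypeR R | Sx x \is a fin_num].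
  by rewrite -[X in measurable X]setTI; exact: emeasurable_fin_num.
have aeA : {ae mu, forall x, Sx x \is a fin_num}.
  by apply: aeS (integrable_ae measurableT LSx) _ => x; exact.
have mfs : mfun (fine \o Sx) by apply: measurableT_comp.
have Ls : L1 (fine \o Sx).
  apply: le_integrable LSx => //; first exact: mfun_EFin.
  by move=> x _ /=; case: (Sx x) => [r||] //=; rewrite normr0 leey.
split=> //.
- split=> //; rewrite -lee_fin EFin_int//; apply: le_trans intSx.
  apply: ge0_le_integral => //.
  + by move=> x _; rewrite lee_fin fine_ge0.
  + exact: mfun_EFin.
  + move=> x _ /=; have := Sx0 x; case: (Sx x) => [r||] //= _; exact: leey.
- by move=> x; exact: fine_ge0.
- exact: measurable_indic.
- move=> x /= Ax; by have := ScS x; rewrite -[Sx x](fineK Ax) => /fine_cvg.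
Qed.

(** The weighted squares of the increments have a finite total integral, because
    [2 ^ n * 8 ^- n] is summable. Off a null set their sum [s] is finite, and
    [telescope_sqr_le] then yields both pointwise convergence and the bound
    of the squared error by a multiple of [2 ^- n * s]. *)
Lemma L2_complete_fast (h : nat -> R -> R) :
  (forall n, L2 (h n)) ->
  (forall n, ip (fun x => h n.+1 x - h n x) (fun x => h n.+1 x - h n x)
     <= 8 ^- n) ->
  exists2 l, L2 l & forall n,
    ip (fun x => l x - h n x) (fun x => l x - h n x) <= 4 * 2 ^- n.
Proof.
move=> Lh dh.
pose d i x := 2 ^+ i * (h i.+1 x - h i x) ^+ 2.
have Ld i : L1 (d i) by apply/L1Z; have [] := L2B (Lh i.+1) (Lh i).
have intd i : \int[mu]_x d i x <= 4 ^- i.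
  rewrite intZ; last by have [] := L2B (Lh i.+1) (Lh i).
  rewrite (_ : 4 = 2^-1 * 8 :> R); last by lra.
  rewrite exprMn exprVn invfM invrK ler_wpM2l//.
  exact: dh.
have LS n : L1 (fun x => \sum_(i < n) d i x).
  elim: n => [|n IH].
    under eq_fun do rewrite big_ord0.
    by apply: (L1_le (L1Z 0 (Ld 0%N))) => [|x]; [exact: mfun_cst|rewrite mul0r normr0].
  by under eq_fun do rewrite big_ord_recr/=; apply: L1D.
have intS n : \int[mu]_x (\sum_(i < n) d i x) <= 2 - 2 * 4 ^- n.
  elim: n => [|n IH].
    under eq_int do rewrite big_ord0.
    by rewrite Rintegral_cst// mul0r expr0 invr1; lra.
  under eq_int do rewrite big_ord_recr/=.
  rewrite (intD (LS n) (Ld n)); apply: (le_trans (lerD IH (intd n))).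
  rewrite exprS invfM; have := exprn_gt0 n (ltr0n R 4); rewrite -invr_gt0.
  lra.
have d0 i x : 0 <= d i x by apply: mulr_ge0; [exact: exprn_ge0|exact: sqr_ge0].
have [|A [s [[Ls ints] s0 mA aeA As]]] := @L1_series_ae_fin d 2 Ld d0.
  move=> n; apply: (le_trans (intS n)).
  by rewrite gerBl mulr_ge0// invr_ge0 exprn_ge0.
pose chi x : R := (x \in A)%:R.
pose l x := limn (fun n => h n x * chi x).
have bnd n k x : A x -> (h (n + k)%N x - h n x) ^+ 2 <= 2 * 2 ^- n * s x.
  move=> Ax; apply: le_trans (telescope_sqr_le (h ^~ x) n k) _.
  rewrite ler_wpM2l ?mulr_ge0 ?invr_ge0 ?exprn_ge0//.
  apply: (@le_trans _ _ (\sum_(i < n + k) d i x)).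
    rewrite -(big_mkord xpredT (d ^~ x)) [leRHS](big_cat_nat (n := n))//= ?leq_addr//.
    by rewrite lerDr sumr_ge0.
  apply: (cvgr_to_ge (As x Ax)); exists (n + k)%N => // m /= nm.
  rewrite -!(big_mkord xpredT (d ^~ x)) [leRHS](big_cat_nat (n := (n + k)%N))//=.
  by rewrite lerDl sumr_ge0.
have chl x : h n x * chi x @[n --> \oo] --> l x.
  have [Ax|nAx] := pselect (A x); last first.
    rewrite /l /chi memNset//=.
    by under eq_fun do rewrite mulr0; exact: is_cvg_cst.
  rewrite /l /chi mem_set//=.
  under eq_fun do rewrite mulr1.
  apply/cauchy_cvgP/cauchy_exP => e e0.
  have [n ne] : exists n, 2 * 2 ^- n * s x < e ^+ 2.
    have : 2 * (2^-1) ^+ n * s x @[n --> \oo] --> 2 * 0 * s x.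
      apply: cvgMl; apply: cvgMr.
      by apply: cvg_expr; rewrite ger0_norm; lra.
    rewrite mulr0 mul0r => /cvgrPdist_lt/(_ _ (exprn_gt0 2 e0))[n _ /(_ n (leqnn n))].
    rewrite /= sub0r normrN exprVn => /(le_lt_trans (ler_norm _)) ?.
    by exists n.
  exists (h n x); exists n => // m /= nm; rewrite /ball/= -(subnKC nm).
  rewrite distrC -ltr_sqr ?nnegrE ?normr_ge0 ?ltW// real_normK ?num_real//.
  exact: le_lt_trans (bnd _ _ _ Ax) ne.
have lb n x : (l x - h n x * chi x) ^+ 2 <= 2 * 2 ^- n * s x.
  have [Ax|nAx] := pselect (A x); last first.
    have -> : l x = 0.
      rewrite /l /chi memNset//=; under eq_fun do rewrite mulr0.
      by rewrite lim_cst.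
    by rewrite /chi memNset//= mulr0 subr0 expr0n !mulr_ge0// invr_ge0 exprn_ge0.
  have cl := chl x; rewrite /chi mem_set//= mulr1.
  have {}cl : h n0 x @[n0 --> \oo] --> l x.
    move: cl; rewrite /chi mem_set//=.
    by under eq_fun do rewrite mulr1.
  have : (h n0 x - h n x) ^+ 2 @[n0 --> \oo] --> (l x - h n x) ^+ 2.
    by rewrite expr2; under eq_fun do rewrite expr2; apply: cvgM; apply: cvgB => //; exact: cvg_cst.
  move/cvgr_to_le; apply; exists n => // m /= nm.
  by rewrite -(subnKC nm); exact: bnd.
have mc n : mfun (fun x => h n x * chi x) by apply: mfunM => //; have [] := Lh n.
have ml : mfun l by apply: mfun_cvg mc _; exact: chl.
have Lch n : L2 (fun x => l x - h n x * chi x).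
  split; first exact: mfunB.
  apply: (L1_le (L1Z (2 * 2 ^- n) Ls)); first by apply: mfunX; exact: mfunB.
  by move=> x; rewrite ger0_norm ?sqr_ge0.
have aech n : {ae mu, forall x, l x - h n x * chi x = l x - h n x}.
  by apply: aeS aeA _ => x Ax; rewrite /chi mem_set//= mulr1.
have mlh n : mfun (fun x => l x - h n x) by apply: mfunB => //; have [] := Lh n.
have Llh n := L2_ae (Lch n) (mlh n) (aech n).
exists l.
  rewrite (_ : l = (fun x => (l x - h 0%N x) + h 0%N x)); first exact: L2D.
  by apply/funext => x; rewrite subrK.
move=> n; rewrite -(ip_ae (Lch n) (Llh n) (mlh n) (aech n)).
rewrite ipC -(ip_ae (Lch n) (Lch n) (mlh n) (aech n)) /ip.
apply: (@le_trans _ _ (2 * 2 ^- n * \int[mu]_x s x)).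
  rewrite -intZ//; apply: int_le => //; [exact: L2M|exact: L1Z|].
  by move=> x; rewrite -expr2.
rewrite (_ : 4 * _ = 2 * 2 ^- n * 2); last by ring.
by rewrite ler_wpM2l// mulr_ge0// invr_ge0 exprn_ge0.
Qed.

(** A Cauchy sequence stays close to a rapidly convergent subsequence. *)
Lemma L2_complete (h : nat -> R -> R) :
  (forall n, L2 (h n)) ->
  (forall e, 0 < e -> exists N, forall m n, (N <= m)%N -> (N <= n)%N ->
    ip (fun x => h m x - h n x) (fun x => h m x - h n x) <= e) ->
  exists2 l, L2 l &
    ip (fun x => h n x - l x) (fun x => h n x - l x) @[n --> \oo] --> 0.
Proof.
move=> Lh Ch.
have /choice[N HN] : forall k, exists N, forall m n, (N <= m)%N -> (N <= n)%N ->
    ip (fun x => h m x - h n x) (fun x => h m x - h n x) <= 8 ^- k.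
  by move=> k; apply: Ch; rewrite invr_gt0 exprn_gt0.
(* cumulative sums turn the ranks N k into an increasing sequence of ranks *)
pose M k := (\sum_(i < k.+1) N i)%N.
have NM k : (N k <= M k)%N by rewrite /M big_ord_recr leq_addl.
have NM1 k : (N k <= M k.+1)%N.
  by rewrite (leq_trans (NM k))// /M [in X in (_ <= X)%N]big_ord_recr leq_addr.
have [|k|l Ll hl] := @L2_complete_fast (fun k => h (M k)).
- by move=> k; exact: Lh.
- exact: HN.
exists l => //.
apply/cvgrPdist_le => e e0.
have [k ke] : exists k, 10 * 2 ^- k <= e.
  have : 10 * (2^-1) ^+ n @[n --> \oo] --> 10 * (0 : R).
    by apply: cvgMr; apply: cvg_expr; rewrite ger0_norm; lra.
  rewrite mulr0 => /cvgrPdist_lt/(_ _ e0)[n _ /(_ n (leqnn n))].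
  rewrite /= sub0r normrN exprVn => /(le_lt_trans (ler_norm _)) /ltW ?.
  by exists n.
exists (N k) => // n /= Nn; rewrite sub0r normrN ger0_norm ?ip_ge0//.
apply: le_trans ke.
rewrite (@eq_ip _ (fun x => h n x - l x) (fun x => (h n x - h (M k) x) + - (l x - h (M k) x))
  (fun x => h n x - l x) (fun x => (h n x - h (M k) x) + - (l x - h (M k) x))); last 2 first.
- by move=> x; rewrite opprB addrA subrK.
- by move=> x; rewrite opprB addrA subrK.
have L1' := L2B (Lh n) (Lh (M k)); have L2' := L2B Ll (Lh (M k)).
apply: le_trans (ip_sqrD_le L1' (L2N L2')) _.
rewrite ipNN.
have H1 := HN k n (M k) Nn (NM k); have H2 := hl k.
have H3 : 8 ^- k <= 2 ^- k :> R.
  by rewrite lef_pV2 ?posrE ?exprn_gt0// lerXn2r ?nnegrE//; lra.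
rewrite /ip in H1 H2 *; lra.
Qed.

End completeness.

(** * The Hartley transform of integrable functions *)

Section hartley_transform.
Context {R : realType}.
Local Notation mu := (@lebesgue_measure R).
Implicit Types (f g h : R -> R) (a b c t x y : R).

Definition cas t : R := cos t + sin t.

(** A real-valued form of the Fourier transform: its even and odd parts are the
    real part and the opposite of the imaginary part. Unlike the Fourier
    kernel, [cas (x * y)] is real, and symmetric in [x] and [y], so that the
    transform is its own adjoint and, up to [2 * pi], its own inverse. *)
Definition hartley f : R -> R := fun y => \int[mu]_x (f x * cas (x * y)).

Lemma cas_le2 t : `|cas t| <= 2.
Proof.
rewrite (le_trans (ler_normD _ _))// -[2]/(1 + 1) lerD//.
  exact: cos_max.
exact: sin_max.
Qed.

Lemma is_derive_cas t : is_derive t 1 cas (cas (- t)).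
Proof.
rewrite /cas cosN sinN.
have -> : cos t - sin t = - sin t + cos t by rewrite addrC.
exact: is_deriveD.
Qed.

Lemma continuous_cas : continuous cas.
Proof. by move=> t; apply: continuousD; [exact: continuous_cos|exact: continuous_sin]. Qed.

Lemma continuous_casl y : continuous (fun x => cas (x * y)).
Proof. by apply: (cont_comp continuous_cas); exact: cont_mulr. Qed.

Lemma continuous_casr c x : continuous (fun y => c * cas (x * y)).
Proof.
apply: contM; first exact: cont_cst.
by apply: (cont_comp continuous_cas); exact: cont_mull.
Qed.

Lemma mfun_cas y : mfun (fun x => cas (x * y)).
Proof. by apply: mfun_continuous; exact: continuous_casl. Qed.

Lemma L1_cas f y : L1 f -> L1 (fun x => f x * cas (x * y)).
Proof.
by move=> Lf; apply: L1M_bounded Lf (mfun_cas y) (fun x => cas_le2 (x * y)).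
Qed.

Lemma hartley_bounded f y : L1 f -> `|hartley f y| <= 2 * \int[mu]_x `|f x|.
Proof.
move=> Lf; have Lfc := L1_cas y Lf.
apply: le_trans (int_norm Lfc) _; rewrite -intZ; last exact: L1_norm.
apply: int_le; [exact: L1_norm|exact/L1Z/L1_norm|move=> x].
by rewrite normrM mulrC ler_wpM2r// cas_le2.
Qed.

Lemma continuous_hartley f : L1 f -> continuous (hartley f).
Proof.
move=> Lf y0; rewrite /hartley.
apply: (@continuity_under_integral R _ _ mu (fun y x => f x * cas (x * y)) setT
  measurableT (y0 - 1) (y0 + 1) _ _ (fun x => 2 * `|f x|)).
- by move=> y _; exact: L1_cas.
- apply: aeW => x _ y _.
  exact: (@continuous_casr (f x) x).
- exact/L1Z/L1_norm.
- move=> y _; apply: aeW => x _.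
  by rewrite normrM mulrC ler_wpM2r// cas_le2.
- by rewrite inE/= in_itv/=; lra.
Qed.

Lemma mfun_hartley f : L1 f -> mfun (hartley f).
Proof. by move=> /continuous_hartley; exact: mfun_continuous. Qed.

Lemma hartleyD f g y : L1 f -> L1 g ->
  hartley (fun x => f x + g x) y = hartley f y + hartley g y.
Proof.
move=> Lf Lg; rewrite /hartley -intD; [|exact: L1_cas..].
by apply: eq_int => x; rewrite mulrDl.
Qed.

Lemma hartleyZ c f y : L1 f -> hartley (fun x => c * f x) y = c * hartley f y.
Proof.
move=> Lf; rewrite /hartley -intZ; last exact: L1_cas.
by apply: eq_int => x; rewrite mulrA.
Qed.

Lemma hartley_opp f y : L1 f -> hartley (fun x => f (- x)) y = hartley f (- y).
Proof.
move=> Lf; rewrite /hartley -(int_opp (L1_cas (- y) Lf)).2.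
by apply: eq_int => x; rewrite mulrNN.
Qed.

(** Fubini's theorem, for the bounded symmetric kernel [cas (x * y)]. *)
Lemma hartley_symmetric f g : L1 f -> L1 g ->
  ip (hartley f) g = ip f (hartley g).
Proof.
move=> Lf Lg; have mf := L1_mfun Lf; have mg := L1_mfun Lg.
pose F (z : measurableTypeR R * measurableTypeR R) : \bar R :=
  (f z.1 * g z.2 * cas (z.1 * z.2))%:E.
pose G (z : measurableTypeR R * measurableTypeR R) : \bar R :=
  (2 * `|f z.1| * `|g z.2|)%:E.
have m1 : measurable_fun [set: measurableTypeR R * measurableTypeR R] (f \o fst).
  by apply: measurableT_comp mf _.
have m2 : measurable_fun [set: measurableTypeR R * measurableTypeR R] (g \o snd).
  by apply: measurableT_comp mg _.
have mF : measurable_fun setT F.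
  apply/measurable_EFinP; apply: measurable_funM; first exact: measurable_funM.
  apply: (measurableT_comp (mfun_continuous continuous_cas)).
  by apply: measurable_funM.
have mG : measurable_fun setT G.
  apply/measurable_EFinP; apply: measurable_funM.
    apply: measurable_funM => //.
    by apply: (measurableT_comp (mfun_continuous (@norm_continuous _ _))).
  by apply: (measurableT_comp (mfun_continuous (@norm_continuous _ _))).
have iG : (mu \x mu)%E.-integrable setT G.
  apply/integrable12ltyP => //.
  have e x : (\int[mu]_y `|G (x, y)| = (2 * `|f x| * \int[mu]_y `|g y|)%:E)%E.
    rewrite -intZ; last exact: L1_norm.
    rewrite EFin_int; last exact/L1Z/L1_norm.
    by apply: eq_integral => y _; rewrite /G gee0_abs// lee_fin !mulr_ge0.
  under eq_integral do rewrite e.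
  rewrite -EFin_int ?ltry//=.
  rewrite (_ : (fun x => _) = fun x => 2 * \int[mu]_y `|g y| * `|f x|).
    exact/L1Z/L1_norm.
  by apply/funext => x; ring.
have iF : (mu \x mu)%E.-integrable setT F.
  apply: le_integrable iG => // -[x y] _ /=; rewrite lee_fin !normrM !normr_id.
  rewrite mulrC -[leRHS]mulrA ler_wpM2r ?mulr_ge0//.
  by rewrite (le_trans (cas_le2 _))// ler_norm.
have LgT x : L1 (fun y => f x * g y * cas (x * y)).
  under eq_fun do rewrite -mulrA (mulrC x).
  exact/L1Z/L1_cas.
have LfT y : L1 (fun x => f x * g y * cas (x * y)).
  under eq_fun do rewrite mulrAC mulrC.
  exact/L1Z/L1_cas.
have LTf : L1 (fun y => hartley f y * g y).
  by under eq_fun do rewrite mulrC; apply: (L1M_bounded Lg (mfun_hartley Lf)) => y; exact: hartley_bounded.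
have LTg : L1 (fun y => f y * hartley g y).
  by apply: (L1M_bounded Lf (mfun_hartley Lg)) => y; exact: hartley_bounded.
have := Fubini iF.
under eq_integral => x _ do rewrite -(EFin_int (LgT x)).
under [RHS]eq_integral => y _ do rewrite -(EFin_int (LfT y)).
have e1 x : \int[mu]_y (f x * g y * cas (x * y)) = f x * hartley g x.
  rewrite /hartley -intZ; last exact: L1_cas.
  by apply: eq_int => y; rewrite (mulrC x) mulrA.
have e2 y : \int[mu]_x (f x * g y * cas (x * y)) = hartley f y * g y.
  rewrite mulrC /hartley -intZ; last exact: L1_cas.
  by apply: eq_int => x; ring.
under eq_integral do rewrite e1.
under [RHS]eq_integral do rewrite e2.
by move=> E; apply: EFin_inj; rewrite /ip !EFin_int//; exact: esym.
Qed.

End hartley_transform.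

(** * Derivation rules and the fundamental theorem of calculus *)

Section fundamental_theorem.
Context {R : realType}.
Local Notation mu := (@lebesgue_measure R).
Implicit Types (f g F : R -> R) (a b c t x y : R).

Lemma drvD f g x a b : is_derive x 1 f a -> is_derive x 1 g b ->
  is_derive x 1 (fun x => f x + g x) (a + b).
Proof. by move=> fa gb; have := is_deriveD fa gb. Qed.

Lemma drvB f g x a b : is_derive x 1 f a -> is_derive x 1 g b ->
  is_derive x 1 (fun x => f x - g x) (a - b).
Proof. by move=> fa gb; have := is_deriveB fa gb. Qed.

Lemma drvM f g x a b : is_derive x 1 f a -> is_derive x 1 g b ->
  is_derive x 1 (fun x => f x * g x) (a * g x + f x * b).
Proof.
move=> fa gb; have := is_deriveM fa gb.
by rewrite /GRing.scale/= addrC (mulrC a).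
Qed.

Lemma drv_cst c x : is_derive x 1 (fun=> c) 0.
Proof. exact: is_derive_cst. Qed.

Lemma drvZ f c x a : is_derive x 1 f a -> is_derive x 1 (fun x => c * f x) (c * a).
Proof. by move=> fa; have := is_deriveZ c fa. Qed.

Lemma drv_mulr c x : is_derive x 1 (fun x => c * x) c.
Proof.
have := drvZ c (is_derive_id x 1).
by rewrite mulr1.
Qed.

Lemma drv_comp f g x a b : is_derive (g x) 1 f a -> is_derive x 1 g b ->
  is_derive x 1 (fun x => f (g x)) (a * b).
Proof. by move=> fa gb; have := is_derive1_comp fa gb. Qed.

Lemma drv_continuous f (df : R -> R) :
  (forall x, is_derive x 1 f (df x)) -> continuous f.
Proof.
move=> Ff x; apply: differentiable_continuous; apply/derivable1_diffP.
by have [] := Ff x.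
Qed.

Lemma int_cut_FTC F f a b : a <= b -> continuous f ->
  (forall x, is_derive x 1 F (f x)) -> \int[mu]_x cut a b f x = F b - F a.
Proof.
rewrite le_eqVlt => /orP[/eqP <- cf _|ab cf Ff].
  by rewrite int_cut set_itv1 Rintegral_set1 subrr.
rewrite int_cut /Rintegral (@continuous_FTC2 _ f F a b ab)//.
- exact: continuous_subspaceT.
- have cF := drv_continuous Ff.
  split.
  + by move=> x _; have [] := Ff x.
  + exact/cvg_at_right_filter/cF.
  + exact/cvg_at_left_filter/cF.
- by move=> x _; rewrite derive1E; have [_] := Ff x.
Qed.

Lemma int_cut_split f a b c : a <= b -> b <= c -> L1 (cut a c f) ->
  \int[mu]_x cut a c f x = \int[mu]_x cut a b f x + \int[mu]_x cut b c f x.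
Proof.
move=> ab bc /L1_cutP Lf; rewrite !int_cut.
have := @Rintegral_itvB R f (BLeft a) (BRight c) b Lf.
rewrite !bnd_simp => /(_ ab bc) H.
rewrite -(@Rintegral_itv_obnd_cbnd _ b (BRight c) f) -?H ?subrKC//.
apply: integrableS Lf => //.
by apply: subset_itvr; rewrite bnd_simp.
Qed.

Lemma eq_int_cut f g a b : (forall x, a <= x <= b -> f x = g x) ->
  \int[mu]_x cut a b f x = \int[mu]_x cut a b g x.
Proof. by move=> fg; apply: eq_int => x; rewrite /cut; case: ifP => // /fg ->. Qed.

Lemma is_derive_exp_trig (e t x : R) : e ^+ 2 + t ^+ 2 != 0 ->
  is_derive x 1 (fun x => (e ^+ 2 + t ^+ 2)^-1 *
      (expR (e * x) * (t * sin (t * x) + e * cos (t * x))))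
    (expR (e * x) * cos (t * x)).
Proof.
move=> et0.
have d1 := drv_comp (is_derive_expR (e * x)) (drv_mulr e x).
have d2 := drvZ t (drv_comp (is_derive_sin (t * x)) (drv_mulr t x)).
have d3 := drvZ e (drv_comp (is_derive_cos (t * x)) (drv_mulr t x)).
apply: is_derive_eq (drvZ _ (drvM d1 (drvD d2 d3))) _.
by field.
Qed.

Lemma continuous_exp_cos e t : continuous (fun x => expR (e * x) * cos (t * x)).
Proof.
apply: contM; apply: cont_comp; try exact: cont_mull.
  exact: continuous_expR.
exact: continuous_cos.
Qed.

End fundamental_theorem.

(** * The Poisson kernel *)

Section poisson_kernel.
Context {R : realType}.
Local Notation mu := (@lebesgue_measure R).
Implicit Types (f g F : R -> R) (a b c e t x y : R).

Definition damping e x : R := expR (- (e * `|x|)).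

Definition poisson e t : R := 2 * e / (e ^+ 2 + t ^+ 2).

Lemma continuous_damping e : continuous (damping e).
Proof.
apply: (cont_comp (@continuous_expR R)).
by apply/contN/contM; [exact: cont_cst|exact: cont_norm].
Qed.

(** On each half-line the integrand has the antiderivative of
    [is_derive_exp_trig], with [e] replaced by [- e] on the right. *)
Lemma damping_cut (e t : R) n : 0 < e ->
  \int[mu]_x cut (- n%:R) n%:R (fun x => damping e x * cos (x * t)) x =
  poisson e t + 2 * (e ^+ 2 + t ^+ 2)^-1 * (expR (- (e * n%:R)) *
    (t * sin (t * n%:R) - e * cos (t * n%:R))).
Proof.
move=> e0.
have et0 : e ^+ 2 + t ^+ 2 != 0.
  by rewrite gt_eqF// ltr_pwDl ?exprn_gt0// sqr_ge0.
have cf : continuous (fun x => damping e x * cos (x * t)).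
  apply: contM; first exact: continuous_damping.
  apply: cont_comp; [exact: continuous_cos|exact: cont_mulr].
rewrite (@int_cut_split _ _ _ 0) ?oppr_le0//; last exact: L1_cut_continuous.
rewrite (@eq_int_cut _ _ (fun x => expR (e * x) * cos (t * x))); last first.
  by move=> x /andP[_ x0]; rewrite /damping ler0_norm// mulrN opprK (mulrC x).
rewrite [X in _ + X](@eq_int_cut _ _ (fun x => expR (- e * x) * cos (t * x))); last first.
  by move=> x /andP[x0 _]; rewrite /damping ger0_norm// mulNr (mulrC x).
rewrite (int_cut_FTC _ (@continuous_exp_cos _ e t) (fun x => is_derive_exp_trig x et0)) ?oppr_le0//.
have et0' : (- e) ^+ 2 + t ^+ 2 != 0 by rewrite sqrrN.
rewrite (int_cut_FTC _ (@continuous_exp_cos _ (- e) t) (fun x => is_derive_exp_trig x et0'))//.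
rewrite !mulr0 expR0 sin0 cos0 !mulrN sinN cosN mulNr /poisson sqrrN mulr0 !mul1r.
by field.
Qed.

Lemma L1_damping e : 0 < e -> L1 (damping e).
Proof.
move=> e0.
have cd := @continuous_damping e.
have [] // := @int_mct _ (fun n => cut (- n%:R) n%:R (damping e)) (damping e) (poisson e 0).
- by move=> n; exact: L1_cut_continuous.
- exact: mfun_continuous.
- by move=> n x; rewrite /cut; case: ifP => // _; exact: expR_ge0.
- move=> x m n mn; rewrite /cut; case: ifP => [/andP[mx xm]|_].
    have mnR : m%:R <= n%:R :> R by rewrite ler_nat.
    by rewrite ifT//; apply/andP; split; lra.
  by case: ifP => // _; exact: expR_ge0.
- by move=> x; exact: cut_cvg.
move=> n; have := damping_cut 0 n e0.
rewrite (_ : (fun x => _ * cos _) = damping e); last first.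
  by apply/funext => x; rewrite mulr0 cos0 mulr1.
move=> ->; rewrite !mul0r cos0 mulr1 sub0r gerDl !mulrN oppr_le0.
by rewrite !mulr_ge0// ?expR_ge0 ?invr_ge0 ?addr_ge0 ?sqr_ge0// ltW.
Qed.

(** The boundary terms of [damping_cut] decay exponentially. *)
Lemma int_damping_cos e t : 0 < e ->
  \int[mu]_x (damping e x * cos (x * t)) = poisson e t.
Proof.
move=> e0.
have mc : mfun (fun x => cos (x * t)).
  apply: mfun_continuous; apply: (cont_comp (@continuous_cos R)); exact: cont_mulr.
have L := L1M_bounded (L1_damping e0) mc (fun x => cos_max _).
have cv := int_cut_cvg L.
suff : poisson e t + 2 * (e ^+ 2 + t ^+ 2)^-1 * (expR (- (e * n%:R)) *
    (t * sin (t * n%:R) - e * cos (t * n%:R))) @[n --> \oo] --> poisson e t + 2 * (e ^+ 2 + t ^+ 2)^-1 * 0.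
  rewrite mulr0 addr0; under eq_fun do rewrite -(damping_cut t _ e0).
  exact: cvg_unique cv.
apply: cvgD; first exact: cvg_cst.
apply: cvgMr; apply: norm_cvg0.
have g0 : expR (- e) ^+ n * (`|t| + e) @[n --> \oo] --> 0 * (`|t| + e).
  apply: cvgMl; apply: cvg_expr.
  by rewrite ger0_norm ?expR_ge0// expR_lt1 oppr_lt0.
rewrite mul0r in g0.
apply: (squeeze_cvgr _ (cvg_cst 0) g0); apply: nearW => n /=.
rewrite normr_ge0 normrM -mulNr expRM_natr ger0_norm ?exprn_ge0 ?expR_ge0//.
rewrite ler_wpM2l ?exprn_ge0 ?expR_ge0// (le_trans (ler_normB _ _))// lerD//.
  by rewrite normrM ler_piMr// sin_max.
by rewrite normrM [`|e|]gtr0_norm// ler_piMr// ?cos_max// ltW.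
Qed.

(** [cas s * cas t = cos (s - t) + sin (s + t)], and the damped sine is odd. *)
Lemma hartley_damping_cas e x y : 0 < e ->
  hartley (fun t => damping e t * cas (t * x)) y = poisson e (x - y).
Proof.
move=> e0; rewrite -int_damping_cos// /hartley.
have Ld := L1_damping e0.
have mtrig (f : R -> R) z : continuous f -> mfun (fun t => f (t * z)).
  by move=> cf; apply: mfun_continuous; apply: (cont_comp cf); exact: cont_mulr.
have Lc := L1M_bounded Ld (mtrig _ (x - y) (@continuous_cos R)) (fun _ => cos_max _).
have Ls := L1M_bounded Ld (mtrig _ (x + y) (@continuous_sin R)) (fun _ => sin_max _).
have s0 : \int[mu]_t (damping e t * sin (t * (x + y))) = 0.
  have [_ H] := int_opp Ls.
  have : \int[mu]_t (damping e t * sin (t * (x + y))) =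
         - \int[mu]_t (damping e t * sin (t * (x + y))).
    rewrite -{1}H -mulN1r -intZ//; apply: eq_int => t.
    by rewrite /damping normrN mulNr sinN mulrN mulN1r.
  by lra.
rewrite -[RHS]addr0 -s0 -intD//; apply: eq_int => t.
rewrite /cas (mulrBr t) (mulrDr t) cosB sinD; ring.
Qed.

(** Move both transforms to the other side by [hartley_symmetric]; what
    remains is the transform of the damped kernel. *)
Lemma damped_pairing e f g : 0 < e -> L1 f -> L1 g ->
  \int[mu]_x (hartley f x * hartley g x * damping e x) =
  \int[mu]_x (f x * \int[mu]_y (g y * poisson e (x - y))).
Proof.
move=> e0 Lf Lg; have Ld := L1_damping e0.
have Lgd : L1 (fun x => hartley g x * damping e x).
  under eq_fun do rewrite mulrC.
  by apply: (L1M_bounded Ld (mfun_hartley Lg)) => x; exact: hartley_bounded.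
transitivity (ip (hartley f) (fun x => hartley g x * damping e x)).
  by apply: eq_int => x; rewrite mulrA.
rewrite hartley_symmetric//; apply: eq_int => x; congr (_ * _).
transitivity (ip (hartley g) (fun t => damping e t * cas (t * x))).
  by apply: eq_int => t; rewrite mulrA.
rewrite hartley_symmetric//; last exact: L1_cas.
by apply: eq_int => y; rewrite hartley_damping_cas.
Qed.

End poisson_kernel.

(** * The Poisson kernel as an approximate identity *)

Section approximate_identity.
Context {R : realType}.
Local Notation mu := (@lebesgue_measure R).
Implicit Types (f g F : R -> R) (a b c e t x y : R).

Lemma poisson_ge0 e t : 0 < e -> 0 <= poisson e t.
Proof.
by move=> e0; rewrite /poisson divr_ge0 ?mulr_ge0 ?addr_ge0 ?sqr_ge0// ltW.
Qed.

(** The kernel integrates a quadratic error to a quantity of order [e]. *)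
Lemma sqr_poisson_le e t : 0 < e -> t ^+ 2 * poisson e t <= 2 * e.
Proof.
move=> e0; rewrite /poisson mulrA ler_pdivrMr ?ltr_pwDl ?exprn_gt0 ?sqr_ge0//.
by rewrite mulrC ler_wpM2l ?mulr_ge0 ?(ltW e0)// lerDr sqr_ge0.
Qed.

Lemma is_derive_atan_poisson e x y : 0 < e ->
  is_derive y 1 (fun y => 2 * atan (e^-1 * (y - x))) (poisson e (x - y)).
Proof.
move=> e0.
have d1 := drvZ e^-1 (drvB (is_derive_id y 1) (drv_cst x y)).
apply: is_derive_eq (drvZ 2 (drv_comp (is_derive1_atan _) d1)) _.
rewrite /poisson.
have h1 : 1 + (e^-1 * (y - x)) ^+ 2 != 0 by rewrite gt_eqF// ltr_pwDl// sqr_ge0.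
have h2 : e ^+ 2 + (x - y) ^+ 2 != 0.
  by rewrite gt_eqF// ltr_pwDl ?exprn_gt0// sqr_ge0.
have e1 : e != 0 by rewrite gt_eqF.
apply/eqP; rewrite -subr_eq0; apply/eqP.
rewrite (_ : 1 + _ = (e ^+ 2 + (x - y) ^+ 2) / e ^+ 2); last by field.
by field; rewrite e1 h2.
Qed.

Lemma continuous_poisson e x : 0 < e -> continuous (fun y => poisson e (x - y)).
Proof.
move=> e0.
have cxy : continuous (fun y => x - y) by apply: contD; [exact: cont_cst|exact: contN cont_id].
apply: contM; first exact: cont_cst.
move=> y; apply: cvgV.
  by rewrite gt_eqF// ltr_pwDl ?exprn_gt0// sqr_ge0.
exact: (contD (cont_cst (c := _)) (contM cxy cxy)).
Qed.

Lemma int_cut_poisson e x a b : 0 < e -> a <= b ->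
  \int[mu]_y cut a b (fun y => poisson e (x - y)) y =
  2 * atan (e^-1 * (b - x)) - 2 * atan (e^-1 * (a - x)).
Proof.
move=> e0 ab; pose F y := 2 * atan (e^-1 * (y - x)).
have dF y : is_derive y 1 F (poisson e (x - y)) by exact: is_derive_atan_poisson.
by rewrite (int_cut_FTC (F := F) ab (continuous_poisson e0) dF).
Qed.

Lemma int_cut_poisson_le e x a b : 0 < e ->
  \int[mu]_y cut a b (fun y => poisson e (x - y)) y <= 2 * pi.
Proof.
move=> e0; have [ab|ba] := leP a b.
  rewrite int_cut_poisson//.
  have := atan_ltpi2 (e^-1 * (b - x)); have := atan_gtNpi2 (e^-1 * (a - x)).
  lra.
rewrite (@eq_int _ _ (fun=> 0)); first by rewrite Rintegral_cst// mul0r mulr_ge0// pi_ge0.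
by move=> y; rewrite /cut ifF//; apply/negP => /andP[/le_trans/[apply]]; rewrite leNgt ba.
Qed.

Lemma cvg_atan_harmonic c : c != 0 ->
  atan ((harmonic n)^-1 * c) @[n --> \oo] --> Num.sg c * (pi / 2).
Proof.
have H (d : R) : 0 < d -> atan ((harmonic n)^-1 * d) @[n --> \oo] --> (pi / 2 : R).
  move=> d0; apply: (cvg_comp (fun n => (harmonic n)^-1 * d) atan); last exact: cvgy_atan.
  apply/cvgryPge => A; near=> n.
  rewrite /harmonic invrK -ler_pdivrMr// (@le_trans _ _ n%:R)//.
    by near: n; exact: nbhs_infty_ger.
  by rewrite ler_nat.
case: (ltgtP c 0) => // [c0|c0] _; last by rewrite gtr0_sg// mul1r; exact: H.
rewrite ltr0_sg// mulN1r.
rewrite [X in X @ _ --> _](_ : _ = fun n => - atan ((harmonic n)^-1 * (- c))).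
  by apply: cvgN; apply: H; rewrite oppr_gt0.
by apply/funext => n; rewrite mulrN atanN opprK.
Unshelve. all: by end_near. Qed.

(** In the limit the mass [2 * pi] of the kernel concentrates at [x]; at an
    endpoint only half of it would be counted. *)
Lemma cvg_int_cut_poisson a b x : a <= b -> x != a -> x != b ->
  \int[mu]_y cut a b (fun y => poisson (harmonic n) (x - y)) y @[n --> \oo] -->
  2 * pi * cut a b (cst 1) x.
Proof.
move=> ab xa xb.
under eq_fun do rewrite (int_cut_poisson _ (harmonic_gt0 _) ab).
rewrite (_ : 2 * pi * _ = 2 * (Num.sg (b - x) * (pi / 2)) - 2 * (Num.sg (a - x) * (pi / 2))); last first.
  rewrite /cut; case: (ltgtP a x) xa => //= [ax _|xa' _].
    rewrite (@ltr0_sg _ (a - x)) ?subr_lt0//.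
    case: (ltgtP x b) xb => //= [xb _|bx _].
      by rewrite gtr0_sg ?subr_gt0//; lra.
    by rewrite ltr0_sg ?subr_lt0//; lra.
  rewrite !gtr0_sg ?subr_gt0//; last exact: lt_le_trans ab.
  by lra.
by apply: cvgB; apply: cvgMr; apply: cvg_atan_harmonic; rewrite subr_eq0 eq_sym.
Qed.

Lemma poisson_smoothing_le f a b M n x : (forall y, `|cut a b f y| <= M) ->
  continuous f ->
  `|\int[mu]_y (cut a b f y * poisson (harmonic n) (x - y))| <= M * (2 * pi).
Proof.
move=> fM cf; have h0 := @harmonic_gt0 R n.
have cp := continuous_poisson (x := x) h0.
rewrite cutM.
have L := L1_cut_continuous a b (contM cf cp).
apply: le_trans (int_norm L) _.
apply: (@le_trans _ _ (\int[mu]_y (M * cut a b (fun y => poisson (harmonic n) (x - y)) y))).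
  apply: int_le; [exact: L1_norm|exact/L1Z/L1_cut_continuous|move=> y].
  have := fM y; rewrite /cut; case: ifP => _ fy; last by rewrite normr0 mulr0.
  by rewrite normrM (ger0_norm (poisson_ge0 _ h0)) ler_wpM2r// poisson_ge0.
rewrite intZ; last exact: L1_cut_continuous.
rewrite ler_wpM2l ?int_cut_poisson_le//.
by apply: le_trans (fM 0).
Qed.

(** Close to [x], the values of [f] differ little from [f x]; further away they
    differ by at most a multiple of [(x - y)^2], to which [sqr_poisson_le]
    applies. *)
Lemma poisson_smoothing_cvg f a b x : continuous f -> a <= b -> x != a -> x != b ->
  \int[mu]_y (cut a b f y * poisson (harmonic n) (x - y)) @[n --> \oo] -->
  2 * pi * cut a b f x.
Proof.
move=> cf ab xa xb.
have [M fM] := cut_bounded a b cf.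
have M0 : 0 <= M by apply: le_trans (fM 0).
(* it is enough to treat the difference with f x times the mass of the kernel *)
have Lf n : L1 (cut a b (fun y => f y * poisson (harmonic n) (x - y))).
  by apply: L1_cut_continuous; apply: contM => //; exact: (continuous_poisson (harmonic_gt0 n)).
have Lp n : L1 (cut a b (fun y => poisson (harmonic n) (x - y))).
  by apply: L1_cut_continuous; exact: (continuous_poisson (harmonic_gt0 n)).
have main := cvg_int_cut_poisson ab xa xb.
rewrite (_ : 2 * pi * cut a b f x = f x * (2 * pi * cut a b (cst 1) x)); last first.
  by rewrite /cut; case: ifP => _ /=; ring.
suff key : (\int[mu]_y (cut a b f y * poisson (harmonic n) (x - y)) -
    f x * \int[mu]_y cut a b (fun y => poisson (harmonic n) (x - y)) y)
    @[n --> \oo] --> 0.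
  rewrite -[X in _ --> X]add0r.
  rewrite (_ : (fun n => _) = (fun n =>
    (\int[mu]_y (cut a b f y * poisson (harmonic n) (x - y)) -
     f x * \int[mu]_y cut a b (fun y => poisson (harmonic n) (x - y)) y) +
     f x * \int[mu]_y cut a b (fun y => poisson (harmonic n) (x - y)) y)).
    by apply: cvgD => //; apply: cvgMr.
  by apply/funext => n; rewrite subrK.
apply/cvgrPdist_le => e e0.
have pi0 : 0 < 2 * pi :> R by rewrite mulr_gt0// pi_gt0.
pose d := e / 2 / (2 * pi).
have d0 : 0 < d by rewrite !divr_gt0.
have /cvgrPdist_lt/(_ _ d0)[r /= r0 fr] := cf x.
pose C := (M + `|f x|) / r ^+ 2.
have C0 : 0 <= C by rewrite divr_ge0 ?addr_ge0 ?sqr_ge0.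
have fd y : a <= y <= b -> `|f y - f x| <= d + C * (x - y) ^+ 2.
  move=> yab; have [yr|yr] := ltP `|x - y| r.
    have := fr y yr; rewrite distrC => /ltW/le_trans; apply.
    by rewrite lerDl mulr_ge0// sqr_ge0.
  have fy : `|f y| <= M by have := fM y; rewrite /cut yab.
  apply: (@le_trans _ _ (C * (x - y) ^+ 2)); last by rewrite lerDr ltW.
  apply: (le_trans (ler_normB _ _)); apply: (@le_trans _ _ (M + `|f x|)).
    by rewrite lerD2r.
  rewrite /C mulrAC ler_pdivlMr ?exprn_gt0// ler_wpM2l ?addr_ge0//.
  rewrite -(real_normK (num_real (x - y))) lerXn2r ?nnegrE//.
  exact: ltW.
have bound n : `|\int[mu]_y (cut a b f y * poisson (harmonic n) (x - y)) -
    f x * \int[mu]_y cut a b (fun y => poisson (harmonic n) (x - y)) y| <=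
    d * (2 * pi) + C * (2 * (b - a)) * harmonic n.
  have h0 := @harmonic_gt0 R n.
  rewrite cutM -intZ; last exact: Lp.
  rewrite -intB; [|exact: Lf|exact: L1Z].
  have L1c : L1 (cut a b (cst 1)) by apply: L1_cut_continuous; exact: cont_cst.
  have i1 : \int[mu]_y cut a b (cst 1) y = b - a.
    by rewrite (int_cut_FTC (F := id) ab (cont_cst (c := 1)) (fun x => is_derive_id x 1)).
  apply: le_trans (int_norm (L1B (Lf n) (L1Z _ (Lp n)))) _.
  apply: (@le_trans _ _ (\int[mu]_y (d * cut a b (fun y => poisson (harmonic n) (x - y)) y +
     C * (2 * harmonic n) * cut a b (cst 1) y))).
    apply: int_le; [exact: L1_norm (L1B (Lf n) (L1Z _ (Lp n)))|by apply: L1D; exact: L1Z|move=> y].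
    rewrite /cut; case: ifP => yab /=; last by rewrite !mulr0 subrr addr0 normr0.
    rewrite mulr1 -mulrBl normrM (ger0_norm (poisson_ge0 _ h0)).
    apply: (le_trans (ler_wpM2r (poisson_ge0 _ h0) (fd y yab))).
    by rewrite mulrDl lerD2l -mulrA ler_wpM2l// sqr_poisson_le.
  rewrite intD; [|exact: L1Z..].
  rewrite !intZ// i1; apply: lerD.
    by rewrite ler_wpM2l ?int_cut_poisson_le// ltW.
  rewrite le_eqVlt; apply/orP; left; apply/eqP; ring.
have hC : C * (2 * (b - a)) * harmonic n @[n --> \oo] --> C * (2 * (b - a)) * (0 : R).
  by apply: cvgMr; exact: cvg_harmonic.
have e2 : 0 < e / 2 by rewrite divr_gt0.
rewrite mulr0 in hC; move/cvgrPdist_le : hC => /(_ _ e2).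
apply: filterS => n; rewrite sub0r normrN => /(le_trans (ler_norm _)) hn.
rewrite sub0r normrN; apply: le_trans (bound n) _.
rewrite /d divfK ?gt_eqF//; lra.
Qed.

End approximate_identity.

(** * Plancherel's formula for truncated continuous functions *)

Section plancherel.
Context {R : realType}.
Local Notation mu := (@lebesgue_measure R).
Implicit Types (f g F : R -> R) (a b c e t x y : R).

Lemma damping_cvg x : damping (harmonic n) x @[n --> \oo] --> (1 : R).
Proof.
rewrite -(@expR0 R).
apply: (cvg_comp (fun n => - (harmonic n * `|x|)) (@expR R)); last exact: continuous_expR.
rewrite -oppr0 -[X in - X](mul0r `|x|).
by apply: cvgN; apply: cvgMl; exact: cvg_harmonic.
Qed.

Lemma damping_ge0 e x : 0 <= damping e x. Proof. exact: expR_ge0. Qed.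

Lemma damping_le1 e x : 0 <= e -> damping e x <= 1.
Proof. by move=> e0; rewrite expR_le1 oppr_le0 mulr_ge0. Qed.

Lemma damping_nd x : {homo (fun n => damping (harmonic n) x) : m n / (m <= n)%N >-> m <= n}.
Proof.
move=> m n mn; rewrite ler_expR lerN2 ler_wpM2r// /harmonic.
by rewrite lef_pV2 ?posrE// ler_nat.
Qed.

Lemma ae_neq a : {ae mu, forall x, x != a}.
Proof.
exists [set a]; split; [exact: measurable_set1|exact: lebesgue_measure_set1|].
by move=> x /= /negP; rewrite negbK => /eqP.
Qed.

(** Dominated convergence in [damped_pairing]: the inner integral is bounded and
    tends to [2 * pi * cut a b g] except at the two endpoints. *)
Lemma damped_pairing_cvg f g a b : L1 f -> continuous g -> a <= b ->
  \int[mu]_x (hartley f x * hartley (cut a b g) x * damping (harmonic n) x)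
    @[n --> \oo] --> 2 * pi * ip f (cut a b g).
Proof.
move=> Lf cg ab; have Lg := L1_cut_continuous a b cg.
under eq_fun do rewrite (damped_pairing (harmonic_gt0 _) Lf Lg).
rewrite /ip -intZ; last first.
  have [M gM] := cut_bounded a b cg.
  exact: L1M_bounded Lf (L1_mfun Lg) gM.
have [M gM] := cut_bounded a b cg.
apply: (proj2 (@int_dct R _ _ (fun x => M * (2 * pi) * `|f x|) _ _ _ _ _)).
- move=> n; apply: mfunM; first exact: L1_mfun.
  have h0 := @harmonic_gt0 R n.
  rewrite (_ : (fun x => _) = hartley (fun t => hartley (cut a b g) t * damping (harmonic n) t)).
    apply: mfun_hartley; under eq_fun do rewrite mulrC.
    by apply: (L1M_bounded (L1_damping h0) (mfun_hartley Lg)) => x; exact: hartley_bounded.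
  apply/funext => x.
  transitivity (ip (hartley (cut a b g)) (fun t => damping (harmonic n) t * cas (t * x))).
    rewrite hartley_symmetric//; last exact/L1_cas/L1_damping.
    by apply: eq_int => y; rewrite hartley_damping_cas.
  by apply: eq_int => t; rewrite mulrA.
- apply: mfunM; first exact: mfun_cst.
  by apply: mfunM; exact: L1_mfun.
- have aeab : {ae mu, forall x, x != a /\ x != b}.
    by apply: aeS2 (ae_neq a) (ae_neq b) _ => x xa xb.
  apply: (aeS aeab) => x [xa xb].
  rewrite mulrCA; apply: cvgMr; exact: poisson_smoothing_cvg.
- exact/L1Z/L1_norm.
- move=> n x; rewrite normrM mulrC ler_wpM2r//.
  exact: poisson_smoothing_le.
Qed.

(** In [damped_pairing_cvg] with [f = cut a b g] the integrand is a square times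
    an increasing factor, so that monotone convergence removes the damping and
    shows at the same time that the square is integrable. *)
Lemma plancherel g a b : continuous g -> a <= b ->
  L2 (hartley (cut a b g)) /\
  ip (hartley (cut a b g)) (hartley (cut a b g)) =
    2 * pi * ip (cut a b g) (cut a b g).
Proof.
move=> cg ab; have Lg := L1_cut_continuous a b cg.
have mTg := mfun_hartley Lg.
set Tg := hartley _ in mTg *.
have cv : \int[mu]_x (Tg x * Tg x * damping (harmonic n) x) @[n --> \oo] -->
    2 * pi * ip (cut a b g) (cut a b g) by exact: damped_pairing_cvg.
have LTd n : L1 (fun x => Tg x * Tg x * damping (harmonic n) x).
  have h0 := @harmonic_gt0 R n.
  rewrite (_ : (fun x => _) = fun x => damping (harmonic n) x * (Tg x * Tg x)).
    apply: (L1M_bounded (c := (2 * \int[mu]_x `|cut a b g x|) ^+ 2) (L1_damping h0)).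
      exact: mfunM.
    move=> x; rewrite normrM -expr2 lerXn2r ?nnegrE//.
      by rewrite mulr_ge0// int_ge0.
    exact: hartley_bounded.
  by apply/funext => x; rewrite mulrC.
have nd : {homo (fun n => \int[mu]_x (Tg x * Tg x * damping (harmonic n) x)) : m n / (m <= n)%N >-> m <= n}.
  move=> m n mn; apply: int_le => // x; rewrite ler_wpM2l ?damping_nd//.
  by rewrite -expr2 sqr_ge0.
have [] := @int_mct R (fun n x => Tg x * Tg x * damping (harmonic n) x)
  (fun x => Tg x * Tg x) (2 * pi * ip (cut a b g) (cut a b g)) LTd.
- exact: mfunM.
- by move=> n x; rewrite mulr_ge0 ?damping_ge0// -expr2 sqr_ge0.
- move=> x m n mn; rewrite ler_wpM2l ?damping_nd//.
  by rewrite -expr2 sqr_ge0.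
- move=> x; rewrite -[X in _ --> X]mulr1.
  by apply: cvgMr; exact: damping_cvg.
- move=> n; apply: (cvgr_to_ge cv); exists n => // m /= nm; exact: nd.
move=> LT cT; split; first by split=> //; under eq_fun do rewrite expr2.
exact: cvg_unique cT cv.
Qed.

(** When both transforms are square integrable, dominated convergence removes the
    damping from [damped_pairing_cvg]. *)
Lemma hartley_pairing f g a b : L1 f -> L2 (hartley f) -> continuous g -> a <= b ->
  ip (hartley f) (hartley (cut a b g)) = 2 * pi * ip f (cut a b g).
Proof.
move=> Lf LTf cg ab; have cv := damped_pairing_cvg Lf cg ab.
have [LTg _] := plancherel cg ab.
have L := L2M LTf LTg.
have [_] := @int_dct R (fun n x => hartley f x * hartley (cut a b g) x * damping (harmonic n) x)
  (fun x => hartley f x * hartley (cut a b g) x) _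
  (fun n => mfunM (L1_mfun L) (mfun_continuous (@continuous_damping R (harmonic n))))
  (L1_mfun L) ltac:(apply: aeW => x; rewrite -[X in _ --> X]mulr1; apply: cvgMr; exact: damping_cvg)
  (L1_norm L) ltac:(by move=> n x; rewrite normrM ler_piMr// ger0_norm ?damping_ge0// damping_le1// harmonic_ge0).
move=> cT; exact: cvg_unique cT cv.
Qed.

End plancherel.

(** * The Hartley transform of square integrable functions *)

Section l2_hartley.
Context {R : realType}.
Local Notation mu := (@lebesgue_measure R).
Implicit Types (f g h phi psi : R -> R) (a b c t x y : R).

Definition hartley_trunc f a : R -> R := hartley (cut (- a) a f).

(** The extension of the transform to square integrable functions, as a relation
    because [phi] is determined only up to a null set. Continuity of [f] makes
    [plancherel] applicable to its truncations and makes [f] unique. *)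
Definition l2_hartley f phi : Prop :=
  [/\ continuous f, L2 f, L2 phi &
    ip (fun y => hartley_trunc f n%:R y - phi y)
       (fun y => hartley_trunc f n%:R y - phi y) @[n --> \oo] --> 0].

(** Continuity of the inner product, from the Cauchy-Schwarz inequality. *)
Lemma ip_cvg (f_ g_ : nat -> R -> R) f g :
  (forall n, L2 (f_ n)) -> (forall n, L2 (g_ n)) -> L2 f -> L2 g ->
  ip (fun y => f_ n y - f y) (fun y => f_ n y - f y) @[n --> \oo] --> 0 ->
  ip (fun y => g_ n y - g y) (fun y => g_ n y - g y) @[n --> \oo] --> 0 ->
  ip (f_ n) (g_ n) @[n --> \oo] --> ip f g.
Proof.
move=> Lf_ Lg_ Lf Lg cf cg.
have Ldf n := L2B (Lf_ n) Lf; have Ldg n := L2B (Lg_ n) Lg.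
have E n : ip (f_ n) (g_ n) - ip f g =
    ip (fun y => f_ n y - f y) (fun y => g_ n y - g y) +
    (ip (fun y => f_ n y - f y) g + ip f (fun y => g_ n y - g y)).
  rewrite (ipBl (Lf_ n) Lf (Ldg n)) (ipBl (Lf_ n) Lf Lg).
  rewrite (ipBr (Lg_ n) Lg (Lf_ n)) (ipBr (Lg_ n) Lg Lf); ring.
have sq0 (u : nat -> R) : u n ^+ 2 @[n --> \oo] --> 0 -> u n @[n --> \oo] --> 0.
  move=> u0; apply: norm_cvg0; have := cvg_comp _ _ u0 (@sqrt_continuous R 0).
  rewrite sqrtr0; apply: cvg_trans; apply: near_eq_cvg; apply: nearW => n.
  by rewrite /= sqrtr_sqr.
have cs0 (u v w : nat -> R) (l : R) : (forall n, 0 <= u n <= v n * w n) ->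
    v n @[n --> \oo] --> 0 -> w n @[n --> \oo] --> l -> u n @[n --> \oo] --> 0.
  move=> uvw v0 wl.
  have vw : v n * w n @[n --> \oo] --> 0 by rewrite -(mul0r l); exact: cvgM.
  by apply: (squeeze_cvgr _ (cvg_cst 0) vw); apply: nearW.
suff d0 : ip (f_ n) (g_ n) - ip f g @[n --> \oo] --> 0 + (0 + (0 : R)).
  by rewrite !addr0 in d0; apply/subr_cvg0; exact: d0.
under eq_fun do rewrite E.
apply: cvgD; last apply: cvgD; apply: sq0.
- apply: cs0 cf cg => n; rewrite sqr_ge0; exact: cauchy_schwarz.
- apply: cs0 cf (cvg_cst (ip g g)) => n; rewrite sqr_ge0; exact: cauchy_schwarz.
- apply: cs0 cg (cvg_cst (ip f f)) => n; rewrite sqr_ge0 mulrC; exact: cauchy_schwarz.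
Qed.

Lemma ip_sqrBC f g :
  ip (fun y => f y - g y) (fun y => f y - g y) =
  ip (fun y => g y - f y) (fun y => g y - f y).
Proof. by apply: eq_int => y; ring. Qed.

Lemma ipB_cst_cvg f : L2 f ->
  ip (fun y => f y - f y) (fun y => f y - f y) @[n --> \oo] --> (0 : R).
Proof.
move=> Lf; rewrite (_ : ip _ _ = 0); first exact: cvg_cst.
by rewrite ip_sqrB//; ring.
Qed.

Lemma opp_le a : 0 <= a -> - a <= a.
Proof. by move=> a0; lra. Qed.

Lemma L2_hartley_trunc f a : continuous f -> 0 <= a -> L2 (hartley_trunc f a).
Proof. by move=> cf a0; have [] := plancherel cf (opp_le a0). Qed.

Lemma ip_cut_cut f g a b : a <= b ->
  ip (cut (- a) a f) (cut (- b) b g) = ip (cut (- a) a f) (cut (- a) a g).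
Proof.
move=> ab; apply: eq_int => x; rewrite /cut; case: ifP => [/andP[ax xa]|]; last by rewrite !mul0r.
by rewrite ifT//; apply/andP; split; lra.
Qed.

(** The pairing of two truncated transforms sees only the shorter interval; hence
    the distance between two truncated transforms is a difference of tails. *)
Lemma ip_hartley_trunc f g a b : continuous f -> continuous g -> 0 <= a -> a <= b ->
  ip (hartley_trunc f a) (hartley_trunc g b) =
  2 * pi * ip (cut (- a) a f) (cut (- a) a g).
Proof.
move=> cf cg a0 ab.
rewrite hartley_pairing//; [|exact: L1_cut_continuous|exact: L2_hartley_trunc|].
- by rewrite ip_cut_cut.
- by apply: opp_le; lra.
Qed.

(** The squared norm of [f] outside [[- a, a]]. *)
Definition tail f a : R := ip f f - ip (cut (- a) a f) (cut (- a) a f).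

Lemma dist_hartley_trunc f a b : continuous f -> 0 <= a -> a <= b ->
  ip (fun y => hartley_trunc f b y - hartley_trunc f a y)
     (fun y => hartley_trunc f b y - hartley_trunc f a y) =
  2 * pi * (tail f a - tail f b).
Proof.
move=> cf a0 ab; have b0 : 0 <= b by lra.
rewrite ip_sqrB; [|exact: L2_hartley_trunc..].
rewrite (ipC (hartley_trunc f b)) !ip_hartley_trunc// /tail; ring.
Qed.

Lemma ip_cut_cvg f g : L2 f -> L2 g ->
  ip (cut (- n%:R) n%:R f) g @[n --> \oo] --> ip f g.
Proof.
move=> Lf Lg; rewrite /ip; under eq_fun do rewrite cutM.
exact/int_cut_cvg/L2M.
Qed.

Lemma ip_cutr f g a b : ip (cut a b f) (cut a b g) = ip (cut a b f) g.
Proof. by apply: eq_int => x; rewrite /cut; case: ifP => // _; rewrite !mul0r. Qed.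

Lemma tail_cvg0 f : L2 f -> tail f n%:R @[n --> \oo] --> 0.
Proof.
move=> Lf; rewrite -(subrr (ip f f)); apply: cvgB; first exact: cvg_cst.
by under eq_fun do rewrite ip_cutr; exact: ip_cut_cvg.
Qed.

Lemma tail_ge0 f a : L2 f -> 0 <= tail f a.
Proof.
move=> Lf; rewrite subr_ge0; apply: int_le; [by apply: L2M; exact: L2_cut|exact: L2M|move=> x].
by rewrite /cut; case: ifP => // _; rewrite mul0r -expr2 sqr_ge0.
Qed.

(** The tails tend to 0, so that by [dist_hartley_trunc] the truncated transforms
    form a Cauchy sequence. *)
Lemma l2_hartley_exists f : continuous f -> L2 f -> exists phi, l2_hartley f phi.
Proof.
move=> cf Lf.
have [||phi Lphi cphi] := @L2_complete R (fun n => hartley_trunc f n%:R).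
- by move=> n; exact: L2_hartley_trunc.
- move=> e e0; have p0 : 0 < 2 * pi :> R by rewrite mulr_gt0// pi_gt0.
  have /cvgrPdist_le/(_ _ (divr_gt0 e0 p0))[N _ HN] := tail_cvg0 Lf.
  have HN' n : (N <= n)%N -> 2 * pi * tail f n%:R <= e.
    move=> /HN /=; rewrite sub0r normrN ger0_norm ?tail_ge0//.
    by rewrite ler_pdivlMr// mulrC.
  exists N => m n; wlog mn : m n / (m <= n)%N.
    move=> W Nm Nn; have [mn|nm] := leqP m n; first exact: W.
    by rewrite ip_sqrBC; exact: (W _ _ (ltnW nm)).
  move=> Nm Nn; rewrite ip_sqrBC.
  rewrite dist_hartley_trunc// ?ler_nat//.
  apply: le_trans (HN' _ Nm); rewrite ler_wpM2l ?(ltW p0)// gerBl.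
  exact: tail_ge0.
- by exists phi.
Qed.

Lemma l2_hartley_pairing f phi (c : R -> R) a b : l2_hartley f phi -> continuous c -> a <= b ->
  ip phi (cut a b c) = ip f (hartley (cut a b c)).
Proof.
move=> [cf Lf Lphi cphi] cc ab.
have Lc := L2_cut_continuous a b cc; have [LTc _] := plancherel cc ab.
have LT n : L2 (hartley_trunc f n%:R) by exact: L2_hartley_trunc.
have := ip_cvg LT (fun=> Lc) Lphi Lc cphi (ipB_cst_cvg Lc).
have e n : ip (hartley_trunc f n%:R) (cut a b c) = ip (cut (- n%:R) n%:R f) (hartley (cut a b c)).
  by rewrite hartley_symmetric//; exact: L1_cut_continuous.
under eq_fun do rewrite e.
move/cvg_unique; apply => //; exact: ip_cut_cvg.
Qed.

Lemma parseval f g phi psi : l2_hartley f phi -> l2_hartley g psi ->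
  ip phi psi = 2 * pi * ip f g.
Proof.
move=> [cf Lf Lphi cphi] [cg Lg Lpsi cpsi].
have := ip_cvg (fun n => L2_hartley_trunc cf (ler0n R n))
  (fun n => L2_hartley_trunc cg (ler0n R n)) Lphi Lpsi cphi cpsi.
under eq_fun do rewrite ip_hartley_trunc// ip_cutr.
move/cvg_unique; apply => //; apply: cvgMr; exact: ip_cut_cvg.
Qed.

(** By [parseval], the distance between [phi] and [psi] is a multiple of the
    distance between [f] and [f]. *)
Lemma l2_hartley_uniq f phi psi : l2_hartley f phi -> l2_hartley f psi ->
  {ae mu, forall x, phi x = psi x}.
Proof.
move=> h1 h2; have [_ _ L1' _] := h1; have [_ _ L2' _] := h2.
have : {ae mu, forall x, phi x - psi x = 0}.
  apply: ip_eq0_ae; first exact: L2B.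
  rewrite ip_sqrB// (parseval h1 h1) (parseval h1 h2) (parseval h2 h2); ring.
by move/aeS; apply => x /subr0_eq.
Qed.

(** By [parseval] again; continuity turns equality almost everywhere into
    equality. *)
Lemma l2_hartley_inj f g phi : l2_hartley f phi -> l2_hartley g phi -> f = g.
Proof.
move=> h1 h2; have [c1 L1' _ _] := h1; have [c2 L2' _ _] := h2.
have p0 : 2 * pi != 0 :> R by rewrite gt_eqF// mulr_gt0// pi_gt0.
have : {ae mu, forall x, f x - g x = 0}.
  apply: ip_eq0_ae; first exact: L2B.
  apply: (mulfI p0); rewrite ip_sqrB// mulrDr mulrBr mulrCA.
  rewrite -(parseval h1 h1) -(parseval h1 h2) -(parseval h2 h2); ring.
move/continuous_ae0 => H; apply/funext => x; apply/eqP; rewrite -subr_eq0; apply/eqP.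
by apply: (H (contD c1 (contN c2))).
Qed.

Lemma l2_hartley_ae f phi psi : l2_hartley f phi -> mfun psi ->
  {ae mu, forall x, phi x = psi x} -> l2_hartley f psi.
Proof.
move=> [cf Lf Lphi cphi] mpsi aee; have Lpsi := L2_ae Lphi mpsi aee.
split=> //.
rewrite (_ : (fun n => _) = (fun n => ip (fun y => hartley_trunc f n%:R y - phi y)
       (fun y => hartley_trunc f n%:R y - phi y)))//.
apply/funext => n.
have LT := L2_hartley_trunc cf (ler0n R n).
have aed : {ae mu, forall y, hartley_trunc f n%:R y - psi y = hartley_trunc f n%:R y - phi y}.
  by apply: aeS aee _ => y ->.
have m1 := mfunB LT.1 Lphi.1.
by rewrite (ip_ae (L2B LT Lpsi) (L2B LT Lpsi) m1 aed) ipC (ip_ae (L2B LT Lpsi) (L2B LT Lphi) m1 aed).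
Qed.

Lemma l2_hartleyD f g phi psi : l2_hartley f phi -> l2_hartley g psi ->
  l2_hartley (fun x => f x + g x) (fun x => phi x + psi x).
Proof.
move=> [cf Lf Lphi cphi] [cg Lg Lpsi cpsi].
split; [exact: contD|exact: L2D|exact: L2D|].
have LT1 n := L2_hartley_trunc cf (ler0n R n).
have LT2 n := L2_hartley_trunc cg (ler0n R n).
have b0 : 2 * ip (fun y => hartley_trunc f n%:R y - phi y) (fun y => hartley_trunc f n%:R y - phi y) +
  2 * ip (fun y => hartley_trunc g n%:R y - psi y) (fun y => hartley_trunc g n%:R y - psi y)
  @[n --> \oo] --> 2 * 0 + 2 * (0 : R).
  by apply: cvgD; apply: cvgMr.
rewrite !mulr0 addr0 in b0.
apply: (squeeze_cvgr _ (cvg_cst 0) b0); apply: nearW => n.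
rewrite ip_ge0/=.
apply: le_trans (ip_sqrD_le (L2B (LT1 n) Lphi) (L2B (LT2 n) Lpsi)).
rewrite le_eqVlt; apply/orP; left; apply/eqP.
have e y : hartley_trunc (fun x => f x + g x) n%:R y - (phi y + psi y) =
    (hartley_trunc f n%:R y - phi y) + (hartley_trunc g n%:R y - psi y).
  rewrite /hartley_trunc (_ : cut _ _ (fun x => f x + g x) =
     fun x => cut (- n%:R) n%:R f x + cut (- n%:R) n%:R g x).
    by rewrite hartleyD; [ring|exact: L1_cut_L2..].
  by apply/funext => x; rewrite /cut; case: ifP => //; rewrite addr0.
exact: eq_ip.
Qed.

Lemma l2_hartleyZ c f phi : l2_hartley f phi ->
  l2_hartley (fun x => c * f x) (fun x => c * phi x).
Proof.
move=> [cf Lf Lphi cphi].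
split; [exact: contM (cont_cst (c := c)) cf|exact: L2Z|exact: L2Z|].
have LT1 n := L2_hartley_trunc cf (ler0n R n).
rewrite (_ : (fun n => _) = fun n => c ^+ 2 * ip (fun y => hartley_trunc f n%:R y - phi y)
       (fun y => hartley_trunc f n%:R y - phi y)).
  by rewrite -[X in _ --> X](mulr0 (c ^+ 2)); apply: cvgMr.
apply/funext => n.
have e y : hartley_trunc (fun x => c * f x) n%:R y - c * phi y =
    c * (hartley_trunc f n%:R y - phi y).
  rewrite /hartley_trunc (_ : cut _ _ (fun x => c * f x) =
     fun x => c * cut (- n%:R) n%:R f x).
    by rewrite hartleyZ; [ring|exact: L1_cut_L2].
  by apply/funext => x; rewrite /cut; case: ifP => //; rewrite mulr0.
have Ld := L2B (LT1 n) Lphi.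
rewrite (eq_ip e e) (ipZl _ Ld (L2Z c Ld)) (ipZr _ Ld Ld); ring.
Qed.

End l2_hartley.

(** * Inversion and derivation *)

Section hartley_calculus.
Context {R : realType}.
Local Notation mu := (@lebesgue_measure R).
Implicit Types (f g h phi psi : R -> R) (a b c t x y : R).

(** Differentiation under the integral sign; the derivative of [cas t] is
    [cas (- t)]. *)
Lemma is_derive_hartley psi y : L1 psi -> L1 (fun x => x * psi x) ->
  is_derive y 1 (hartley psi) (hartley (fun x => x * psi x) (- y)).
Proof.
move=> Lp Lxp.
pose k (y x : R) := psi x * cas (x * y).
have dk (z x : R) : is_derive z 1 (fun u : R => k u x) (x * psi x * cas (x * - z)).
  apply: is_derive_eq (drvZ (psi x) (drv_comp (is_derive_cas (x * z)) (drv_mulr x z))) _.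
  by rewrite mulrN; ring.
have pk z x : partial1of2 k z x = x * psi x * cas (x * - z).
  by rewrite /partial1of2 derive1E; have [_] := dk z x.
have Iy : `]y - 1, y + 1[%classic y by rewrite /= in_itv/=; lra.
have ik z : `]y - 1, y + 1[%classic z -> mu.-integrable setT (EFin \o k z).
  by move=> _; exact: L1_cas.
have dk1 (z x : R) : `]y - 1, y + 1[%classic z -> setT x -> derivable (fun u : R => k u x) z 1.
  by move=> _ _; have [] := dk z x.
have G0 x : 0 <= 2 * `|x * psi x| by rewrite mulr_ge0.
have GL : L1 (fun x => 2 * `|x * psi x|) by exact/L1Z/L1_norm.
have kG (z x : R) : `]y - 1, y + 1[%classic z -> setT x -> `|partial1of2 k z x| <= 2 * `|x * psi x|.
  by move=> _ _; rewrite pk normrM mulrC ler_wpM2r// cas_le2.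
have D := @derivable_under_integral R _ _ mu k setT measurableT y _ _ Iy ik dk1 _ G0 GL kG.
have E := @differentiation_under_integral R _ _ mu k setT measurableT y _ _ Iy ik dk1 _ G0 GL kG.
apply: (@DeriveDef _ _ _ y 1 (hartley psi)); first exact: D.
by rewrite -derive1E [LHS]E; apply: eq_int => x; rewrite pk.
Qed.

(** [f x ^ 2 <= f y ^ 2 + \int |2 f f'|] for every [y] in [[x, x + 1]]; average
    over [y]. *)
Lemma sqr_le_window f f' x : (forall x, is_derive x 1 f (f' x)) -> continuous f' ->
  f x ^+ 2 <= 2 * \int[mu]_t cut x (x + 1) (fun t => f t ^+ 2 + f' t ^+ 2) t.
Proof.
move=> df cf'; have cf := drv_continuous df.
have ck : continuous (fun t => f t ^+ 2 + f' t ^+ 2).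
  by apply: contD; [exact: (contM cf cf)|exact: (contM cf' cf')].
set k := fun t => _ + _ in ck *.
set K := \int[mu]_t _.
have c2 : continuous (fun t => 2 * (f t * f' t)).
  exact: (contM (cont_cst (c := 2)) (contM cf cf')).
have fy y : x <= y <= x + 1 -> f x ^+ 2 <= f y ^+ 2 + K.
  move=> /andP[xy y1].
  have dff t : is_derive t 1 (fun t => f t * f t) (2 * (f t * f' t)).
    by apply: is_derive_eq (drvM (df t) (df t)) _; ring.
  have := int_cut_FTC xy c2 dff.
  rewrite -!expr2 => E.
  have : - K <= \int[mu]_t cut x y (fun t => 2 * (f t * f' t)) t.
    rewrite lerNl -mulN1r -intZ; last exact: L1_cut_continuous.
    apply: int_le; [exact/L1Z/L1_cut_continuous|exact: L1_cut_continuous|move=> t].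
    rewrite /cut; case: ifP => [/andP[xt ty]|_].
      rewrite ifT; last by apply/andP; split; lra.
      rewrite /k; have := sqr_ge0 (f t + f' t); nra.
    by case: ifP => _; rewrite mulr0// addr_ge0// sqr_ge0.
  by rewrite E; lra.
have x1 : x <= x + 1 by rewrite lerDl.
have i1 c : \int[mu]_y cut x (x + 1) (cst c) y = c.
  have dc t : is_derive t 1 (fun t => c * t) c by exact: drv_mulr.
  by rewrite (int_cut_FTC x1 (cont_cst (c := c)) dc); ring.
have cff : continuous (fun t => f t ^+ 2) by exact: (contM cf cf).
apply: (@le_trans _ _ (\int[mu]_y (cut x (x + 1) (fun t => f t ^+ 2) y + cut x (x + 1) (cst K) y))).
  rewrite -[leLHS]i1; apply: int_le.
  - by apply: L1_cut_continuous; exact: cont_cst.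
  - by apply: L1D; apply: L1_cut_continuous => //; exact: cont_cst.
  - move=> y; rewrite /cut; case: ifP => [xy|]; last by rewrite addr0.
    exact: fy.
rewrite intD ?i1; [|exact: L1_cut_continuous|by apply: L1_cut_continuous; exact: cont_cst].
rewrite mulr2n mulrDl mul1r lerD2r; apply: int_le; [exact: L1_cut_continuous..|move=> y].
by rewrite /cut; case: ifP => // _; rewrite /k lerDl sqr_ge0.
Qed.

(** The windows of [sqr_le_window] leave every bounded interval, and the part of
    the integral outside of large intervals is small. *)
Lemma L2_derive_decay f f' : (forall x, is_derive x 1 f (f' x)) -> continuous f' ->
  L2 f -> L2 f' ->
  f x @[x --> +oo] --> 0 /\ f x @[x --> -oo] --> 0.
Proof.
move=> df cf' Lf Lf'.
pose k t := f t ^+ 2 + f' t ^+ 2.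
have k0 t : 0 <= k t by rewrite addr_ge0// sqr_ge0.
have Lk : L1 k by apply: L1D; [case: Lf|case: Lf'].
pose tau (n : nat) := \int[mu]_t k t - \int[mu]_t cut (- n%:R) n%:R k t.
have tau0 : tau n @[n --> \oo] --> 0.
  rewrite -(subrr (\int[mu]_t k t)); apply: cvgB; first exact: cvg_cst.
  exact: int_cut_cvg.
have out n x : (n%:R < x \/ x + 1 < - n%:R) -> f x ^+ 2 <= 2 * tau n.
  move=> nx; apply: le_trans (sqr_le_window x df cf') _.
  rewrite ler_wpM2l// /tau -intB//; last exact: L1_cut.
  apply: int_le; [exact: L1_cut|by apply: L1B => //; exact: L1_cut|move=> t].
  rewrite /cut; case: ifP => [/andP[xt tx]|_].
    by rewrite ifF ?subr0//; apply/negP => /andP[n1 n2]; case: nx => ?; lra.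
  by case: ifP => _; rewrite ?subrr ?subr0.
have small e : 0 < e -> exists n, forall x, (n%:R < x \/ x + 1 < - n%:R) -> `|f x| < e.
  move=> e0; have e2 : 0 < e ^+ 2 / 2 by rewrite divr_gt0 ?exprn_gt0.
  have /cvgrPdist_lt/(_ _ e2)[n _ /(_ n (leqnn n))] := tau0.
  rewrite /= sub0r normrN => /(le_lt_trans (ler_norm _)) taun.
  exists n => x /out fx.
  rewrite -ltr_sqr ?nnegrE ?normr_ge0 ?ltW// real_normK ?num_real//.
  lra.
split; apply/cvgrPdist_lt => e /small[n fn].
- by exists n%:R; split => // x nx; rewrite sub0r normrN; apply: fn; left.
- exists (- n%:R - 1); split => // x nx; rewrite sub0r normrN; apply: fn; right.
  lra.
Qed.

(** The integrals over intervals determine a function up to a null set, and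
    those of the transform are given by [l2_hartley_pairing]. *)
Lemma l2_hartley_char f phi : continuous f -> L2 f -> L2 phi ->
  (forall a b, a <= b ->
    ip phi (cut a b (cst 1)) = ip f (hartley (cut a b (cst 1)))) ->
  l2_hartley f phi.
Proof.
move=> cf Lf Lphi H; have [psi hpsi] := l2_hartley_exists cf Lf.
have [_ _ Lpsi _] := hpsi.
have c1 := cont_cst (R := R) (c := 1).
apply: (l2_hartley_ae hpsi Lphi.1).
have : {ae mu, forall x, psi x - phi x = 0}.
  have Ld := L2B Lpsi Lphi.
  apply: cut_ae0 => [|a b|a b]; first exact: Ld.1.
    exact: L1_cut_L2.
  have [ab|ba] := leP a b; last first.
    rewrite (@eq_int _ _ (fun=> 0)); first by rewrite Rintegral_cst// mul0r.
    by move=> x; rewrite /cut ifF//; apply/negP => /andP[/le_trans/[apply]]; rewrite leNgt ba.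
  rewrite cutE1; have Lc := L2_cut_continuous a b c1.
  rewrite -/(ip _ _) (ipBl Lpsi Lphi Lc) H// -(l2_hartley_pairing hpsi c1 ab).
  by rewrite subrr.
by move/aeS; apply => x /subr0_eq.
Qed.

(** The transform of [psi] satisfies the criterion [l2_hartley_char] by
    [hartley_pairing]. That it is square integrable follows by duality: its
    truncations have norms bounded by that of [psi]. *)
Lemma l2_hartley_inverse psi : L1 psi -> L2 psi ->
  l2_hartley (fun x => (2 * pi)^-1 * hartley psi x) psi.
Proof.
move=> L1p L2p.
have p0 : 0 < 2 * pi :> R by rewrite mulr_gt0// pi_gt0.
have p1 : 2 * pi != 0 :> R by rewrite gt_eqF.
set g := fun x => _.
have cT := continuous_hartley L1p.
have cg : continuous g by exact: (contM (cont_cst (c := _)) cT).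
have L2g n := L2_cut_continuous (- n%:R) n%:R cg.
have L1g n := L1_cut_continuous (- n%:R) n%:R cg.
(* the transform is a contraction up to the factor 2 pi, by duality *)
have bnd n : ip (cut (- n%:R) n%:R g) (cut (- n%:R) n%:R g) <= (2 * pi)^-1 * ip psi psi.
  have nn : - n%:R <= n%:R :> R by apply: opp_le.
  have [LTg Eg] := plancherel cg nn.
  set gn := cut _ _ g in Eg LTg *; set G := ip gn gn.
  have E : G = (2 * pi)^-1 * ip psi (hartley gn).
    rewrite /G ip_cutr -(hartley_symmetric L1p (L1g n)) (ipC gn) /ip -intZ.
      by apply: eq_int => x; rewrite mulrA.
    have [M gM] := cut_bounded (- n%:R) n%:R cT.
    rewrite (_ : (fun x => _) = cut (- n%:R) n%:R (fun x => hartley psi x * g x)).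
      by apply: L1_cut_continuous; exact: contM.
    by apply/funext => x; rewrite /gn /cut; case: ifP; rewrite ?mulr0.
  have := cauchy_schwarz L2p LTg; rewrite Eg -/G => CS.
  have : ip psi (hartley gn) = 2 * pi * G by rewrite E mulVKf.
  move=> E2; rewrite E2 in CS.
  have : 0 <= G by exact: ip_ge0.
  rewrite le_eqVlt => /orP[/eqP <-|G0]; first by rewrite mulr_ge0 ?ip_ge0// invr_ge0 ltW.
  rewrite mulrC ler_pdivlMr//.
  have : (G * (2 * pi)) * (2 * pi * G) <= ip psi psi * (2 * pi * G) by move: CS; lra.
  by rewrite ler_pM2r// mulr_gt0.
have Lg : L2 g.
  split; first exact: mfun_continuous.
  have [] // := @int_mct R (fun n x => cut (- n%:R) n%:R g x * cut (- n%:R) n%:R g x)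
    (fun x => g x ^+ 2) _ (fun n => L2M (L2g n) (L2g n)) _ _ _ _ bnd.
  - by apply: mfunX; exact: mfun_continuous.
  - by move=> n x; rewrite -expr2 sqr_ge0.
  - move=> x m n mn; have mnR : m%:R <= n%:R :> R by rewrite ler_nat.
    rewrite /cut; case: ifP => [/andP[mx xm]|_]; last by rewrite mulr0 -expr2 sqr_ge0.
    by rewrite ifT//; apply/andP; split; lra.
  - by move=> x; rewrite expr2; apply: cvgM; exact: cut_cvg.
apply: l2_hartley_char => // a b ab.
have c1 := cont_cst (R := R) (c := 1).
have [LTc _] := plancherel c1 ab.
have LTp : L2 (hartley psi).
  rewrite (_ : hartley psi = fun x => 2 * pi * g x); first exact: L2Z.
  by apply/funext => x; rewrite /g mulVKf.
by rewrite (ipZl _ LTp LTc) hartley_pairing// mulKf.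
Qed.

Lemma int_derive_eq0 F F' : (forall x, is_derive x 1 F (F' x)) -> continuous F' ->
  L1 F' -> F x @[x --> +oo] --> 0 -> F x @[x --> -oo] --> 0 -> \int[mu]_x F' x = 0.
Proof.
move=> dF cF' LF' Fy FNy.
have cv := int_cut_cvg LF'.
have cv2 : F n%:R - F (- n%:R) @[n --> \oo] --> 0 - (0 : R).
  apply: cvgB.
    by apply: (cvg_comp (fun n : nat => n%:R) F); [exact: cvgr_idn|exact: Fy].
  apply: (cvg_comp (fun n : nat => - n%:R) F); last exact: FNy.
  by apply/cvgNrNy; exact: cvgr_idn.
rewrite subr0 in cv2; apply: cvg_unique cv2 => //.
rewrite (_ : (fun n : nat => F n%:R - F (- n%:R)) =
  fun n : nat => \int[mu]_x cut (- n%:R) n%:R F' x)//.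
apply/funext => n; rewrite (int_cut_FTC _ cF' dF)//.
exact: opp_le.
Qed.

(** [L2_derive_decay] removes the boundary terms. *)
Lemma integration_by_parts_L2 f g f' g' :
  (forall x, is_derive x 1 f (f' x)) -> continuous f' ->
  (forall x, is_derive x 1 g (g' x)) -> continuous g' ->
  L2 f -> L2 g -> L2 f' -> L2 g' -> ip f' g = - ip f g'.
Proof.
move=> df cf' dg cg' Lf Lg Lf' Lg'.
have cf := drv_continuous df; have cg := drv_continuous dg.
have [fy fNy] := L2_derive_decay df cf' Lf Lf'.
have [gy gNy] := L2_derive_decay dg cg' Lg Lg'.
have L1' := L2M Lf' Lg; have L2' := L2M Lf Lg'.
have : \int[mu]_x (f' x * g x + f x * g' x) = 0.
  apply: (@int_derive_eq0 (fun x => f x * g x)).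
  - by move=> x; exact: drvM.
  - by apply: contD; exact: contM.
  - exact: L1D.
  - by rewrite -[X in _ --> X](mulr0 0); exact: cvgM.
  - by rewrite -[X in _ --> X](mulr0 0); exact: cvgM.
rewrite intD// -!/(ip _ _); lra.
Qed.

(** Paired with the indicator of an interval, the transform of [f'] gives [<f', T 1>]
    with [T 1] the transform of the indicator. Integrate by parts: by
    [is_derive_hartley] the derivative of [T 1] is the reflected transform of
    the restriction of [x] to the interval, and this moves back onto the
    transform of [f]. *)
Lemma l2_hartley_derive f f' phi : (forall x, is_derive x 1 f (f' x)) ->
  continuous f' -> L2 f' -> l2_hartley f phi ->
  l2_hartley f' (fun y => - y * phi (- y)).
Proof.
move=> df cf' Lf' hphi; have [cf Lf Lphi _] := hphi.
have [phi' hphi'] := l2_hartley_exists cf' Lf'; have [_ _ Lphi' _] := hphi'.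
have mo := mfun_continuous (contN (cont_id (R := R))).
have mp : mfun (fun y => - y * phi (- y)).
  by apply: mfunM => //; exact: mfun_comp Lphi.1 mo.
apply: (l2_hartley_ae hphi' mp).
have Lc a b : L1 (cut a b (fun y => - y * phi (- y))).
  rewrite -cutM; have cN := contN (cont_id (R := R)).
  exact: L2M (L2_cut_continuous a b cN) (L2_opp Lphi).
suff : {ae mu, forall x, phi' x - - x * phi (- x) = 0}.
  by move/aeS; apply => x /subr0_eq.
have c1 := cont_cst (R := R) (c := 1).
have cutB a b : cut a b (fun x => phi' x - - x * phi (- x)) =
    fun x => cut a b phi' x - cut a b (fun y => - y * phi (- y)) x.
  by apply/funext => x; rewrite /cut; case: ifP => //; rewrite subr0.
have LcB a b : L1 (cut a b (fun x => phi' x - - x * phi (- x))).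
  by rewrite cutB; apply: L1B => //; exact: L1_cut_L2.
apply: cut_ae0 => // [|a b]; first exact: mfunB Lphi'.1 mp.
have [ab|ba] := leP a b; last first.
  rewrite (@eq_int _ _ (fun=> 0)); first by rewrite Rintegral_cst// mul0r.
  by move=> x; rewrite /cut ifF//; apply/negP => /andP[/le_trans/[apply]]; rewrite leNgt ba.
rewrite cutB intB; [|exact: L1_cut_L2|exact: Lc].
have -> : \int[mu]_x cut a b phi' x = ip phi' (cut a b (cst 1)) by rewrite cutE1.
rewrite (l2_hartley_pairing hphi' c1 ab).
have LTc := plancherel c1 ab; set h := cut a b (cst 1) in LTc *.
have L1h : L1 h by exact: L1_cut_continuous.
have cid := cont_id (R := R); have cN := contN cid.
have xh : (fun x => x * h x) = cut a b id.
  by apply/funext => x; rewrite /h /cut; case: ifP; rewrite ?mulr1 ?mulr0.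
have L1xh : L1 (fun x => x * h x) by rewrite xh; exact: L1_cut_continuous.
have [Lxh _] := plancherel cid ab; rewrite -xh in Lxh.
have cTxh : continuous (fun y => hartley (fun x => x * h x) (- y)).
  exact: (cont_comp (continuous_hartley L1xh) cN).
rewrite (integration_by_parts_L2 df cf' (fun y => is_derive_hartley y L1h L1xh) cTxh)//;
  [|exact: LTc.1|exact: (L2_opp Lxh)].
have ba' : - b <= - a by rewrite lerN2.
have e1 : (fun y => hartley (fun x => x * h x) (- y)) = hartley (cut (- b) (- a) -%R).
  apply/funext => y; rewrite -hartley_opp//; congr (hartley _ _).
  apply/funext => x; rewrite /h /cut lerNr lerNl andbC.
  by case: ifP; rewrite ?mulr1 ?mulr0.
rewrite e1 -(l2_hartley_pairing hphi cN ba').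
rewrite /ip -(proj2 (int_opp _)); last first.
  exact: (L2M Lphi (L2_cut_continuous _ _ cN)).
rewrite -mulN1r -intZ; last first.
  exact: (L2M (L2_opp Lphi) (L2_opp (L2_cut_continuous _ _ cN))).
rewrite -intB//; last first.
  exact: (L1Z _ (L2M (L2_opp Lphi) (L2_opp (L2_cut_continuous _ _ cN)))).
rewrite (@eq_int _ _ (fun=> 0)); first by rewrite Rintegral_cst// mul0r.
move=> x; rewrite /cut !lerN2 andbC; case: ifP => _; ring.
Qed.

End hartley_calculus.

(** * Functions in all the Sobolev spaces *)

Section sobolev.
Context {R : realType}.
Local Notation mu := (@lebesgue_measure R).
Implicit Types (f g h u v w phi psi : R -> R) (a b c t x y : R).

Lemma sobolev_is_derive u x : sobolev_oo u -> is_derive x 1 u (derive1 u x).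
Proof.
move=> [du _]; apply: DeriveDef; first exact: (du 0%N).
by rewrite derive1E.
Qed.

Lemma derive1n_derive1 k u : derive1n k (derive1 u) = derive1n k.+1 u.
Proof. by elim: k => [//|k IH]; rewrite !derive1nS IH. Qed.

Lemma sobolev_derive1 u : sobolev_oo u -> sobolev_oo (derive1 u).
Proof.
move=> [du Lu]; split=> k.
  by rewrite derive1n_derive1; exact: du.
by rewrite derive1n_derive1; exact: Lu.
Qed.

Lemma sobolev_continuous u : sobolev_oo u -> continuous u.
Proof. by move=> Su; apply: drv_continuous => x; exact: sobolev_is_derive. Qed.

Lemma sobolev_L2 u : sobolev_oo u -> L2 u.
Proof. by move=> [_ /(_ 0%N)] /L2P. Qed.

Lemma is_derive_derive1 f g : (forall x, is_derive x 1 f (g x)) -> derive1 f = g.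
Proof. by move=> fg; apply/funext => x; rewrite derive1E; have [_] := fg x. Qed.

(** A coinduction principle that avoids formulas for iterated derivatives: [P]
    need only describe the shape of the functions, such as a sum of products. *)
Lemma sobolev_coind (P : (R -> R) -> Prop) :
  (forall g, P g -> L2 g /\ exists2 g', P g' & forall x, is_derive x 1 g (g' x)) ->
  forall g, P g -> sobolev_oo g.
Proof.
move=> HP g Pg.
have Pk k : P (derive1n k g).
  elim: k => [//|k IH]; rewrite derive1nS.
  by have [_ [g' Pg' dg]] := HP _ IH; rewrite (is_derive_derive1 dg).
split=> k; have [Lk [g' _ dg]] := HP _ (Pk k).
  by move=> x; have [] := dg x.
exact/L2P.
Qed.

Lemma sobolevD u v : sobolev_oo u -> sobolev_oo v -> sobolev_oo (fun x => u x + v x).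
Proof.
move=> Su Sv.
apply: (@sobolev_coind (fun g => exists u v, [/\ sobolev_oo u, sobolev_oo v &
  g = fun x => u x + v x])); last by exists u, v.
move=> _ [f [g [Sf Sg ->]]]; split; first by apply: L2D; exact: sobolev_L2.
exists (fun x => derive1 f x + derive1 g x).
  by exists (derive1 f), (derive1 g); split=> //; exact: sobolev_derive1.
by move=> x; apply: drvD; exact: sobolev_is_derive.
Qed.

Lemma sobolevZ c u : sobolev_oo u -> sobolev_oo (fun x => c * u x).
Proof.
move=> Su.
apply: (@sobolev_coind (fun g => exists2 u, sobolev_oo u & g = fun x => c * u x));
  last by exists u.
move=> _ [f Sf ->]; split; first by apply: L2Z; exact: sobolev_L2.
exists (fun x => c * derive1 f x).
  by exists (derive1 f) => //; exact: sobolev_derive1.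
by move=> x; apply: drvZ; exact: sobolev_is_derive.
Qed.

Lemma sobolev_decay u : sobolev_oo u -> u x @[x --> +oo] --> 0 /\ u x @[x --> -oo] --> 0.
Proof.
move=> Su; have Su' := sobolev_derive1 Su.
apply: (@L2_derive_decay R u (derive1 u)).
- by move=> x; exact: sobolev_is_derive.
- exact: sobolev_continuous.
- exact: sobolev_L2.
- exact: sobolev_L2.
Qed.

Lemma sobolev_bounded u : sobolev_oo u -> exists M, forall x, `|u x| <= M.
Proof.
move=> Su; have Su' := sobolev_derive1 Su.
have [[_ Lu] [_ Lu']] := (sobolev_L2 Su, sobolev_L2 Su').
have Lk := L1D Lu Lu'.
set K := fun x => _ in Lk.
exists (1 + 2 * \int[mu]_x K x) => x.
have : u x ^+ 2 <= 2 * \int[mu]_x K x.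
  apply: le_trans (sqr_le_window x (fun x => sobolev_is_derive x Su) (sobolev_continuous Su')) _.
  rewrite ler_wpM2l//; apply: int_le => //; first exact: L1_cut.
  by move=> t; rewrite /cut; case: ifP => // _; rewrite addr_ge0// sqr_ge0.
rewrite -(real_normK (num_real (u x))).
have := normr_ge0 (u x); have := sqr_ge0 (`|u x| - 1); nra.
Qed.

Lemma sobolevM u v : sobolev_oo u -> sobolev_oo v -> sobolev_oo (fun x => u x * v x).
Proof.
move=> Su Sv.
(* finite sums of products are stable under derivation *)
pose P g := exists s : seq ((R -> R) * (R -> R)),
  (forall p, List.In p s -> sobolev_oo p.1 /\ sobolev_oo p.2) /\
  g = fun x => \sum_(p <- s) p.1 x * p.2 x.
apply: (@sobolev_coind P); last first.
  exists [:: (u, v)]; split; first by move=> p [<-|[]].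
  by apply/funext => x; rewrite big_seq1.
move=> _ [s [Ss ->]]; elim: s Ss => [|[f g] s IH] Ss.
  split.
    under eq_fun do rewrite big_nil; split; first exact: mfun_cst.
    under eq_fun do rewrite expr0n; exact: integrable0.
  exists (fun=> 0); first by exists [::]; split=> //; apply/funext => x; rewrite big_nil.
  by move=> x; under eq_fun do rewrite big_nil; exact: drv_cst.
have [Sf Sg] := Ss (f, g) (or_introl erefl).
have [|Ls [g' [s' [Ss' ->]] ds]] := IH; first by move=> p ps; apply: Ss; right.
split.
  under eq_fun do rewrite big_cons/=.
  have [M gM] := sobolev_bounded Sg.
  apply: L2D => //; apply: (L2M_bounded (sobolev_L2 Sf) (mfun_continuous (sobolev_continuous Sg)) gM).
exists (fun x => (derive1 f x * g x + f x * derive1 g x) + \sum_(p <- s') p.1 x * p.2 x).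
  exists [:: (derive1 f, g), (f, derive1 g) & s']; split.
    move=> p [<-|[<-|/Ss'//]] /=; split=> //; exact: sobolev_derive1.
  by apply/funext => x; rewrite !big_cons/= addrA.
move=> x; under eq_fun do rewrite big_cons/=.
by apply: drvD => //; apply: drvM; exact: sobolev_is_derive.
Qed.

Lemma sobolevX n u : sobolev_oo u -> sobolev_oo (fun x => u x ^+ n.+1).
Proof.
move=> Su; elim: n => [|n IH]; first by under eq_fun do rewrite expr1.
by under eq_fun do rewrite exprS; exact: sobolevM.
Qed.

End sobolev.

(** * The Fourier transform in terms of the Hartley transform *)

Section fourier_hartley.
Context {R : realType}.
Local Notation mu := (@lebesgue_measure R).
Implicit Types (f g h u v w phi psi : R -> R) (a b c t x y : R).

Lemma hartley_trunc_cos_sin f a y : continuous f ->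
  \int[mu]_(x in `[- a, a]) (f x * cos (x * y)) =
    (hartley_trunc f a y + hartley_trunc f a (- y)) / 2 /\
  \int[mu]_(x in `[- a, a]) (f x * sin (x * y)) =
    (hartley_trunc f a y - hartley_trunc f a (- y)) / 2.
Proof.
move=> cf; rewrite -!int_cut.
have cc : continuous (fun x => f x * cos (x * y)).
  by apply: contM => //; apply: (cont_comp (@continuous_cos R)); exact: cont_mulr.
have cs : continuous (fun x => f x * sin (x * y)).
  by apply: contM => //; apply: (cont_comp (@continuous_sin R)); exact: cont_mulr.
have Lc := L1_cut_continuous (- a) a cc; have Ls := L1_cut_continuous (- a) a cs.
have -> : hartley_trunc f a y = \int[mu]_x cut (- a) a (fun x => f x * cos (x * y)) x +
    \int[mu]_x cut (- a) a (fun x => f x * sin (x * y)) x.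
  rewrite -intD//; apply: eq_int => x; rewrite /cut; case: ifP => _; rewrite ?mul0r ?addr0//.
  by rewrite /cas mulrDr.
have -> : hartley_trunc f a (- y) = \int[mu]_x cut (- a) a (fun x => f x * cos (x * y)) x -
    \int[mu]_x cut (- a) a (fun x => f x * sin (x * y)) x.
  rewrite -intB//; apply: eq_int => x; rewrite /cut; case: ifP => _; rewrite ?mul0r ?subr0//.
  by rewrite /cas mulrN cosN sinN mulrBr.
by split; field.
Qed.

Lemma sqnormc_fourier_trunc f a y (F : R -> R[i]) : continuous f ->
  sqnormc (fourier_trunc f a y - F y) =
    ((hartley_trunc f a y - (complex.Re (F y) - complex.Im (F y))) ^+ 2 +
     (hartley_trunc f a (- y) - (complex.Re (F y) + complex.Im (F y))) ^+ 2) / 2.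
Proof.
move=> cf; have [ec es] := hartley_trunc_cos_sin a y cf.
rewrite /fourier_trunc ec es /sqnormc.
by case: (F y) => re im /=; field.
Qed.

Lemma hartley_trunc_reflect f a y : L2 f ->
  hartley_trunc (fun x => f (- x)) a y = hartley_trunc f a (- y).
Proof.
move=> Lf; rewrite /hartley_trunc -hartley_opp; last exact: L1_cut_L2.
congr (hartley _ _); apply/funext => x.
by rewrite /cut (lerN2 a x) (lerNl x a) andbC.
Qed.

Lemma l2_hartley_reflect f phi : l2_hartley f phi ->
  l2_hartley (fun x => f (- x)) (fun y => phi (- y)).
Proof.
move=> [cf Lf Lphi cphi].
split; [exact: (cont_comp cf (contN (cont_id (R := R))))|exact: L2_opp|exact: L2_opp|].
rewrite (_ : (fun n => _) = (fun n => ip (fun y => hartley_trunc f n%:R y - phi y)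
       (fun y => hartley_trunc f n%:R y - phi y)))//.
apply/funext => n.
have Ld := L2B (L2_hartley_trunc cf (ler0n R n)) Lphi.
rewrite -(ip_opp Ld Ld).
have e y : hartley_trunc (fun x => f (- x)) n%:R y - phi (- y) =
    hartley_trunc f n%:R (- y) - phi (- y).
  by rewrite hartley_trunc_reflect.
exact: eq_ip.
Qed.

(** By [sqnormc_fourier_trunc] the squared distance of the truncated Fourier
    integrals to [F] is half the sum of two such distances for Hartley
    transforms, so that it tends to 0 only if both of them do. *)
Lemma is_fourier_l2_hartley f (F : R -> R[i]) : continuous f -> is_fourier f F ->
  l2_hartley f (fun y => complex.Re (F y) - complex.Im (F y)) /\
  l2_hartley (fun x => f (- x)) (fun y => complex.Re (F y) + complex.Im (F y)).
Proof.
move=> cf [/L2P Lf /L2P LRe /L2P LIm cF].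
have LT n := L2_hartley_trunc cf (ler0n R n).
have LB := L2B LRe LIm; have LD := L2D LRe LIm.
have LTo n : L2 (fun y => hartley_trunc f n%:R (- y)) by exact: L2_opp.
have Lo := L2_opp Lf.
have key n : (\int[mu]_y (sqnormc (fourier_trunc f n%:R y - F y))%:E =
   (2^-1 * (ip (fun y => hartley_trunc f n%:R y - (complex.Re (F y) - complex.Im (F y)))
      (fun y => hartley_trunc f n%:R y - (complex.Re (F y) - complex.Im (F y))) +
    ip (fun y => hartley_trunc f n%:R (- y) - (complex.Re (F y) + complex.Im (F y)))
      (fun y => hartley_trunc f n%:R (- y) - (complex.Re (F y) + complex.Im (F y)))))%:E)%E.
  have L1' := L2M (L2B (LT n) LB) (L2B (LT n) LB).
  have L2' := L2M (L2B (LTo n) LD) (L2B (LTo n) LD).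
  rewrite /ip -intD// -intZ; last exact: L1D.
  rewrite EFin_int; last by apply: L1Z; exact: L1D.
  apply: eq_integral => y _; rewrite sqnormc_fourier_trunc//; by congr (_%:E); field.
have cFn := cvg_comp (fun n : nat => n%:R : R) _ cvgr_idn cF.
have {}cFn : (2^-1 * (ip (fun y => hartley_trunc f n%:R y - (complex.Re (F y) - complex.Im (F y)))
      (fun y => hartley_trunc f n%:R y - (complex.Re (F y) - complex.Im (F y))) +
    ip (fun y => hartley_trunc f n%:R (- y) - (complex.Re (F y) + complex.Im (F y)))
      (fun y => hartley_trunc f n%:R (- y) - (complex.Re (F y) + complex.Im (F y))))) @[n --> \oo] --> (0 : R).
  apply: (fine_cvg (f := fun n => _%:E)).
  move: cFn; rewrite /comp; under eq_fun do rewrite key.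
  exact.
pose S1 n := ip (fun y => hartley_trunc f n%:R y - (complex.Re (F y) - complex.Im (F y)))
      (fun y => hartley_trunc f n%:R y - (complex.Re (F y) - complex.Im (F y))).
pose S2 n := ip (fun y => hartley_trunc f n%:R (- y) - (complex.Re (F y) + complex.Im (F y)))
      (fun y => hartley_trunc f n%:R (- y) - (complex.Re (F y) + complex.Im (F y))).
have cS : S1 n + S2 n @[n --> \oo] --> (0 : R).
  rewrite (_ : (fun n => _) = fun n => 2 * (2^-1 * (S1 n + S2 n))).
    by rewrite -(mulr0 2); apply: cvgMr.
  by apply/funext => n; rewrite mulVKf.
split; split=> //.
- apply: (squeeze_cvgr _ (cvg_cst 0) cS); apply: nearW => n.
  by rewrite ip_ge0/= lerDl ip_ge0.
- exact: (cont_comp cf (contN (cont_id (R := R)))).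
- apply: (squeeze_cvgr _ (cvg_cst 0) cS); apply: nearW => n.
  have e y : hartley_trunc (fun x => f (- x)) n%:R y - (complex.Re (F y) + complex.Im (F y)) =
    hartley_trunc f n%:R (- y) - (complex.Re (F y) + complex.Im (F y)).
    by rewrite hartley_trunc_reflect.
  by rewrite ip_ge0/= (eq_ip e e) lerDr ip_ge0.
Qed.

(** The convergence for the natural numbers extends to real truncation points
    by [dist_hartley_trunc]. *)
Lemma l2_hartley_is_fourier f phi : l2_hartley f phi ->
  is_fourier f (fun y => (phi y + phi (- y)) / 2 +i* ((phi (- y) - phi y) / 2)).
Proof.
move=> hf; have [cf Lf Lphi cphi] := hf; have Lo := L2_opp Lphi.
split; [exact/L2P|..].
- rewrite (_ : (fun y => _) = fun y => 2^-1 * (phi y + phi (- y))).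
    by apply/L2P/L2Z/L2D.
  by apply/funext => y /=; rewrite mulrC.
- rewrite (_ : (fun y => _) = fun y => 2^-1 * (phi (- y) - phi y)).
    by apply/L2P/L2Z/L2B.
  by apply/funext => y /=; rewrite mulrC.
have LT A : 0 <= A -> L2 (hartley_trunc f A) := L2_hartley_trunc cf.
have E A : 0 <= A -> (\int[mu]_y (sqnormc (fourier_trunc f A y -
      ((phi y + phi (- y)) / 2 +i* ((phi (- y) - phi y) / 2))))%:E =
   (ip (fun y => hartley_trunc f A y - phi y) (fun y => hartley_trunc f A y - phi y))%:E)%E.
  move=> A0; have Ld := L2B (LT _ A0) Lphi; have L1' := L2M Ld Ld.
  have L2' := L2M (L2_opp Ld) (L2_opp Ld).
  have -> : ip (fun y => hartley_trunc f A y - phi y) (fun y => hartley_trunc f A y - phi y) =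
    2^-1 * (ip (fun y => hartley_trunc f A y - phi y) (fun y => hartley_trunc f A y - phi y) +
      ip (fun y => hartley_trunc f A (- y) - phi (- y)) (fun y => hartley_trunc f A (- y) - phi (- y))).
    by rewrite (ip_opp Ld Ld); field.
  rewrite /ip -intD// -intZ; last exact: L1D.
  rewrite EFin_int; last by apply: L1Z; exact: L1D.
  apply: eq_integral => y _.
  rewrite (@sqnormc_fourier_trunc f A y (fun y => (phi y + phi (- y)) / 2 +i* ((phi (- y) - phi y) / 2)))//=.
  by congr (_%:E); field.
suff : ip (fun y => hartley_trunc f A y - phi y) (fun y => hartley_trunc f A y - phi y)
    @[A --> +oo] --> 0.
  move=> c0.
  have c1 : (ip (fun y => hartley_trunc f A y - phi y) (fun y => hartley_trunc f A y - phi y))%:E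
      @[A --> +oo] --> (0 : R)%:E.
    by apply: cvg_EFin; [exact: nearW|exact: c0].
  apply: cvg_trans c1; apply: near_eq_cvg; near=> A.
  have A0 : 0 <= A by near: A; apply: nbhs_pinfty_ge; rewrite num_real.
  by rewrite E.
apply/cvgrPdist_lt => e e0; have p0 : 0 < 2 * pi :> R by rewrite mulr_gt0// pi_gt0.
have e4 : 0 < e / 4 by rewrite divr_gt0.
have [n [tn cn]] : exists n, tail f n%:R < e / 4 / (2 * pi) /\
    ip (fun y => hartley_trunc f n%:R y - phi y) (fun y => hartley_trunc f n%:R y - phi y) < e / 4.
  have /cvgrPdist_lt/(_ _ (divr_gt0 e4 p0)) t0 := tail_cvg0 Lf.
  move/cvgrPdist_lt : (cphi) => /(_ _ e4) c0.
  near \oo => n; exists n; split.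
  - near: n; apply: filterS t0 => n; rewrite sub0r normrN; exact/le_lt_trans/ler_norm.
  - near: n; apply: filterS c0 => n; rewrite sub0r normrN; exact/le_lt_trans/ler_norm.
exists n%:R; split=> // A nA; have A0 : 0 <= A by apply: le_trans (ltW nA).
rewrite sub0r normrN ger0_norm ?ip_ge0//.
have e1 y : hartley_trunc f A y - phi y =
   (hartley_trunc f A y - hartley_trunc f n%:R y) + (hartley_trunc f n%:R y - phi y) by ring.
rewrite (eq_ip e1 e1).
have LA := LT A A0; have Ln := LT n%:R (ler0n R n).
apply: le_lt_trans (ip_sqrD_le (L2B LA Ln) (L2B Ln Lphi)) _.
rewrite (dist_hartley_trunc cf (ler0n R n) (ltW nA)).
have := tail_ge0 A Lf; move: tn; rewrite ltr_pdivlMr// => tn tA.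
have : 2 * pi * (tail f n%:R - tail f A) <= 2 * pi * tail f n%:R.
  by rewrite ler_wpM2l ?(ltW p0)// gerBl.
lra.
Unshelve. all: by end_near. Qed.

End fourier_hartley.

(** * The Hilbert transform of the derivative *)

Section hilbert_derivative.
Context {R : realType}.
Local Notation mu := (@lebesgue_measure R).
Implicit Types (f g h u v w phi psi : R -> R) (a b c t x y : R).

(** Multiplication by [y] of the transform corresponds, up to sign and reflection,
    to derivation of the function. *)
Lemma L2_moments k u phi : sobolev_oo u -> l2_hartley u phi ->
  L2 (fun y => y ^+ k * phi y).
Proof.
elim: k u phi => [|k IH] u phi Su hu.
  by under eq_fun do rewrite expr0 mul1r; case: hu.
have Su' := sobolev_derive1 Su.
have hu' := l2_hartley_derive (fun x => sobolev_is_derive x Su)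
  (sobolev_continuous Su') (sobolev_L2 Su') hu.
have := L2Z ((-1) ^+ k) (L2_opp (IH _ _ Su' hu')).
congr L2; apply/funext => y; rewrite !opprK mulrA -exprMn.
by rewrite mulN1r opprK exprS; ring.
Qed.

(** This is half of the Poisson kernel for [e = 1]. *)
Lemma L1_bracket : L1 (fun y : R => (1 + y ^+ 2)^-1).
Proof.
have c1 := continuous_poisson (R := R) (e := 1) (x := 0) ltr01.
have [] // := @int_mct R (fun n => cut (- n%:R) n%:R (fun y => poisson 1 (0 - y)))
  (fun y => poisson 1 (0 - y)) (2 * pi).
- by move=> n; exact: L1_cut_continuous.
- exact: mfun_continuous.
- by move=> n x; rewrite /cut; case: ifP => // _; exact: poisson_ge0.
- move=> x m n mn; have mnR : m%:R <= n%:R :> R by rewrite ler_nat.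
  rewrite /cut; case: ifP => [/andP[mx xm]|_].
    by rewrite ifT//; apply/andP; split; lra.
  by case: ifP => // _; exact: poisson_ge0.
- by move=> x; exact: cut_cvg.
- by move=> n; exact: int_cut_poisson_le.
move=> L _; have := L1Z 2^-1 L; congr L1; apply/funext => y.
by rewrite /poisson sub0r sqrrN expr1n mulr1 mulKf.
Qed.

(** [phi] is the product of [(1 + y^2)^-1] and [phi + y^2 phi], both square
    integrable. *)
Lemma L1_of_moments phi : L2 phi -> L2 (fun y => y ^+ 2 * phi y) -> L1 phi.
Proof.
move=> L0 L2'.
have Lb : L2 (fun y : R => (1 + y ^+ 2)^-1).
  have L := L1_bracket; split; first exact: L1_mfun.
  apply: (L1_le L); first by apply: mfunX; exact: L1_mfun.
  move=> x; have x0 : 1 <= 1 + x ^+ 2 by rewrite lerDl sqr_ge0.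
  have i0 : 0 <= (1 + x ^+ 2)^-1 by rewrite invr_ge0; lra.
  by rewrite ger0_norm ?sqr_ge0// expr2 ler_piMr// invf_le1//; lra.
have := L2M Lb (L2D L0 L2'); congr L1; apply/funext => y.
have y0 : 1 + y ^+ 2 != 0 by rewrite gt_eqF// ltr_pwDl// sqr_ge0.
by field.
Qed.

(** On smooth functions this is the Fourier multiplier [|xi|]. *)
Definition hdx u : R -> R := hilbert (derive1 u).

Lemma mfun_sg : mfun (@Num.sg R).
Proof.
rewrite (_ : Num.sg = fun x : R => \1_(`]0, +oo[%classic) x - \1_(`]-oo, 0[%classic) x).
  by apply: mfunB; apply: measurable_indic.
apply/funext => x; rewrite !indicE !mem_setE !in_itv/= andbT.
by case: sgrP => x0; rewrite ?ltxx ?subrr// ?x0 ?(lt_gtF x0) ?subr0 ?sub0r.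
Qed.

(** The even and odd parts of the transform are exchanged by [- i], up to a sign;
    in terms of the transform itself this is the reflection. *)
Lemma is_hilbert_l2_hartley f g phi : l2_hartley f phi -> continuous g ->
  is_hilbert f g -> l2_hartley g (fun y => Num.sg y * phi (- y)).
Proof.
move=> hf cg [F fF gF]; have [cf _ Lphi _] := hf.
have [_ h2] := is_fourier_l2_hartley cf fF.
have [h3 _] := is_fourier_l2_hartley cg gF.
have ae2 := l2_hartley_uniq h2 (l2_hartley_reflect hf).
apply: (l2_hartley_ae h3).
  by apply: mfunM; [exact: mfun_sg|exact: (L2_opp Lphi).1].
apply: aeS ae2 _ => y <-.
by case: (F y) => re im /=; ring.
Qed.

Lemma is_hilbert_inverse f phi : l2_hartley f phi ->
  L1 (fun y => Num.sg y * phi (- y)) -> L2 (fun y => Num.sg y * phi (- y)) ->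
  is_hilbert f (fun x => (2 * pi)^-1 * hartley (fun y => Num.sg y * phi (- y)) x).
Proof.
move=> hf Lp1 Lp2; have hg := l2_hartley_inverse Lp1 Lp2.
exists (fun y => (phi y + phi (- y)) / 2 +i* ((phi (- y) - phi y) / 2)).
  exact: l2_hartley_is_fourier.
have := l2_hartley_is_fourier hg; congr is_fourier.
apply/funext => y; apply/eqP; rewrite eq_complex /= opprK sgrN.
apply/andP; split; apply/eqP; first by field.
by field.
Qed.

(** [is_hilbert_inverse] shows that a continuous representative exists, and
    [l2_hartley_inj] that it is the only one. *)
Lemma hilbert_l2_hartley f phi : l2_hartley f phi ->
  L1 (fun y => Num.sg y * phi (- y)) -> L2 (fun y => Num.sg y * phi (- y)) ->
  hilbert f = (fun x => (2 * pi)^-1 * hartley (fun y => Num.sg y * phi (- y)) x).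
Proof.
move=> hf Lp1 Lp2; have hg := l2_hartley_inverse Lp1 Lp2.
have [cg _ _ _] := hg.
have hH : [set g | continuous g /\ is_hilbert f g] (hilbert f).
  rewrite /hilbert; case: xgetP => [_ _ []//|].
  move=> /(_ (fun x => (2 * pi)^-1 * hartley (fun y => Num.sg y * phi (- y)) x)).
  by case; split=> //; exact: is_hilbert_inverse.
case: hH => ch hh; have h1 := is_hilbert_l2_hartley hf ch hh.
exact: l2_hartley_inj h1 hg.
Qed.

(** All moments of [phi] are square integrable, by [L2_moments]. *)
Lemma abs_multiplier u phi : sobolev_oo u -> l2_hartley u phi ->
  [/\ L1 (fun y => `|y| * phi y), L2 (fun y => `|y| * phi y) &
      L1 (fun y => y * (`|y| * phi y))].
Proof.
move=> Su hu; have M k := L2_moments k Su hu.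
have [_ _ [mphi _] _] := hu.
have ma : mfun (fun y => `|y| * phi y).
  by apply: mfunM => //; apply: mfun_continuous; exact: cont_norm.
have mid : mfun (fun y : R => y) by apply: mfun_continuous; exact: cont_id.
have La k : L2 (fun y => y ^+ k * (`|y| * phi y)).
  apply: (L2_le (M k.+1)); first by apply: mfunM => //; exact: mfunX.
  by move=> y; rewrite !normrM !normrX normr_id exprS mulrCA mulrA.
have e0 : (fun y => y ^+ 0 * (`|y| * phi y)) = fun y => `|y| * phi y.
  by apply/funext => y; rewrite expr0 mul1r.
have L0 := La 0%N; rewrite e0 in L0.
split=> //; first exact: (L1_of_moments L0 (La 2%N)).
apply: L1_of_moments.
  by have := La 1%N; congr L2; apply/funext => y; rewrite expr1.
by have := La 3%N; congr L2; apply/funext => y; rewrite exprSr -mulrA.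
Qed.

(** The transform of the derivative is [- y * phi (- y)]; the sign in the Hilbert
    transform and a second reflection turn this into [|y| * phi y]. *)
Lemma hdxE u phi : sobolev_oo u -> l2_hartley u phi ->
  hdx u = fun x => (2 * pi)^-1 * hartley (fun y => `|y| * phi y) x.
Proof.
move=> Su hu; have [A1 A2 _] := abs_multiplier Su hu.
have Su' := sobolev_derive1 Su.
have hu' := l2_hartley_derive (fun x => sobolev_is_derive x Su)
  (sobolev_continuous Su') (sobolev_L2 Su') hu.
have e : (fun y => Num.sg y * (- - y * phi (- - y))) = fun y => `|y| * phi y.
  by apply/funext => y; rewrite !opprK mulrA -normrEsg.
rewrite -e in A1 A2 *; rewrite /hdx; exact: (hilbert_l2_hartley hu' A1 A2).
Qed.

Opaque hdx.

Lemma l2_hartley_hdx u phi : sobolev_oo u -> l2_hartley u phi ->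
  l2_hartley (hdx u) (fun y => `|y| * phi y).
Proof.
move=> Su hu; have [A1 A2 _] := abs_multiplier Su hu.
by rewrite (hdxE Su hu); exact: l2_hartley_inverse.
Qed.

Lemma sobolev_l2_hartley u : sobolev_oo u -> exists phi, l2_hartley u phi.
Proof.
by move=> Su; apply: l2_hartley_exists; [exact: sobolev_continuous|exact: sobolev_L2].
Qed.

Lemma hdxD u v : sobolev_oo u -> sobolev_oo v ->
  hdx (fun x => u x + v x) = fun x => hdx u x + hdx v x.
Proof.
move=> Su Sv; have [phi hu] := sobolev_l2_hartley Su.
have [psi hv] := sobolev_l2_hartley Sv.
have h1 := l2_hartley_hdx (sobolevD Su Sv) (l2_hartleyD hu hv).
apply: (l2_hartley_inj h1).
have := l2_hartleyD (l2_hartley_hdx Su hu) (l2_hartley_hdx Sv hv).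
by congr l2_hartley; apply/funext => y; rewrite mulrDr.
Qed.

Lemma hdxZ c u : sobolev_oo u -> hdx (fun x => c * u x) = fun x => c * hdx u x.
Proof.
move=> Su; have [phi hu] := sobolev_l2_hartley Su.
have h1 := l2_hartley_hdx (sobolevZ c Su) (l2_hartleyZ c hu).
apply: (l2_hartley_inj h1).
have := l2_hartleyZ c (l2_hartley_hdx Su hu).
by congr l2_hartley; apply/funext => y; rewrite mulrCA.
Qed.

(** By [parseval], because the multiplier is real. *)
Lemma hdx_symmetric u v : sobolev_oo u -> sobolev_oo v -> ip (hdx u) v = ip u (hdx v).
Proof.
move=> Su Sv; have [phi hu] := sobolev_l2_hartley Su.
have [psi hv] := sobolev_l2_hartley Sv.
have p0 : 2 * pi != 0 :> R by rewrite gt_eqF// mulr_gt0// pi_gt0.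
apply: (mulfI p0).
rewrite -(parseval (l2_hartley_hdx Su hu) hv) -(parseval hu (l2_hartley_hdx Sv hv)).
by apply: eq_int => y; ring.
Qed.

(** The multiplier [|xi|] is even, so that it commutes with derivation. *)
Lemma is_derive_hdx u x : sobolev_oo u -> is_derive x 1 (hdx u) (hdx (derive1 u) x).
Proof.
move=> Su; have [phi hu] := sobolev_l2_hartley Su.
have Su' := sobolev_derive1 Su.
have hu' := l2_hartley_derive (fun x => sobolev_is_derive x Su)
  (sobolev_continuous Su') (sobolev_L2 Su') hu.
have [A1 _ A3] := abs_multiplier Su hu.
rewrite (hdxE Su hu) (hdxE Su' hu').
apply: is_derive_eq (drvZ _ (is_derive_hartley x A1 A3)) _.
rewrite -hartley_opp//; congr (_ * hartley _ x).
by apply/funext => y; rewrite normrN; ring.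
Qed.

Lemma sobolev_hdx u : sobolev_oo u -> sobolev_oo (hdx u).
Proof.
move=> Su.
apply: (@sobolev_coind R (fun g => exists2 u, sobolev_oo u & g = hdx u)); last by exists u.
move=> _ [v Sv ->]; split.
  have [phi hv] := sobolev_l2_hartley Sv.
  by case: (l2_hartley_hdx Sv hv).
exists (hdx (derive1 v)); first by exists (derive1 v) => //; exact: sobolev_derive1.
by move=> x; exact: is_derive_hdx.
Qed.

Lemma sobolev_ibp u v : sobolev_oo u -> sobolev_oo v ->
  ip (derive1 u) v = - ip u (derive1 v).
Proof.
move=> Su Sv; have Su' := sobolev_derive1 Su; have Sv' := sobolev_derive1 Sv.
apply: integration_by_parts_L2; try exact: sobolev_continuous; try exact: sobolev_L2.
  by move=> x; exact: sobolev_is_derive.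
by move=> x; exact: sobolev_is_derive.
Qed.

(** The composite of commuting operators of which one is symmetric and the other,
    the derivation, is skew-symmetric is itself skew-symmetric. *)
Lemma ip_hdx_derive1 u : sobolev_oo u -> ip (hdx u) (derive1 u) = 0.
Proof.
move=> Su; have Su' := sobolev_derive1 Su; have Sh := sobolev_hdx Su.
have e : derive1 (hdx u) = hdx (derive1 u).
  by apply: is_derive_derive1 => x; exact: is_derive_hdx.
have h1 := sobolev_ibp Sh Su; have h2 := hdx_symmetric Su' Su.
rewrite e in h1; have h3 := ipC (derive1 u) (hdx u).
lra.
Qed.

End hilbert_derivative.

(** * Quadratic invariants of symplectic Runge-Kutta methods *)

Section symplectic_quadratic_invariant.
Context (K : comPzRingType) (E : lmodType K).
Variables (D : E -> Prop) (S : K -> Prop) (B : E -> E -> K).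
Hypothesis D0 : D 0.
Hypothesis DD : forall u v, D u -> D v -> D (u + v).
Hypothesis DZ : forall c u, S c -> D u -> D (c *: u).
Hypothesis BC : forall u v, D u -> D v -> B u v = B v u.
Hypothesis BDl : forall u v w, D u -> D v -> D w -> B (u + v) w = B u w + B v w.
Hypothesis BZl : forall c u v, S c -> D u -> D v -> B (c *: u) v = c * B u v.

Let B0l u : D u -> B 0 u = 0.
Proof.
move=> Du; have := BDl D0 D0 Du; rewrite addr0 => /eqP.
by rewrite -subr_eq0 opprD addrA subrr sub0r oppr_eq0 => /eqP.
Qed.

Let D_sum (I : finType) (c : I -> K) (k : I -> E) :
  (forall i, S (c i)) -> (forall i, D (k i)) -> D (\sum_i c i *: k i).
Proof. by move=> Sc Dk; elim/big_ind: _ => // i _; exact: DZ. Qed.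

Let B_suml (I : finType) (c : I -> K) (k : I -> E) v :
  (forall i, S (c i)) -> (forall i, D (k i)) -> D v ->
  B (\sum_i c i *: k i) v = \sum_i c i * B (k i) v.
Proof.
move=> Sc Dk Dv.
suff [] : D (\sum_i c i *: k i) /\ B (\sum_i c i *: k i) v = \sum_i c i * B (k i) v by [].
elim/big_rec2: _ => [|i x y _ [Dy <-]]; first by rewrite B0l.
have Dck := DZ (Sc i) (Dk i).
by split; [exact: DD|rewrite BDl// BZl].
Qed.

(** Write [k i] for [G (Y i)]. Expanding [B y1 y1] gives, besides [B y0 y0], the
    term [2 tau \sum b_i B y0 (k i)] and the double sum of
    [tau^2 b_i b_j B (k i) (k j)]. Since [B (Y i) (k i) = 0], the equation for
    [Y i] turns [B y0 (k i)] into [- tau \sum_j a_ij B (k j) (k i)], and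
    symplecticity makes the two terms cancel. The predicates [D] and [S]
    allow for a form that is bilinear only on a subspace of vectors or only
    over some of the scalars. *)
Lemma rk_step_quadratic_invariant (s : nat) (a : 'M[K]_s) (b : 'rV[K]_s) (tau : K)
    (G : E -> E) (y0 : E) (Y : 'I_s -> E) (y1 : E) :
  symplectic a b -> (forall i j, S (a i j)) -> (forall i, S (b 0 i)) -> S tau ->
  rk_step a b tau G y0 Y y1 ->
  D y0 -> (forall i, D (G (Y i))) -> (forall i, B (Y i) (G (Y i)) = 0) ->
  B y1 y1 = B y0 y0.
Proof.
move=> symp Sa Sb Stau [YE ->] Dy0 DG BG.
pose k i := G (Y i); pose M i j := B (k i) (k j).
have Dk i : D (k i) by exact: DG.
pose inc := \sum_i b 0 i *: k i.
have Dinc : D inc by exact: D_sum.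
have Dti : D (tau *: inc) by exact: DZ.
have y0k i : B y0 (k i) = - (tau * \sum_j a i j * M j i).
  have Das : D (\sum_j a i j *: k j) by exact: D_sum.
  have := BG i; rewrite {1}YE -/(k i) BDl//; last exact: DZ.
  rewrite BZl// B_suml// => /eqP; rewrite addr_eq0 => /eqP ->; congr (- (tau * _)).
have y0inc : B y0 inc = - (tau * \sum_i \sum_j b 0 i * a i j * M j i).
  rewrite BC// B_suml// mulr_sumr -sumrN; apply: eq_bigr => i _.
  rewrite BC// y0k mulrN mulrCA; congr (- (tau * _)).
  by rewrite mulr_sumr; apply: eq_bigr => j _; rewrite mulrA.
have incinc : B inc inc = \sum_i \sum_j b 0 i * b 0 j * M i j.
  rewrite B_suml//; apply: eq_bigr => i _; rewrite BC// B_suml// mulr_sumr.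
  by apply: eq_bigr => j _; rewrite BC// mulrA.
have twice : (\sum_i \sum_j b 0 i * a i j * M j i) + (\sum_i \sum_j b 0 i * a i j * M j i) =
    \sum_i \sum_j b 0 i * b 0 j * M i j.
  rewrite {2}exchange_big -big_split; apply: eq_bigr => i _ /=.
  rewrite -big_split; apply: eq_bigr => j _ /=.
  by rewrite -symp mulrDl; congr (_ * _ + _); exact: BC.
rewrite -/inc BDl//; last exact: DD.
have DDi := DD Dy0 Dti.
rewrite (BC Dy0 DDi) (BC Dti DDi) !BDl// (BC Dti Dy0).
have e1 : B y0 (tau *: inc) = tau * B y0 inc by rewrite BC// BZl// BC.
have e2 : B (tau *: inc) (tau *: inc) = tau * (tau * B inc inc).
  by rewrite BZl// BC// BZl.
by rewrite e1 e2 y0inc incinc -twice; ring.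
Qed.

End symplectic_quadratic_invariant.

(** * Integrals of derivatives of Sobolev functions *)

Section continuous_problem.
Context {R : realType}.
Local Notation mu := (@lebesgue_measure R).
Implicit Types (f g h u v w phi psi : R -> R) (a b c t x y : R).

Lemma sobolevN u : sobolev_oo u -> sobolev_oo (fun x => - u x).
Proof.
move=> Su; have := sobolevZ (-1) Su; congr sobolev_oo.
by apply/funext => x; rewrite mulN1r.
Qed.

(** The integral is [w q - w p], and both values tend to 0. *)
Lemma integral_seg_derive1 w : sobolev_oo w ->
  integral_seg (derive1 w) p @[p --> filter_prod (-oo : set_system R) +oo] --> (0 : R).
Proof.
move=> Sw; have [wy wNy] := sobolev_decay Sw.
have c2 : w p.2 - w p.1 @[p --> filter_prod (-oo : set_system R) +oo] --> (0 : R) - 0.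
  apply: cvgB.
    by apply: (cvg_comp (fun p : R * R => p.2) w) wy; exact: cvg_snd.
  by apply: (cvg_comp (fun p : R * R => p.1) w) wNy; exact: cvg_fst.
rewrite subr0 in c2; apply: cvg_trans c2; apply: near_eq_cvg.
exists ([set x | x < 0], [set x | 0 < x]) => /=.
  by split; exists 0; split.
move=> [p q] [/= p0 q0]; rewrite /integral_seg/= -int_cut.
have pq : p <= q by lra.
rewrite (int_cut_FTC pq _ (fun x => sobolev_is_derive x Sw))//.
exact/sobolev_continuous/sobolev_derive1.
Qed.

Lemma improper_integral_add_derive1 u w : sobolev_oo u -> sobolev_oo w ->
  improper_integrable u ->
  improper_integrable (fun x => u x + derive1 w x) /\
  improper_integral (fun x => u x + derive1 w x) = improper_integral u.
Proof.
move=> Su Sw iu; have Sw' := sobolev_derive1 Sw.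
have cv : integral_seg (fun x => u x + derive1 w x) p
    @[p --> filter_prod (-oo : set_system R) +oo] --> improper_integral u + 0.
  rewrite (_ : integral_seg _ = fun p => integral_seg u p + integral_seg (derive1 w) p).
    by apply: cvgD; [exact: iu|exact: integral_seg_derive1].
  apply/funext => p; rewrite /integral_seg -!int_cut -intD; last 2 first.
  - exact/L1_cut_continuous/sobolev_continuous.
  - exact/L1_cut_continuous/sobolev_continuous.
  by apply: eq_int => x; rewrite /cut; case: ifP; rewrite ?addr0.
rewrite addr0 in cv; split; first exact/cvgP/cv.
exact/cvg_lim/cv.
Qed.

Lemma drvX n u (du x : R) : is_derive x 1 u du ->
  is_derive x 1 (fun x => u x ^+ n.+1) (n.+1%:R * (du * u x ^+ n)).
Proof.
move=> d; elim: n => [|n IH].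
  by under eq_fun do rewrite expr1; rewrite expr0 mulr1 mul1r.
under eq_fun do rewrite exprS.
by apply: is_derive_eq (drvM d IH) _; rewrite (exprS _ n) -(natr1 n.+1); ring.
Qed.

(** The integrand is the derivative of [u^(n+2) / (n+2)]; integration by parts shows
    that the integral is [- n.+1] times itself. *)
Lemma ip_derive1_power n u : sobolev_oo u -> ip (derive1 u) (fun x => u x ^+ n.+1) = 0.
Proof.
move=> Su; have Su' := sobolev_derive1 Su; have SX := sobolevX n Su.
have dX x := drvX n (sobolev_is_derive x Su).
have := sobolev_ibp Su SX; rewrite (is_derive_derive1 dX).
have -> : ip u (fun x => n.+1%:R * (derive1 u x * u x ^+ n)) =
    n.+1%:R * ip (derive1 u) (fun x => u x ^+ n.+1).
  rewrite /ip -intZ; last exact: (L2M (sobolev_L2 Su') (sobolev_L2 SX)).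
  by apply: eq_int => x; rewrite exprS; ring.
have n0 : 0 < n.+1%:R :> R by rewrite ltr0n.
nra.
Qed.

End continuous_problem.

(** * Invariants of the Benjamin-Ono system *)

Section gbo_step.
Context {R : realType}.
Local Notation mu := (@lebesgue_measure R).
Implicit Type y : (R -> R) * R.
Variables (m : nat) (C0 : R).
Hypothesis m_gt0 : (0 < m)%N.

Definition flux (y : (R -> R) * R) : R -> R :=
  fun x => - hdx y.1 x +
    m%:R^-1 * (y.1 x ^+ m * y.2 / Num.sqrt (radicand m C0 y.1)).

Lemma gbo_rhs_flux y : (gbo_rhs m C0 y).1 = fun x => - derive1 (flux y) x.
Proof. by []. Qed.

Lemma fluxE y : flux y = fun x => - hdx y.1 x +
  m%:R^-1 * (y.2 / Num.sqrt (radicand m C0 y.1)) * y.1 x ^+ m.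
Proof. by apply/funext => x; rewrite /flux; ring. Qed.

Lemma sobolev_power (u : R -> R) : sobolev_oo u -> sobolev_oo (fun x => u x ^+ m).
Proof. by case: m m_gt0 => // n _; exact: sobolevX. Qed.

Lemma sobolev_flux y : sobolev_oo y.1 -> sobolev_oo (flux y).
Proof.
move=> Sy; rewrite fluxE; apply: sobolevD.
  exact/sobolevN/sobolev_hdx.
exact/sobolevZ/sobolev_power.
Qed.

Lemma sobolev_gbo_rhs y : sobolev_oo y.1 -> sobolev_oo (gbo_rhs m C0 y).1.
Proof.
by move=> Sy; rewrite gbo_rhs_flux; apply/sobolevN/sobolev_derive1; exact: sobolev_flux.
Qed.

Lemma ipN_derive1_r (u w : R -> R) : sobolev_oo u -> sobolev_oo w ->
  ip u (fun x => - derive1 w x) = ip (derive1 u) w.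
Proof.
move=> Su Sw; have Sw' := sobolev_derive1 Sw.
rewrite (sobolev_ibp Su Sw) -mulN1r -(ipZr (-1) (sobolev_L2 Sw') (sobolev_L2 Su)).
by apply: eq_int => x; rewrite mulN1r.
Qed.

(** After an integration by parts [u_x] is paired with the flux, and it is
    orthogonal to both [H u_x] and [u^m]. *)
Lemma mass_rate y : sobolev_oo y.1 -> ip y.1 (gbo_rhs m C0 y).1 = 0.
Proof.
move=> Sy; have Sf := sobolev_flux Sy; have Sy' := sobolev_derive1 Sy.
have Sh := sobolev_hdx Sy; have SX := sobolev_power Sy.
rewrite gbo_rhs_flux ipN_derive1_r// fluxE.
set c := m%:R^-1 * _.
have e1 : ip (derive1 y.1) (fun x => - hdx y.1 x) = 0.
  transitivity (ip (derive1 y.1) (fun x => -1 * hdx y.1 x)).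
    by apply: eq_int => x; rewrite mulN1r.
  rewrite (ipZr _ (sobolev_L2 Sh) (sobolev_L2 Sy')) ipC ip_hdx_derive1//.
  by rewrite mulr0.
have e2 : ip (derive1 y.1) (fun x => c * y.1 x ^+ m) = 0.
  rewrite (ipZr _ (sobolev_L2 SX) (sobolev_L2 Sy')).
  by case: m m_gt0 => // n _; rewrite ip_derive1_power// mulr0.
rewrite (ipDr (sobolev_L2 (sobolevN Sh)) (sobolev_L2 (sobolevZ c SX)) (sobolev_L2 Sy')).
by rewrite e1 e2 addr0.
Qed.

(** The variable [v] is chosen such that the left-hand side is minus one half of
    the pairing of the flux [g] with [u_t = - g_x], which vanishes. *)
Lemma energy_rate y : sobolev_oo y.1 -> 0 < radicand m C0 y.1 ->
  2^-1 * ip (hdx y.1) (gbo_rhs m C0 y).1 -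
    (m * m.+1)%:R^-1 * (y.2 * (gbo_rhs m C0 y).2) = 0.
Proof.
move=> Sy r0; have Sf := sobolev_flux Sy.
have Sh := sobolev_hdx Sy; have SX := sobolev_power Sy.
have Sk := sobolev_gbo_rhs Sy.
set k := (gbo_rhs m C0 y).1 in Sk *.
have c0 : 0 < Num.sqrt (radicand m C0 y.1) by rewrite sqrtr_gt0.
have -> : (gbo_rhs m C0 y).2 = m.+1%:R / (2 * Num.sqrt (radicand m C0 y.1)) *
  ip (fun x => y.1 x ^+ m) k by [].
have fk : ip (flux y) k = 0.
  have := ipN_derive1_r Sf Sf; rewrite -gbo_rhs_flux -/k => E1.
  have := sobolev_ibp Sf Sf; rewrite -E1 => E2.
  have : ip (flux y) (derive1 (flux y)) = - ip (flux y) k.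
    rewrite -mulN1r -(ipZr (-1) (sobolev_L2 Sk) (sobolev_L2 Sf)).
    by apply: eq_int => x; rewrite /k gbo_rhs_flux mulN1r opprK.
  have := ipC (derive1 (flux y)) (flux y); lra.
have : ip (hdx y.1) k = m%:R^-1 * (y.2 / Num.sqrt (radicand m C0 y.1)) *
    ip (fun x => y.1 x ^+ m) k.
  move: fk; rewrite fluxE; set c := m%:R^-1 * _.
  rewrite (ipDl (sobolev_L2 (sobolevN Sh)) (sobolev_L2 (sobolevZ c SX)) (sobolev_L2 Sk)).
  rewrite (ipZl c (sobolev_L2 SX) (sobolev_L2 Sk)).
  have -> : ip (fun x => - hdx y.1 x) k = - ip (hdx y.1) k.
    rewrite -mulN1r -(ipZl (-1) (sobolev_L2 Sh) (sobolev_L2 Sk)).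
    by apply: eq_int => x; rewrite mulN1r.
  lra.
move=> ->; rewrite natrM; set c := Num.sqrt _ in c0 *; set J := ip _ _.
have m0 : m%:R != 0 :> R by rewrite pnatr_eq0 -lt0n.
have m1 : m.+1%:R != 0 :> R by rewrite pnatr_eq0.
have c1 : c != 0 by rewrite gt_eqF.
move: (m.+1%:R : R) (m%:R : R) J m0 m1 => p q J q0 p0.
by field; rewrite p0 q0 c1.
Qed.

Variables (tau : R) (s : nat) (a : 'M[R]_s) (b : 'rV[R]_s).
Hypothesis symp : symplectic a b.
Variables (y0 y1 : (R -> R) * R) (Y : 'I_s -> (R -> R) * R).
Hypothesis Sy0 : sobolev_oo y0.1.
Hypothesis SY : forall i, sobolev_oo (Y i).1.
Hypothesis Ypos : forall i, 0 < radicand m C0 (Y i).1.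
Hypothesis step : rk_step a b tau (gbo_rhs m C0) y0 Y y1.

Let D (z : (R -> R) * R) := sobolev_oo z.1.

Let D0 : D 0.
Proof.
rewrite /D; have := sobolevZ 0 Sy0; congr sobolev_oo.
by apply/funext => x; rewrite mul0r.
Qed.

Let DD u v : D u -> D v -> D (u + v). Proof. exact: sobolevD. Qed.

Let DZ (c : R) u : True -> D u -> D (c *: u). Proof. by move=> _; exact: sobolevZ. Qed.

Lemma rk_step_mass : mass y1.1 = mass y0.1.
Proof.
apply: (@rk_step_quadratic_invariant R _ D (fun=> True) (fun u v => ip u.1 v.1)
  D0 DD DZ _ _ _ s a b tau (gbo_rhs m C0) y0 Y y1 symp) => //.
- by move=> u v _ _; exact: ipC.
- by move=> u v w Su Sv Sw; apply: ipDl; exact: sobolev_L2.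
- by move=> c u v _ Su Sv; apply: ipZl; exact: sobolev_L2.
- by move=> i; exact: sobolev_gbo_rhs.
- by move=> i; exact: mass_rate.
Qed.

Lemma rk_step_energy : energy m C0 y1 = energy m C0 y0.
Proof.
pose Q (u v : (R -> R) * R) :=
  2^-1 * ip (hdx u.1) v.1 - (m * m.+1)%:R^-1 * (u.2 * v.2).
have EQ y : energy m C0 y = Q y y + (m * m.+1)%:R^-1 * C0.
  rewrite /energy /Q -/(hdx y.1); ring.
rewrite !EQ; congr (_ + _).
apply: (@rk_step_quadratic_invariant R _ D (fun=> True) Q
  D0 DD DZ _ _ _ s a b tau (gbo_rhs m C0) y0 Y y1 symp) => //.
- move=> u v Su Sv; congr (_ * _ - _ * _); last exact: mulrC.
  exact: (etrans (@hdx_symmetric R u.1 v.1 Su Sv) (ipC u.1 (hdx v.1))).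
- move=> u v w Su Sv Sw; rewrite /Q (@hdxD R u.1 v.1 Su Sv).
  rewrite (ipDl (sobolev_L2 (sobolev_hdx Su)) (sobolev_L2 (sobolev_hdx Sv)) (sobolev_L2 Sw)).
  have distr (A1 A2 k p q r : R) : 2^-1 * (A1 + A2) - k * ((p + q) * r) =
    2^-1 * A1 - k * (p * r) + (2^-1 * A2 - k * (q * r)) by ring.
  exact: distr.
- move=> c u v _ Su Sv; rewrite /Q (@hdxZ R c u.1 Su).
  rewrite (ipZl c (sobolev_L2 (sobolev_hdx Su)) (sobolev_L2 Sv)).
  have distr (A k p q : R) : 2^-1 * (c * A) - k * (c * p * q) =
    c * (2^-1 * A - k * (p * q)) by ring.
  exact: distr.
- by move=> i; exact: sobolev_gbo_rhs.
- by move=> i; exact: energy_rate.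
Qed.

(** The right-hand side is a derivative at each intermediate value, and so is
    every linear combination of such values. *)
Lemma rk_step_increment : exists2 w, sobolev_oo w & y1.1 = fun x => y0.1 x + derive1 w x.
Proof.
have [_ ->] := step.
suff [w Sw wE] : exists2 w, sobolev_oo w &
    (\sum_i b 0 i *: gbo_rhs m C0 (Y i)).1 = derive1 w.
  exists (fun x => tau * w x); first exact: sobolevZ.
  rewrite (is_derive_derive1 (fun x => drvZ tau (sobolev_is_derive x Sw))).
  by rewrite -wE.
elim/big_ind: _ => [|u v [f Sf fE] [g Sg gE]|i _].
- exists (0 : (R -> R) * R).1; first exact: D0.
  by apply/esym/is_derive_derive1 => x; exact: drv_cst.
- exists (fun x => f x + g x); first exact: sobolevD.
  rewrite (is_derive_derive1 (fun x => drvD (sobolev_is_derive x Sf) (sobolev_is_derive x Sg))).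
  by rewrite -fE -gE.
- have Sf := sobolev_flux (SY i).
  exists (fun x => - b 0 i * flux (Y i) x); first exact: sobolevZ.
  rewrite (is_derive_derive1 (fun x => drvZ (- b 0 i) (sobolev_is_derive x Sf))).
  by apply/funext => x; rewrite mulNr -mulrN.
Qed.

Lemma rk_step_integral : improper_integrable y0.1 ->
  improper_integrable y1.1 /\ improper_integral y1.1 = improper_integral y0.1.
Proof.
by move=> iy0; have [w Sw ->] := rk_step_increment; exact: improper_integral_add_derive1.
Qed.

End gbo_step.

Theorem gbo_rk_invariants (R : realType) (m : nat) (tau C0 : R) (s : nat)
    (a : 'M[R]_s) (b : 'rV[R]_s) (T : nat) (y : nat -> (R -> R) * R)
    (Y : nat -> 'I_s -> (R -> R) * R) :
  (1 <= m)%N -> symplectic a b ->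
  (forall n, (n <= T)%N -> sobolev_oo (y n).1) ->
  (forall n i, (n < T)%N -> sobolev_oo (Y n i).1) ->
  improper_integrable (y 0%N).1 ->
  (forall n i, (n < T)%N -> 0 < radicand m C0 (Y n i).1) ->
  (forall n, (n < T)%N -> rk_step a b tau (gbo_rhs m C0) (y n) (Y n) (y n.+1)) ->
  forall n, (n < T)%N ->
    [/\ improper_integrable (y n).1,
        improper_integrable (y n.+1).1,
        improper_integral (y n.+1).1 = improper_integral (y n).1,
        mass (y n.+1).1 = mass (y n).1 &
        energy m C0 (y n.+1) = energy m C0 (y n)].
Proof.
move=> m0 symp Sy SY i0 pos step.
have int n : (n < T)%N -> improper_integrable (y n).1 ->
    improper_integrable (y n.+1).1 /\
    improper_integral (y n.+1).1 = improper_integral (y n).1.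
  move=> nT; have Syn := Sy n (ltnW nT).
  exact: (rk_step_integral m0 Syn (SY n ^~ nT) (step n nT)).
have iy n : (n <= T)%N -> improper_integrable (y n).1.
  by elim: n => // n IH nT; have [] := int n nT (IH (ltnW nT)).
move=> n nT; have Syn := Sy n (ltnW nT); have [iy1 iyE] := int n nT (iy n (ltnW nT)).
split=> //; first exact: (iy n (ltnW nT)).
- exact: (rk_step_mass m0 symp Syn (SY n ^~ nT) (step n nT)).
- exact: (rk_step_energy m0 symp Syn (SY n ^~ nT) (pos n ^~ nT) (step n nT)).
Qed.

(** * Adjoints of complex matrices *)

Section adjoint_matrices.
Context {R : realType}.
Implicit Types (m n p : nat) (z c : R[i]).

Definition adjmx m n (A : 'M[R[i]]_(m, n)) : 'M[R[i]]_(n, m) := (map_mx conjc A)^T.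

Lemma conjcM z c : conjc (z * c) = conjc z * conjc c. Proof. exact: rmorphM. Qed.
Lemma conjcB z c : conjc (z - c) = conjc z - conjc c. Proof. exact: rmorphB. Qed.
Lemma conjcD z c : conjc (z + c) = conjc z + conjc c. Proof. exact: rmorphD. Qed.
Lemma conjcN z : conjc (- z) = - conjc z. Proof. exact: rmorphN. Qed.
Lemma conjcV z : conjc z^-1 = (conjc z)^-1. Proof. exact: fmorphV. Qed.
Lemma conjc_real z : z \is Num.real -> conjc z = z. Proof. exact: conj_Creal. Qed.

Lemma adjmxE m n (A : 'M[R[i]]_(m, n)) i j : adjmx A i j = conjc (A j i).
Proof. by rewrite !mxE. Qed.

Lemma adjmxK m n : cancel (@adjmx m n) (@adjmx n m).
Proof. by move=> A; apply/matrixP => i j; rewrite !adjmxE conjcK. Qed.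

Lemma adjmxM m n p (A : 'M[R[i]]_(m, n)) (B : 'M[R[i]]_(n, p)) :
  adjmx (A *m B) = adjmx B *m adjmx A.
Proof. by rewrite /adjmx map_mxM trmx_mul. Qed.

Lemma adjmxZ m n c (A : 'M[R[i]]_(m, n)) : adjmx (c *: A) = conjc c *: adjmx A.
Proof. by rewrite /adjmx map_mxZ linearZ. Qed.

End adjoint_matrices.

(** * The discrete operators and the discrete inner product *)

Section discrete_operators.
Context {R : realType}.
Variables (alpha : R) (N : nat).
Hypothesis alpha_gt0 : 0 < alpha.
Hypothesis N_gt0 : (0 < N)%N.

Local Notation F := (dftmx R N).
Local Notation P := (Pmx alpha N).
Local Notation W := (Wmx alpha N).
Implicit Types (A : 'M[R[i]]_N) (u v w : 'cV[R[i]]_N) (c : R[i]).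

Lemma conjc_cis (t : R) : conjc (cis t) = cis (- t).
Proof. by rewrite /cis cosN sinN. Qed.

Lemma idftmx_adj : idftmx R N = N%:R *: adjmx F.
Proof.
apply/matrixP => j k; rewrite [RHS]mxE adjmxE !mxE conjcM conjcV.
by rewrite conjc_real ?realn// conjc_cis opprK mulrA mulfV ?mul1r// pnatr_eq0 -lt0n.
Qed.

(** The entry at infinity is 0 on both sides, so that the convention for the
    inverse of [P] does no harm. *)
Lemma Wmx_mul_Pinvmx : W *m Pinvmx alpha N = adjmx P.
Proof.
rewrite /Wmx /Pmx /Pinvmx map_diag_mx !mulmx_diag /adjmx map_diag_mx tr_diag_mx.
congr diag_mx; apply/rowP => j; rewrite !mxE; case: ifP => _.
  by rewrite mulr0 rmorph0.
by rewrite mulrAC mulfV ?mul1r// eq_complex/= negb_and gt_eqF.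
Qed.

Lemma adjmx_Wmx : adjmx W = W.
Proof.
rewrite /Wmx /Pmx /adjmx !map_diag_mx mulmx_diag map_diag_mx tr_diag_mx.
by congr diag_mx; apply/rowP => j; rewrite !mxE /= conjcM conjcK mulrC.
Qed.

Let tri (k l : int) : int :=
  if l == k - 1 then k else if l == k then 2 * k + 1 else if l == k + 1 then k + 1 else 0.

Let tri_sym k l : tri k l = tri l k.
Proof. by rewrite /tri; repeat case: eqP => ?; lia. Qed.

Let sgh (k : int) : R := Num.sg (k%:~R + 2^-1).

Let sgh_ge0 (k : int) : 0 <= k -> sgh k = 1.
Proof.
move=> k0; apply: gtr0_sg; have : 0 <= k%:~R :> R by rewrite ler0z.
lra.
Qed.

Let sgh_lt0 (k : int) : k < 0 -> sgh k = -1.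
Proof.
move=> k0; apply: ltr0_sg; have : k%:~R <= (-1)%:~R :> R by rewrite ler_int; lia.
by rewrite mulrNz; lra.
Qed.

(** The entry that couples [k - 1] and [k] is [k], and the signs of [k - 1/2] and
    [k + 1/2] differ only for [k = 0]. *)
Let sgh_tri_sym k l : sgh k * (tri k l)%:~R = sgh l * (tri l k)%:~R.
Proof.
rewrite [tri l k]tri_sym; have [->|t0] := eqVneq (tri k l) 0; first by rewrite !mulr0.
congr (_ * _); have [k0|k0] := leP 0 k; have [l0|l0] := leP 0 l.
- by rewrite !sgh_ge0.
- suff t1 : tri k l = 0 by rewrite t1 eqxx in t0.
  by rewrite /tri; repeat case: eqP => ?; lia.
- suff t1 : tri k l = 0 by rewrite t1 eqxx in t0.
  by rewrite /tri; repeat case: eqP => ?; lia.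
- by rewrite !sgh_lt0.
Qed.

Let S1mxE k l : S1mx alpha N k l = 'i%C / (2 * alpha%:C) * (tri (jdx k) (jdx l))%:~R.
Proof. by rewrite mxE /tri; do !case: ifP => _ //; rewrite mulr0z. Qed.

Let conjc_i : conjc 'i%C = - 'i%C :> R[i].
Proof. by apply/eqP; rewrite eq_complex /= oppr0 !eqxx. Qed.

Let conj_i2a : conjc ('i%C / (2 * alpha%:C)) = - ('i%C / (2 * alpha%:C)) :> R[i].
Proof.
rewrite conjcM conjcV (@conjc_real _ (2 * _)) ?conjc_i ?mulNr//.
by rewrite realM ?realn// complex_real.
Qed.

Lemma adjmx_S1mx : adjmx (S1mx alpha N) = - S1mx alpha N.
Proof.
apply/matrixP => k l; rewrite adjmxE [RHS]mxE !S1mxE conjcM conj_i2a tri_sym.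
by rewrite conjc_real ?realz// mulNr.
Qed.

Lemma adjmx_Hmx_mul_S1mx : adjmx (Hmx R N *m S1mx alpha N) = Hmx R N *m S1mx alpha N.
Proof.
have HSE k l : (Hmx R N *m S1mx alpha N) k l =
    (- 'i%C * ('i%C / (2 * alpha%:C))) * (sgh (jdx k) * (tri (jdx k) (jdx l))%:~R)%:C.
  rewrite /Hmx -scalemxAl mxE mul_diag_mx mxE S1mxE mxE -/(sgh _).
  by rewrite (rmorphM (real_complex R)) (rmorph_int (real_complex R)); ring.
apply/matrixP => k l; rewrite adjmxE !HSE conjcM (@conjc_real _ _%:C) ?complex_real//.
rewrite sgh_tri_sym; congr (_ * _).
by rewrite conjcM conj_i2a -[- 'i%C in LHS]conjc_i conjcK mulrN mulNr.
Qed.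

(** The weight turns the inverses of [P] and of the Fourier matrix into adjoints;
    likewise for [Wmx_mul_HDxmx]. Hence these products inherit the symmetry
    of the middle factor. *)
Lemma Wmx_mul_Dxmx : W *m Dxmx alpha N = N%:R *: (adjmx (F *m P) *m S1mx alpha N *m (F *m P)).
Proof.
rewrite /Dxmx !mulmxA Wmx_mul_Pinvmx idftmx_adj adjmxM.
by rewrite -(scalemxAr _ (adjmx P) (adjmx F)) -!scalemxAl.
Qed.

Lemma Wmx_mul_HDxmx :
  W *m HDxmx alpha N = N%:R *: (adjmx (F *m P) *m (Hmx R N *m S1mx alpha N) *m (F *m P)).
Proof.
rewrite /HDxmx !mulmxA Wmx_mul_Pinvmx idftmx_adj adjmxM.
by rewrite -(scalemxAr _ (adjmx P) (adjmx F)) -!scalemxAl.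
Qed.

Lemma iphDl u v w : iph alpha (u + v) w = iph alpha u w + iph alpha v w.
Proof. by rewrite /iph mulmxDr mxE mulrDr. Qed.

Lemma iphZl c u v : iph alpha (c *: u) v = c * iph alpha u v.
Proof. by rewrite /iph -scalemxAr mxE mulrCA. Qed.

Lemma iph_conj u v : iph alpha v u = conjc (iph alpha u v).
Proof.
rewrite /iph -!/(adjmx _) conjcM (@conjc_real _ _%:C) ?complex_real//; congr (_ * _).
by rewrite -adjmxE (adjmxM _ u) [X in _ = (_ *m X) _ _](adjmxM (adjmx v)) adjmx_Wmx adjmxK mulmxA.
Qed.

Lemma iph_mulmx_adj A B u v : adjmx (W *m A) = W *m B ->
  iph alpha (A *m u) v = iph alpha u (B *m v).
Proof.
move=> AB; rewrite /iph -!/(adjmx _) adjmxM -mulmxA (mulmxA W A).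
by rewrite -(adjmxK (W *m A)) AB adjmxM adjmx_Wmx !mulmxA.
Qed.

Lemma iph_HDxmx u v : iph alpha (HDxmx alpha N *m u) v = iph alpha u (HDxmx alpha N *m v).
Proof.
apply: iph_mulmx_adj; rewrite Wmx_mul_HDxmx adjmxZ conjc_real ?realn//; congr (_ *: _).
by rewrite adjmxM [X in _ *m X]adjmxM adjmx_Hmx_mul_S1mx adjmxK mulmxA.
Qed.

Lemma iph_Dxmx u v : iph alpha (Dxmx alpha N *m u) v = - iph alpha u (Dxmx alpha N *m v).
Proof.
have -> : - iph alpha u (Dxmx alpha N *m v) = iph alpha u ((- Dxmx alpha N) *m v).
  rewrite mulNmx -[- (_ *m v)]scaleN1r [RHS]iph_conj iphZl conjcM (@conjc_real _ (-1)) ?realN ?real1// mulN1r.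
  by rewrite -iph_conj.
apply: iph_mulmx_adj; rewrite mulmxN Wmx_mul_Dxmx adjmxZ conjc_real ?realn// -scalerN.
congr (_ *: _); rewrite adjmxM [X in _ *m X]adjmxM adjmx_S1mx adjmxK mulmxA.
by rewrite mulmxN mulNmx.
Qed.

End discrete_operators.

(** * The energy of the discrete system *)

Section discrete_step.
Context {R : realType}.
Variables (alpha : R) (N m : nat) (C0 : R).
Hypothesis alpha_gt0 : 0 < alpha.
Hypothesis N_gt0 : (0 < N)%N.
Hypothesis m_gt0 : (0 < m)%N.
Implicit Types y z : 'cV[R[i]]_N * R[i].

Let HD := HDxmx alpha N.

(** Sesquilinear, so that it is Hermitian; the sum with its conjugate is then
    symmetric and bilinear over the real scalars, which include the
    coefficients of the method. *)
Definition energy_form y z : R[i] :=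
  2^-1 * iph alpha (HD *m y.1) z.1 - (m * m.+1)%:R^-1 * (y.2 * conjc z.2).

Lemma energy_formDl y1 y2 z : energy_form (y1 + y2) z = energy_form y1 z + energy_form y2 z.
Proof.
rewrite /energy_form mulmxDr iphDl.
have distr (A1 A2 k p q r : R[i]) : 2^-1 * (A1 + A2) - k * ((p + q) * r) =
  2^-1 * A1 - k * (p * r) + (2^-1 * A2 - k * (q * r)) by ring.
exact: distr.
Qed.

Lemma energy_formZl c y z : energy_form (c *: y) z = c * energy_form y z.
Proof.
rewrite /energy_form -scalemxAr iphZl.
have distr (A k p q : R[i]) : 2^-1 * (c * A) - k * (c * p * q) =
  c * (2^-1 * A - k * (p * q)) by ring.
exact: distr.
Qed.

Lemma energy_form_conj y z : energy_form z y = conjc (energy_form y z).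
Proof.
rewrite /energy_form conjcB [X in _ = X - _]conjcM -iph_conj !conjcM !conjcV !(@conjc_real _ _%:R) ?realn// conjcK.
by rewrite /HD -iph_HDxmx// (mulrC z.2).
Qed.

Lemma energyh_form y : y.2 \is Num.real ->
  energyh alpha m C0 y = energy_form y y + (m * m.+1)%:R^-1 * C0%:C.
Proof.
move=> y2; rewrite /energyh /energy_form (conjc_real y2) -/HD expr2.
by rewrite mulrBr opprB addrA addrAC.
Qed.

(** As for [energy_rate]: the left-hand side is minus the real part of the
    product of [g] and [k = - D g], and [D] is skew-adjoint. *)
Lemma energy_form_gboh_rhs y : y.2 \is Num.real -> 0 < radicandh alpha m C0 y.1 ->
  energy_form y (gboh_rhs alpha m C0 y) + conjc (energy_form y (gboh_rhs alpha m C0 y)) = 0.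
Proof.
move=> y2 r0; have c0 : 0 < sqrtC (radicandh alpha m C0 y.1) by rewrite sqrtC_gt0.
have cR := conjc_real (gtr0_real c0).
pose v := y.2; pose u := y.1; set c := sqrtC _ in c0 cR.
pose lam := m%:R^-1 * (v / c); pose g := - (HD *m u) + lam *: powv m u.
pose k := - (Dxmx alpha N *m g).
have lamR : conjc lam = lam.
  by rewrite /lam !conjcM !conjcV cR (conjc_real y2) conjc_real ?realn.
have -> : gboh_rhs alpha m C0 y = (k, m.+1%:R / (2 * c) * iph alpha (powv m u) k) by [].
have gk : iph alpha g k + conjc (iph alpha g k) = 0.
  have kE w : iph alpha k w = - iph alpha (Dxmx alpha N *m g) w.
    by rewrite /k -scaleN1r iphZl mulN1r.
  have kg : iph alpha k g = - iph alpha g k.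
    by rewrite kE iph_Dxmx// [iph alpha g k]iph_conj kE [iph _ g _]iph_conj conjcN.
  by have := iph_conj alpha g k; rewrite kg => <-; rewrite subrr.
have gE : iph alpha g k = - iph alpha (HD *m u) k + lam * iph alpha (powv m u) k.
  by rewrite /g -scaleN1r iphDl !iphZl mulN1r.
rewrite /energy_form /= -/u -/v; rewrite gE in gk.
move: (iph alpha (HD *m u) k) (iph alpha (powv m u) k) gk => X Z gk.
have n0 : m%:R != 0 :> R[i] by rewrite pnatr_eq0 -lt0n.
have n1 : m.+1%:R != 0 :> R[i] by rewrite pnatr_eq0.
have c_n0 : c != 0 by rewrite gt_eqF.
have -> : 2^-1 * X - (m * m.+1)%:R^-1 * (v * conjc (m.+1%:R / (2 * c) * Z)) =
    2^-1 * (- (- X + lam * Z) + lam * (Z - conjc Z)).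
  rewrite !conjcM conjcV conjcM cR !(@conjc_real _ _%:R) ?realn// natrM /lam.
  move: (m%:R : R[i]) (m.+1%:R : R[i]) (conjc Z) n0 n1 => p q Z' p0 q0.
  by field; rewrite p0 q0 c_n0.
rewrite conjcM conjcD conjcN conjcM lamR conjcB conjcK (@conjc_real _ 2^-1) ?realV ?realn//.
have cancel (p q l z w : R[i]) : p + q = 0 ->
    2^-1 * (- p + l * (z - w)) + 2^-1 * (- q + l * (w - z)) = 0.
  by move=> /eqP; rewrite addr_eq0 => /eqP ->; ring.
exact: cancel.
Qed.

Variables (tau : R) (s : nat) (a : 'M[R]_s) (b : 'rV[R]_s).
Hypothesis symp : symplectic a b.

Lemma rk_step_energyh (y0 y1 : 'cV[R[i]]_N * R[i]) (Y : 'I_s -> 'cV[R[i]]_N * R[i]) :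
  y0.2 \is Num.real -> y1.2 \is Num.real -> (forall i, (Y i).2 \is Num.real) ->
  (forall i, 0 < radicandh alpha m C0 (Y i).1) ->
  rk_step (map_mx (real_complex R) a) (map_mx (real_complex R) b) tau%:C
    (gboh_rhs alpha m C0) y0 Y y1 ->
  energyh alpha m C0 y1 = energyh alpha m C0 y0.
Proof.
move=> y0R y1R YR Ypos step; rewrite !energyh_form//; congr (_ + _).
pose B y z := energy_form y z + conjc (energy_form y z).
have BE y : B y y = 2 * energy_form y y.
  by rewrite /B -energy_form_conj mulr_natl mulr2n.
suff : B y1 y1 = B y0 y0.
  by rewrite !BE; apply: mulfI; rewrite pnatr_eq0.
have sympC : symplectic (map_mx (real_complex R) a) (map_mx (real_complex R) b).
  move=> i j; rewrite !mxE -(rmorphM (real_complex R) (b 0 i) (b 0 j)) -symp.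
  by rewrite rmorphD !rmorphM.
apply: (@rk_step_quadratic_invariant _ _ (fun=> True) (fun c : R[i] => conjc c = c) B
  I _ _ _ _ _ s _ _ _ _ y0 Y y1 sympC _ _ _ step) => //.
- by move=> y z _ _; rewrite /B -!energy_form_conj addrC.
- by move=> y y' z _ _ _; rewrite /B energy_formDl conjcD; ring.
- by move=> c y z cc _ _; rewrite /B energy_formZl conjcM cc; ring.
- by move=> i j; rewrite mxE conjc_real ?complex_real.
- by move=> i; rewrite mxE conjc_real ?complex_real.
- by rewrite conjc_real ?complex_real.
- by move=> i; exact: energy_form_gboh_rhs.
Qed.

End discrete_step.

Theorem gboh_rk_energy (R : realType) (m : nat) (tau C0 : R) (s : nat)
    (a : 'M[R]_s) (b : 'rV[R]_s) (alpha : R) (N T : nat)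
    (y : nat -> 'cV[R[i]]_N * R[i]) (Y : nat -> 'I_s -> 'cV[R[i]]_N * R[i]) :
  (1 <= m)%N -> symplectic a b -> 0 < alpha -> (0 < N)%N ->
  (forall n, (n <= T)%N -> (y n).2 \is Num.real) ->
  (forall n i, (n < T)%N -> (Y n i).2 \is Num.real) ->
  (forall n i, (n < T)%N -> 0 < radicandh alpha m C0 (Y n i).1) ->
  (forall n, (n < T)%N ->
    rk_step (map_mx (real_complex R) a) (map_mx (real_complex R) b) tau%:C
      (gboh_rhs alpha m C0) (y n) (Y n) (y n.+1)) ->
  forall n, (n <= T)%N -> energyh alpha m C0 (y n) = energyh alpha m C0 (y 0%N).
Proof.
move=> m0 symp al0 N0 yR YR Ypos step; elim=> // n IH nT; rewrite -(IH (ltnW nT)).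
exact: (rk_step_energyh al0 N0 m0 symp (yR n (ltnW nT)) (yR n.+1 nT) (YR n ^~ nT)
  (Ypos n ^~ nT) (step n nT)).
Qed.

Theorem theorem3p4 (R : realType) (m : nat) (tau C0 : R) (s : nat)
    (a : 'M[R]_s) (b : 'rV[R]_s) :
  (1 <= m)%N -> 0 < tau -> symplectic a b ->
  (forall (T : nat) (y : nat -> (R -> R) * R)
      (Y : nat -> 'I_s -> (R -> R) * R),
    (forall n, (n <= T)%N -> sobolev_oo (y n).1) ->
    (forall n i, (n < T)%N -> sobolev_oo (Y n i).1) ->
    improper_integrable (y 0%N).1 ->
    0 < radicand m C0 (y 0%N).1 ->
    (forall n i, (n < T)%N -> 0 < radicand m C0 (Y n i).1) ->
    (y 0%N).2 = Num.sqrt (radicand m C0 (y 0%N).1) ->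
    (forall n, (n < T)%N ->
      rk_step a b tau (gbo_rhs m C0) (y n) (Y n) (y n.+1)) ->
    forall n, (n < T)%N ->
      [/\ improper_integrable (y n).1,
          improper_integrable (y n.+1).1,
          improper_integral (y n.+1).1 = improper_integral (y n).1,
          mass (y n.+1).1 = mass (y n).1 &
          energy m C0 (y n.+1) = energy m C0 (y n)]) /\
  (forall (alpha : R) (N : nat), 0 < alpha -> (0 < N)%N -> ~~ odd N ->
    forall (T : nat) (y : nat -> 'cV[R[i]]_N * R[i])
      (Y : nat -> 'I_s -> 'cV[R[i]]_N * R[i]),
    (forall n, (n <= T)%N -> grid_vector (y n).1 /\ (y n).2 \is Num.real) ->
    (forall n i, (n < T)%N ->
      grid_vector (Y n i).1 /\ (Y n i).2 \is Num.real) ->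
    0 < radicandh alpha m C0 (y 0%N).1 ->
    (forall n i, (n < T)%N -> 0 < radicandh alpha m C0 (Y n i).1) ->
    (y 0%N).2 = sqrtC (radicandh alpha m C0 (y 0%N).1) ->
    (forall n, (n < T)%N ->
      rk_step (map_mx (real_complex R) a) (map_mx (real_complex R) b) tau%:C
        (gboh_rhs alpha m C0) (y n) (Y n) (y n.+1)) ->
    forall n, (n <= T)%N ->
      energyh alpha m C0 (y n) = energyh alpha m C0 (y 0%N)).
Proof.
move=> m0 tau0 symp; split.
  move=> T y Y Sy SY i0 _ pos _ step.
  exact: (gbo_rk_invariants m0 symp Sy SY i0 pos step).
move=> alpha N al0 N0 _ T y Y gy gY _ pos _ step.
apply: (gboh_rk_energy m0 symp al0 N0 _ _ pos step) => [n nT|n i nT].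
  by have [] := gy n nT.
by have [] := gY n i nT.
Qed.
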